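(* Let $(G,\Gamma)$ be a Hecke pair, $\mathcal{A}$ a Fell bundle over a discrete groupoid $X$, and $\alpha$ an action of $G$ on $\mathcal{A}$ which is $\Gamma$-good and satisfies the $\Gamma$-intersection property. If the Hecke algebra $\mathcal{H}(G,\Gamma)$ is a $BG^*$-algebra, then the full crossed product $C^*_{\tau}(\mathcal{A}/\Gamma)\times_{\alpha}G/\Gamma$ always exists, for any $\overline{\alpha}$-permissible $C^*$-norm $\|\cdot\|_{\tau}$ on $\mathcal{D}(\mathcal{A})$.
   Context: **Hecke pairs.** $(G,\Gamma)$ is a Hecke pair if $\Gamma\subseteq G$ is a subgroup such that every double coset $\Gamma g\Gamma$ is a finite union of left (and of right) cosets. $\Gamma^g:=\Gamma\cap g\Gamma g^{-1}$, $L(g)=|\Gamma g\Gamma/\Gamma|$, $R(g)=|\Gamma\backslash\Gamma g\Gamma|$, $\Delta(g)=L(g)/R(g)$. The Hecke algebra $\mathcal{H}(G,\Gamma)$ is the $*$-algebra of finitely supported functions on $\Gamma\backslash G/\Gamma$ with $(f_1*f_2)(\Gamma g\Gamma)=\sum_{h\Gamma\in G/\Gamma}f_1(\Gamma h\Gamma)f_2(\Gamma h^{-1}g\Gamma)$, $f^*(\Gamma g\Gamma)=\Delta(g^{-1})\overline{f(\Gamma g^{-1}\Gamma)}$. **$BG^*$-algebras.** A pre-$*$-representation of a $*$-algebra $B$ is a $*$-homomorphism from $B$ into the $*$-algebra $L(V)$ of (everywhere defined) adjointable linear operators on an inner product space $V$; it is normed if it takes values in bounded operators. $B$ is a $BG^*$-algebra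 if all its pre-$*$-representations are normed. **Fell bundles and actions.** $X$ has unit space $X^0$, source $\mathbf{s}$ and range $\mathbf{r}$. $C_c(\mathcal{A})$ is the $*$-algebra of finitely supported sections with $(f_1f_2)(z)=\sum_{z=xy}f_1(x)f_2(y)$, $f^*(z)=f(z^{-1})^*$; for $a\in\mathcal{A}_x$, $a_x$ is the section equal to $a$ at $x$ and $0$ elsewhere. An action $\alpha$ of $G$ on $\mathcal{A}$ consists of a right action $(x,g)\mapsto xg$ of $G$ on $X$ by groupoid automorphisms and bijections $\alpha_g:\mathcal{A}\to\mathcal{A}$ ($\alpha_{gh}=\alpha_g\alpha_h$, $\alpha_e=\mathrm{id}$) restricting to linear isometries $\mathcal{A}_x\to\mathcal{A}_{xg^{-1}}$ and preserving products and involution. For a subgroup $H\subseteq G$, $\alpha$ is $H$-good if for all $x\in X$, $h\in H$ with $\mathbf{s}(x)h=\mathbf{s}(x)$ one has $xh=x$ and $\alpha_h(a)=a$ for all $a\in\mathcal{A}_x$. It satisfies the $\Gamma$-intersection property if $u\Gamma\cap ug\Gamma g^{-1}=u\Gamma^g$ for all $u\in X^0$, $g\in G$. **Orbit bundle.** If $\alpha$ is $H$-good, put $H_{x,y}=\{h\in H:\mathbf{s}(x)h=\mathbf{r}(y)\}$. The orbit set $X/H$ is a groupoid: $(xH,yH)$ is composable iff $H_{x,y}\neq\emptyset$, and then $xH\cdot yH=(x\tilde h)yH$ for any $\tilde h\in H_{x,y}$; $(xH)^{-1}=x^{-1}H$. The set $\mathcal{A}/H$ of orbits $[a]$ is a Fell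 bundle over $X/H$ with fiber $\{[a]:a\in\mathcal{A}_x\}$ over $xH$ (linear structure and norm from $\mathcal{A}_x$), $[a][b]=[\alpha_{\tilde h^{-1}}(a)b]$, $[a]^*=[a^*]$. $[a]_{xH}\in C_c(\mathcal{A}/H)$ is the section with value $[a]$ at $xH$ and $0$ elsewhere. **Multipliers.** $M(C_c(\mathcal{A}))$ is the $*$-algebra of linear maps $T$ on $C_c(\mathcal{A})$ having an adjoint $T^*$, i.e. $(Tf_1)^*f_2=f_1^*(T^*f_2)$. $C_c(\mathcal{A}/H)$ is a $*$-subalgebra of it via $[a]_{xH}b_y=(\alpha_{\tilde h^{-1}}(a)b)_{(x\tilde h)y}$ if $\tilde h\in H_{x,y}\neq\emptyset$, and $0$ otherwise. $\overline{\alpha}_g$ is the automorphism $(\overline{\alpha}_gf)(x)=\alpha_g(f(xg))$ of $C_c(\mathcal{A})$, extended to $M(C_c(\mathcal{A}))$ by $T\mapsto\overline{\alpha}_gT\overline{\alpha}_g^{-1}$. Let $\mathcal{C}$ be the set of finite intersections of conjugates of $\Gamma$; $\mathcal{D}(\mathcal{A})\subseteq M(C_c(\mathcal{A}))$ is the $*$-subalgebra generated by all $C_c(\mathcal{A}/H)$, $H\in\mathcal{C}$; it is $\overline{\alpha}$-invariant. A $C^*$-norm on $\mathcal{D}(\mathcal{A})$ is $\overline{\alpha}$-permissible if every $\overline{\alpha}_g$ is continuous for it. **Crossed product.** $C_c(\mathcal{A}/\Gamma)\times^{alg}_{\alpha}G/\Gamma$ is the $*$-algebra of finitely supported $f:G/\Gamma\to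 M(C_c(\mathcal{A}))$ with $f(g\Gamma)\in C_c(\mathcal{A}/\Gamma^g)$ and $f(\gamma g\Gamma)=\overline{\alpha}_{\gamma}(f(g\Gamma))$ for $\gamma\in\Gamma$, with $(f_1*f_2)(g\Gamma)=\sum_{[h]\in G/\Gamma}f_1(h\Gamma)\overline{\alpha}_h(f_2(h^{-1}g\Gamma))$ and $f^*(g\Gamma)=\Delta(g^{-1})\overline{\alpha}_g(f(g^{-1}\Gamma))^*$. $C_c(\mathcal{A}/\Gamma)$ is identified with the functions supported on the coset $\Gamma$. **Full crossed product.** For an $\overline{\alpha}$-permissible norm $\|\cdot\|_\tau$ put $\|f\|_{\tau,u}=\sup_{\Phi}\|\Phi(f)\|\in[0,\infty]$, the supremum over all $*$-representations $\Phi$ (by bounded operators on Hilbert spaces) of $C_c(\mathcal{A}/\Gamma)\times^{alg}_\alpha G/\Gamma$ whose restriction to $C_c(\mathcal{A}/\Gamma)$ is continuous for $\|\cdot\|_\tau$. The full crossed product $C^*_\tau(\mathcal{A}/\Gamma)\times_\alpha G/\Gamma$ exists if $\|\cdot\|_{\tau,u}$ is a $C^*$-norm (equivalently, is finite everywhere), and is then the completion for this norm. *)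

(* Defs.v *)
From HB Require Import structures.
From mathcomp Require Import all_boot all_order all_algebra.
From mathcomp Require Import all_classical all_reals.
From mathcomp Require Import ereal topology normedtype.
From mathcomp Require Import complex finmap.

Set Implicit Arguments.
Unset Strict Implicit.
Unset Printing Implicit Defensive.

Import Order.TTheory GRing.Theory Num.Theory numFieldNormedType.Exports.
Local Open Scope fset_scope.
Local Open Scope classical_set_scope.
Local Open Scope ring_scope.
Local Open Scope quotient_scope.

Record subgroup (G : groupType) := Subgroup {
  sg_set :> set G;
  sg_one : sg_set 1%g;
  sg_mul : forall g h, sg_set g -> sg_set h -> sg_set (g * h)%g;
  sg_inv : forall g, sg_set g -> sg_set (g^-1)%g }.

Section Cosets.
Variables (G : groupType) (H : subgroup G).

Definition lcoset_rel : rel G := fun g k => `[< sg_set H (g^-1 * k)%g >].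
Definition rcoset_rel : rel G := fun g k => `[< sg_set H (k * g^-1)%g >].
Definition dcoset_set (g : G) : set G :=
  [set k | exists a b, [/\ sg_set H a, sg_set H b & k = (a * g * b)%g]].
Definition dcoset_rel : rel G := fun g k => `[< dcoset_set g k >].

Lemma lcoset_refl : reflexive lcoset_rel.
Proof. by move=> g; apply/asboolP; rewrite mulVg; exact: sg_one. Qed.
Lemma lcoset_sym : symmetric lcoset_rel.
Proof.
by move=> g k; apply/asboolP/asboolP => /sg_inv; rewrite invgM invgK.
Qed.
Lemma lcoset_trans : transitive lcoset_rel.
Proof.
move=> h g k /asboolP Hgh /asboolP Hhk; apply/asboolP.
by have := sg_mul Hgh Hhk; rewrite mulgA mulgK.
Qed.
Canonical lcoset_equiv := EquivRel lcoset_rel lcoset_refl lcoset_sym lcoset_trans.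

Lemma rcoset_refl : reflexive rcoset_rel.
Proof. by move=> g; apply/asboolP; rewrite mulgV; exact: sg_one. Qed.
Lemma rcoset_sym : symmetric rcoset_rel.
Proof.
by move=> g k; apply/asboolP/asboolP => /sg_inv; rewrite invgM invgK.
Qed.
Lemma rcoset_trans : transitive rcoset_rel.
Proof.
move=> h g k /asboolP Hgh /asboolP Hhk; apply/asboolP.
by have := sg_mul Hhk Hgh; rewrite mulgA mulgVK.
Qed.
Canonical rcoset_equiv := EquivRel rcoset_rel rcoset_refl rcoset_sym rcoset_trans.

Lemma dcoset_refl : reflexive dcoset_rel.
Proof.
move=> g; apply/asboolP; exists 1%g, 1%g.
by split; [exact: sg_one | exact: sg_one | rewrite mul1g mulg1].
Qed.
Lemma dcoset_sym : symmetric dcoset_rel.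
Proof.
suff S g k : dcoset_rel g k -> dcoset_rel k g by move=> g k; apply/idP/idP; exact: S.
move=> /asboolP[a [b [Ha Hb ->]]]; apply/asboolP; exists (a^-1)%g, (b^-1)%g.
by split; [exact: sg_inv | exact: sg_inv | rewrite !mulgA mulVg mul1g mulgK].
Qed.
Lemma dcoset_trans : transitive dcoset_rel.
Proof.
move=> h g k /asboolP[a [b [Ha Hb ->]]] /asboolP[c [d [Hc Hd ->]]].
apply/asboolP; exists (c * a)%g, (b * d)%g.
by split; [exact: sg_mul | exact: sg_mul | rewrite !mulgA].
Qed.
Canonical dcoset_equiv := EquivRel dcoset_rel dcoset_refl dcoset_sym dcoset_trans.

(* G/H, H\G and H\G/H *)
Definition lcosets := {eq_quot lcoset_equiv}.
HB.instance Definition _ := Choice.on lcosets.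
HB.instance Definition _ := EqQuotient.on lcosets.
Definition rcosets := {eq_quot rcoset_equiv}.
HB.instance Definition _ := Choice.on rcosets.
HB.instance Definition _ := EqQuotient.on rcosets.
Definition dcosets := {eq_quot dcoset_equiv}.
HB.instance Definition _ := Choice.on dcosets.
HB.instance Definition _ := EqQuotient.on dcosets.

Definition lcoset_of (g : G) : lcosets := \pi_lcosets g.
Definition rcoset_of (g : G) : rcosets := \pi_rcosets g.
Definition dcoset_of (g : G) : dcosets := \pi_dcosets g.

Definition Hecke_pair := forall g : G,
  finite_set (lcoset_of @` dcoset_set g) /\ finite_set (rcoset_of @` dcoset_set g).

Definition Hecke_L (g : G) : nat := #|` fset_set (lcoset_of @` dcoset_set g)|.
Definition Hecke_R (g : G) : nat := #|` fset_set (rcoset_of @` dcoset_set g)|.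
Definition Hecke_Delta (K : unitRingType) (g : G) : K :=
  (Hecke_L g)%:R / (Hecke_R g)%:R.

Definition conj_set (g : G) : set G := [set (g * h * g^-1)%g | h in H].

Lemma conj_set1 g : conj_set g 1%g.
Proof. by exists 1%g; [exact: sg_one | rewrite mulg1 mulgV]. Qed.
Lemma conj_setM g k l : conj_set g k -> conj_set g l -> conj_set g (k * l)%g.
Proof.
move=> [a Ha <-] [b Hb <-]; exists (a * b)%g; first exact: sg_mul.
by rewrite !mulgA mulgVK.
Qed.
Lemma conj_setV g k : conj_set g k -> conj_set g (k^-1)%g.
Proof.
move=> [a Ha <-]; exists (a^-1)%g; first exact: sg_inv.
by rewrite !invgM invgK mulgA.
Qed.

(* H^g = H ∩ g H g^-1 *)
Definition capconj (g : G) : subgroup G.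
Proof.
exists (H `&` conj_set g).
- by split; [exact: sg_one | exact: conj_set1].
- by move=> k l [? ?] [? ?]; split; [exact: sg_mul | exact: conj_setM].
- by move=> k [? ?]; split; [exact: sg_inv | exact: conj_setV].
Defined.

(* finite (nonempty) intersections of conjugates of H *)
Definition conj_cap (K : subgroup G) := exists (g0 : G) (gs : seq G),
  (K : set G) = \bigcap_(g in [set` g0 :: gs]) conj_set g.

End Cosets.

Section StarAlgebras.
Variable R : realType.
Local Notation C := R[i].

(* A *-algebra presented as a subset of an ambient complex vector space, with
   product and involution defined on the ambient space.  The algebraic laws and
   the stability of [sa_mem] are theorems about the instances used below; they
   are not recorded here. *)
Record star_algebra := StarAlgebra {
  sa_space :> lmodType C;
  sa_mem : set sa_space;
  sa_mul : sa_space -> sa_space -> sa_space;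
  sa_star : sa_space -> sa_space }.

Record inner_product_space := InnerProductSpace {
  ips_space :> lmodType C;
  ips_dot : {dot ips_space for (Num.conj : C -> C)} }.

Definition hnorm (V : inner_product_space) (v : V) : R :=
  Num.sqrt (complex.Re (ips_dot V v v)).

Definition complete_ips (V : inner_product_space) :=
  forall u : nat -> V,
    (forall e : R, 0 < e -> exists N, forall m n, (N <= m)%N -> (N <= n)%N ->
       hnorm (u m - u n) < e) ->
    exists l : V, forall e : R, 0 < e -> exists N, forall n, (N <= n)%N ->
       hnorm (u n - l) < e.

Definition adjoint_pair (V : inner_product_space) (T S : V -> V) :=
  forall v w, ips_dot V (T v) w = ips_dot V v (S w).

Definition adjointable (V : inner_product_space) (T : V -> V) :=
  linear T /\ exists S : V -> V, linear S /\ adjoint_pair T S.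

Definition bounded_op (V : inner_product_space) (T : V -> V) :=
  exists M : R, forall v, hnorm (T v) <= M * hnorm v.

Definition opnorm (V : inner_product_space) (T : V -> V) : \bar R :=
  ereal_sup [set (hnorm (T v))%:E | v in [set v : V | hnorm v <= 1]].

(* *-homomorphisms from B into the *-algebra L(V) of adjointable operators; only
   the values of pi on [sa_mem B] matter. *)
Definition pre_star_rep (B : star_algebra) (V : inner_product_space)
    (pi : B -> V -> V) :=
  [/\ forall b, sa_mem b -> adjointable (pi b),
      forall (c : C) b1 b2, sa_mem b1 -> sa_mem b2 ->
        forall v, pi (c *: b1 + b2) v = c *: pi b1 v + pi b2 v,
      forall b1 b2, sa_mem b1 -> sa_mem b2 ->
        forall v, pi (sa_mul b1 b2) v = pi b1 (pi b2 v)
    & forall b, sa_mem b -> adjoint_pair (pi b) (pi (sa_star b))].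

Definition normed_rep (B : star_algebra) (V : inner_product_space)
    (pi : B -> V -> V) := forall b, sa_mem b -> bounded_op (pi b).

Definition BG_star_algebra (B : star_algebra) :=
  forall (V : inner_product_space) (pi : B -> V -> V),
    pre_star_rep pi -> normed_rep pi.

Definition star_rep (B : star_algebra) (V : inner_product_space)
    (pi : B -> V -> V) := [/\ complete_ips V, pre_star_rep pi & normed_rep pi].

Definition Cstar_norm (B : star_algebra) (N : B -> R) :=
  [/\ forall b, sa_mem b -> 0 <= N b /\ (N b = 0 -> b = 0),
      forall (c : C) b, sa_mem b -> N (c *: b) = complex.Re `|c| * N b,
      forall b1 b2, sa_mem b1 -> sa_mem b2 -> N (b1 + b2) <= N b1 + N b2,
      forall b1 b2, sa_mem b1 -> sa_mem b2 -> N (sa_mul b1 b2) <= N b1 * N b2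
    & forall b, sa_mem b -> N (sa_mul (sa_star b) b) = N b ^+ 2].

End StarAlgebras.

Section HeckeAlgebra.
Variables (R : realType) (G : groupType) (Gam : subgroup G).
Local Notation C := R[i].

(* Formulas on G/Gam and Gam\G/Gam are evaluated at the chosen representative
   [repr]; for a Hecke pair they do not depend on it. *)
Definition Hecke_mul (f1 f2 : dcosets Gam -> C) : dcosets Gam -> C :=
  fun d => \sum_(c \in [set: lcosets Gam])
    f1 (dcoset_of Gam (repr c)) * f2 (dcoset_of Gam ((repr c)^-1 * repr d)%g).

Definition Hecke_star (f : dcosets Gam -> C) : dcosets Gam -> C :=
  fun d => Hecke_Delta Gam C ((repr d)^-1)%g *
           Num.conj (f (dcoset_of Gam ((repr d)^-1)%g)).

Definition Hecke_algebra : star_algebra R :=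
  @StarAlgebra R (dcosets Gam -> C)
    [set f | finite_set [set d | f d != 0]] Hecke_mul Hecke_star.

End HeckeAlgebra.

(* A discrete groupoid: units are identified with their identity arrows, and
   x * y is composable iff s(x) = r(y); [gpd_mul] is junk otherwise. *)
Record groupoid := Groupoid {
  gpd_car :> choiceType;
  src : gpd_car -> gpd_car;
  rng : gpd_car -> gpd_car;
  gpd_mul : gpd_car -> gpd_car -> gpd_car;
  gpd_inv : gpd_car -> gpd_car;
  src_src : forall x, src (src x) = src x;
  rng_src : forall x, rng (src x) = src x;
  src_rng : forall x, src (rng x) = rng x;
  rng_rng : forall x, rng (rng x) = rng x;
  src_mul : forall x y, src x = rng y -> src (gpd_mul x y) = src y;
  rng_mul : forall x y, src x = rng y -> rng (gpd_mul x y) = rng x;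
  gpd_mulA : forall x y z, src x = rng y -> src y = rng z ->
    gpd_mul (gpd_mul x y) z = gpd_mul x (gpd_mul y z);
  gpd_mul_src : forall x, gpd_mul x (src x) = x;
  gpd_mul_rng : forall x, gpd_mul (rng x) x = x;
  src_inv : forall x, src (gpd_inv x) = rng x;
  rng_inv : forall x, rng (gpd_inv x) = src x;
  gpd_mulV : forall x, gpd_mul x (gpd_inv x) = rng x;
  gpd_mulVx : forall x, gpd_mul (gpd_inv x) x = src x }.

Definition units (X : groupoid) : set X := [set u | src u = u].

(* Identities between elements of different fibers are stated in the total
   space {x & fib x}.  Positivity of a^* a in the C*-algebra A_{s(x)} is
   spelled as a^* a = b^* b with b in A_{s(x)}. *)
Record Fell_bundle (R : realType) (X : groupoid) := FellBundle {
  fib : X -> completeNormedModType R[i];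
  fmul : forall x y : X, fib x -> fib y -> fib (gpd_mul x y);
  fstar : forall x : X, fib x -> fib (gpd_inv x);
  fmul_linl : forall (x y : X) (b : fib y), src x = rng y ->
    linear (fun a : fib x => fmul a b);
  fmul_linr : forall (x y : X) (a : fib x), src x = rng y ->
    linear (fun b : fib y => fmul a b);
  fmulA : forall (x y z : X) (a : fib x) (b : fib y) (c : fib z),
    src x = rng y -> src y = rng z ->
    Tagged fib (fmul (fmul a b) c) = Tagged fib (fmul a (fmul b c));
  fmul_norm : forall (x y : X) (a : fib x) (b : fib y), src x = rng y ->
    `|fmul a b| <= `|a| * `|b|;
  fstar_conj : forall (x : X) (c : R[i]) (a b : fib x),
    fstar (c *: a + b) = Num.conj c *: fstar a + fstar b;
  fstarK : forall (x : X) (a : fib x), Tagged fib (fstar (fstar a)) = Tagged fib a;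
  fstar_mul : forall (x y : X) (a : fib x) (b : fib y), src x = rng y ->
    Tagged fib (fstar (fmul a b)) = Tagged fib (fmul (fstar b) (fstar a));
  fcstar : forall (x : X) (a : fib x), `|fmul (fstar a) a| = `|a| ^+ 2;
  fpos : forall (x : X) (a : fib x), exists b : fib (src x),
    Tagged fib (fmul (fstar a) a) = Tagged fib (fmul (fstar b) b) }.

Section Sections.
Variables (R : realType) (X : groupoid) (A : Fell_bundle R X).
Local Notation C := R[i].
Local Notation fib := (fib A).

Definition total_space := {x : X & fib x}.
HB.instance Definition _ := Choice.on total_space.

Definition in_fib (z : X) (u : total_space) : fib z := untag 0 (fun v : fib z => v) u.

Definition tmul (u v : total_space) : total_space := Tagged fib (fmul (tagged u) (tagged v)).

Definition sections := forall x : X, fib x.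
HB.instance Definition _ := gen_eqMixin sections.
HB.instance Definition _ := gen_choiceMixin sections.

Let sadd (f g : sections) : sections := fun x => f x + g x.
Let sopp (f : sections) : sections := fun x => - f x.
Let szero : sections := fun=> 0.
Let sscale (c : C) (f : sections) : sections := fun x => c *: f x.

Let saddA : associative sadd.
Proof. by move=> f g h; apply: functional_extensionality_dep => x; exact: addrA. Qed.
Let saddC : commutative sadd.
Proof. by move=> f g; apply: functional_extensionality_dep => x; exact: addrC. Qed.
Let sadd0 : left_id szero sadd.
Proof. by move=> f; apply: functional_extensionality_dep => x; exact: add0r. Qed.
Let saddN : left_inverse szero sopp sadd.
Proof. by move=> f; apply: functional_extensionality_dep => x; exact: addNr. Qed.
HB.instance Definition _ :=
  GRing.isZmodule.Build sections saddA saddC sadd0 saddN.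

Let sscaleA a b f : sscale a (sscale b f) = sscale (a * b) f.
Proof. by apply: functional_extensionality_dep => x; exact: scalerA. Qed.
Let sscale1 : left_id 1 sscale.
Proof. by move=> f; apply: functional_extensionality_dep => x; exact: scale1r. Qed.
Let sscaleDr : right_distributive sscale +%R.
Proof. by move=> a f g; apply: functional_extensionality_dep => x; exact: scalerDr. Qed.
Let sscaleDl f : {morph sscale^~ f : a b / a + b}.
Proof. by move=> a b; apply: functional_extensionality_dep => x; exact: scalerDl. Qed.
HB.instance Definition _ := GRing.Zmodule_isLmodule.Build C sections
  sscaleA sscale1 sscaleDr sscaleDl.

Definition finsupp : {pred sections} :=
  fun f => `[< finite_set [set x | f x != 0] >].

Lemma finsuppP (f : sections) :
  reflect (finite_set [set x | f x != 0]) (f \in finsupp).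
Proof. exact: asboolP. Qed.

Lemma finsupp_submod : submod_closed finsupp.
Proof.
split=> [|c f g /finsuppP Ff /finsuppP Fg].
  apply/finsuppP; rewrite (_ : [set _ | _] = set0) //.
  by apply/seteqP; split=> // x /=; rewrite eqxx.
apply/finsuppP; have : finite_set ([set x | f x != 0] `|` [set x | g x != 0]).
  by rewrite finite_setU.
apply: sub_finite_set => x /= fgx.
have [fx0|] := eqVneq (f x) 0; last by left.
right; apply: contra_neq fgx => gx0.
by rewrite -[LHS]/(c *: f x + g x) fx0 gx0 scaler0 addr0.
Qed.
HB.instance Definition _ := GRing.isSubmodClosed.Build C sections finsupp
  (GRing.submod_closed_semi finsupp_submod).

(* C_c(A) *)
Record Cc := MkCc { Cc_val :> sections; _ : Cc_val \in finsupp }.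
HB.instance Definition _ := [isSub for Cc_val].
HB.instance Definition _ := [Choice of Cc by <:].
HB.instance Definition _ := [SubChoice_isSubLmodule of Cc by <:].

Lemma Cc_finite (f : Cc) : finite_set [set x | Cc_val f x != 0].
Proof. by apply/finsuppP; case: f. Qed.

Lemma in_fib0 (z x : X) : in_fib z (Tagged fib (0 : fib x)) = 0.
Proof.
rewrite /in_fib /untag; case: eqP => // p.
by move: (p); rewrite /= in p *; case: _ / p => p; rewrite /etagged /= eq_axiomK.
Qed.

Lemma in_fib_neq0 (z : X) (u : total_space) : in_fib z u != 0 ->
  tag u = z /\ tagged u != 0.
Proof.
move=> uz; split.
  by apply/eqP; apply: contra_neqT uz => uz; exact: untag_dflt.
by apply: contra_neq uz; case: u => x a /= ->; exact: in_fib0.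
Qed.

Definition delta_sec (u : total_space) : sections := fun z => in_fib z u.
Lemma delta_finsupp u : delta_sec u \in finsupp.
Proof.
apply/finsuppP; apply: (@sub_finite_set _ _ [set tag u]); last exact: finite_set1.
by move=> z /in_fib_neq0[].
Qed.
(* the section a_x *)
Definition Cc_delta (u : total_space) : Cc := MkCc (delta_finsupp u).

Definition mul_sec (f1 f2 : sections) : sections := fun z =>
  \sum_(p \in [set p : X * X | src p.1 = rng p.2 /\ gpd_mul p.1 p.2 = z])
    in_fib z (tmul (Tagged fib (f1 p.1)) (Tagged fib (f2 p.2))).

Lemma fmul0r (x y : X) (b : fib y) : src x = rng y -> fmul (0 : fib x) b = 0.
Proof.
by move=> xy; have := fmul_linl b xy (-1) 0 0; rewrite scaler0 addr0 scaleN1r addNr.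
Qed.
Lemma fmulr0 (x y : X) (a : fib x) : src x = rng y -> fmul a (0 : fib y) = 0.
Proof.
by move=> xy; have := fmul_linr a xy (-1) 0 0; rewrite scaler0 addr0 scaleN1r addNr.
Qed.

Lemma mul_finsupp (f1 f2 : Cc) : mul_sec f1 f2 \in finsupp.
Proof.
apply/finsuppP.
apply: (@sub_finite_set _ _ [set gpd_mul p.1 p.2 | p in
   [set x | Cc_val f1 x != 0] `*` [set x | Cc_val f2 x != 0]]); last first.
  by apply: finite_image; apply: finite_setX; exact: Cc_finite.
move=> z /= nz; apply: contrapT => nex; move/eqP: nz; apply.
apply: fsbig1 => -[x y] [/= xy xyz]; apply/eqP/negPn/negP => /in_fib_neq0[_ /=].
move=> m0; apply: nex; exists (x, y) => //; split=> /=.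
  by apply: contra_neq m0 => ->; exact: fmul0r.
by apply: contra_neq m0 => ->; exact: fmulr0.
Qed.
Definition Cc_mul (f1 f2 : Cc) : Cc := MkCc (mul_finsupp f1 f2).

Definition star_sec (f : sections) : sections := fun z =>
  in_fib z (Tagged fib (fstar (f (gpd_inv z)))).
Lemma fstar0 (x : X) : fstar (0 : fib x) = 0.
Proof.
by have := fstar_conj (-1) (0 : fib x) 0; rewrite scaler0 addr0 rmorphN rmorph1 scaleN1r addNr.
Qed.
Lemma gpd_invK (x : X) : gpd_inv (gpd_inv x) = x.
Proof.
rewrite -[LHS]gpd_mul_src src_inv rng_inv -(gpd_mulVx x) -gpd_mulA; last 2 first.
- by rewrite src_inv.
- by rewrite src_inv.
by rewrite gpd_mulVx src_inv gpd_mul_rng.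
Qed.
Lemma star_finsupp (f : Cc) : star_sec f \in finsupp.
Proof.
apply/finsuppP; apply: (@sub_finite_set _ _ (@gpd_inv X @` [set x | Cc_val f x != 0])).
  move=> z /in_fib_neq0[_ /= fz]; exists (gpd_inv z); last exact: gpd_invK.
  by apply: contra_neq fz => ->; exact: fstar0.
by apply: finite_image; exact: Cc_finite.
Qed.
Definition Cc_star (f : Cc) : Cc := MkCc (star_finsupp f).

Definition mult_adjoint (T S : Cc -> Cc) :=
  forall f1 f2, Cc_mul (Cc_star (T f1)) f2 = Cc_mul (Cc_star f1) (S f2).

Definition multipliers : set (Cc -> Cc) :=
  [set T | linear T /\ exists S : Cc -> Cc, linear S /\ mult_adjoint T S].

(* T^*, which is unique; 0 if T has no adjoint *)
Definition mult_star (T : Cc -> Cc) : Cc -> Cc :=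
  xget 0 [set S | linear S /\ mult_adjoint T S].

Definition star_subalgebra (D : set (Cc -> Cc)) :=
  [/\ D `<=` multipliers, D 0,
      forall (c : C) S T, D S -> D T -> D (c *: S + T),
      forall S T, D S -> D T -> D (S \o T)
    & forall T, D T -> D (mult_star T)].

End Sections.

(* [gact x g] is x g; [bact g] is alpha_g restricted to the fibers. Bijectivity
   of alpha_g and of x |-> x g follow from the group laws. *)
Record Fell_action (R : realType) (G : groupType) (X : groupoid)
    (A : Fell_bundle R X) := FellAction {
  gact : X -> G -> X;
  gact1 : forall x, gact x 1%g = x;
  gactM : forall x g h, gact x (g * h)%g = gact (gact x g) h;
  gact_src : forall x g, src (gact x g) = gact (src x) g;
  gact_rng : forall x g, rng (gact x g) = gact (rng x) g;
  gact_mul : forall x y g, src x = rng y ->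
    gact (gpd_mul x y) g = gpd_mul (gact x g) (gact y g);
  bact : forall (g : G) (x : X), fib A x -> fib A (gact x (g^-1)%g);
  bact_linear : forall g x, linear (@bact g x);
  bact_norm : forall g x (a : fib A x), `|bact g a| = `|a|;
  bact1 : forall x (a : fib A x), Tagged (fib A) (bact 1%g a) = Tagged (fib A) a;
  bactM : forall g h x (a : fib A x),
    Tagged (fib A) (bact (g * h)%g a) = Tagged (fib A) (bact g (bact h a));
  bact_mul : forall g x y (a : fib A x) (b : fib A y), src x = rng y ->
    Tagged (fib A) (bact g (fmul a b)) = Tagged (fib A) (fmul (bact g a) (bact g b));
  bact_star : forall g x (a : fib A x),
    Tagged (fib A) (bact g (fstar a)) = Tagged (fib A) (fstar (bact g a)) }.

Section Action.
Variables (R : realType) (G : groupType) (X : groupoid) (A : Fell_bundle R X).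
Variable (alpha : Fell_action G A).
Local Notation C := R[i].
Local Notation fib := (fib A).
Local Notation gact := (gact alpha).
Local Notation bact := (bact alpha).
Local Notation Cc := (Cc A).

Definition tact (g : G) (u : total_space A) : total_space A := Tagged fib (bact g (tagged u)).

Definition good_action (H : subgroup G) := forall (x : X) (h : G), sg_set H h ->
  gact (src x) h = src x ->
  gact x h = x /\ forall a : fib x, Tagged fib (bact h a) = Tagged fib a.

Definition intersection_property (Gam : subgroup G) := forall (u : X) (g : G),
  units u ->
  [set gact u a | a in Gam] `&` [set gact u k | k in conj_set Gam g] =
  [set gact u a | a in capconj Gam g].

Definition act_sec (g : G) (f : sections A) : sections A := fun x =>
  in_fib x (Tagged fib (bact g (f (gact x g)))).
Lemma bact0 g (x : X) : bact g (0 : fib x) = 0.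
Proof.
by have := @bact_linear _ _ _ _ alpha g x (-1) 0 0; rewrite scaler0 addr0 scaleN1r addNr.
Qed.
Lemma act_finsupp g (f : Cc) : act_sec g f \in @finsupp R X A.
Proof.
apply/finsuppP.
apply: (@sub_finite_set _ _ [set gact x (g^-1)%g | x in [set x | Cc_val f x != 0]]).
  move=> x /in_fib_neq0[_ /= fx]; exists (gact x g); last first.
    by rewrite -gactM mulgV gact1.
  by apply: contra_neq fx => ->; exact: bact0.
by apply: finite_image; exact: Cc_finite.
Qed.
Definition Cc_act (g : G) (f : Cc) : Cc := MkCc (act_finsupp g f).

(* The inverse of the automorphism of g is that of g^-1. *)
Definition mult_act (g : G) (T : Cc -> Cc) : Cc -> Cc :=
  fun f => Cc_act g (T (Cc_act (g^-1)%g f)).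

Section Orbits.
Variable H : subgroup G.

Definition gorbit_rel : rel X := fun x y => `[< exists2 h, sg_set H h & y = gact x h >].
Definition forbit_rel : rel (total_space A) :=
  fun u v => `[< exists2 h, sg_set H h & v = tact h u >].

Lemma gorbit_refl : reflexive gorbit_rel.
Proof. by move=> x; apply/asboolP; exists 1%g; [exact: sg_one | rewrite gact1]. Qed.
Lemma gorbit_sym : symmetric gorbit_rel.
Proof.
suff S x y : gorbit_rel x y -> gorbit_rel y x by move=> x y; apply/idP/idP; exact: S.
move=> /asboolP[h Hh ->]; apply/asboolP; exists (h^-1)%g; first exact: sg_inv.
by rewrite -gactM mulgV gact1.
Qed.
Lemma gorbit_trans : transitive gorbit_rel.
Proof.
move=> y x z /asboolP[h Hh ->] /asboolP[k Hk ->]; apply/asboolP.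
by exists (h * k)%g; [exact: sg_mul | rewrite gactM].
Qed.
Canonical gorbit_equiv := EquivRel gorbit_rel gorbit_refl gorbit_sym gorbit_trans.

Lemma tact1 u : tact 1%g u = u.
Proof. by case: u => x a; exact: bact1. Qed.
Lemma tactM g h u : tact (g * h)%g u = tact g (tact h u).
Proof. by case: u => x a; exact: bactM. Qed.

Lemma forbit_refl : reflexive forbit_rel.
Proof. by move=> x; apply/asboolP; exists 1%g; [exact: sg_one | rewrite tact1]. Qed.
Lemma forbit_sym : symmetric forbit_rel.
Proof.
suff S x y : forbit_rel x y -> forbit_rel y x by move=> x y; apply/idP/idP; exact: S.
move=> /asboolP[h Hh ->]; apply/asboolP; exists (h^-1)%g; first exact: sg_inv.
by rewrite -tactM mulVg tact1.
Qed.
Lemma forbit_trans : transitive forbit_rel.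
Proof.
move=> y x z /asboolP[h Hh ->] /asboolP[k Hk ->]; apply/asboolP.
by exists (k * h)%g; [exact: sg_mul | rewrite tactM].
Qed.
Canonical forbit_equiv := EquivRel forbit_rel forbit_refl forbit_sym forbit_trans.

(* X/H and the total space A/H of the orbit bundle *)
Definition gorbits := {eq_quot gorbit_equiv}.
HB.instance Definition _ := Choice.on gorbits.
HB.instance Definition _ := EqQuotient.on gorbits.
Definition forbits := {eq_quot forbit_equiv}.
HB.instance Definition _ := Choice.on forbits.
HB.instance Definition _ := EqQuotient.on forbits.

Definition forbit_proj (o : forbits) : gorbits := \pi_gorbits (tag (repr o)).

(* Finitely supported sections of A/H; [a] is zero in its fiber iff a = 0, as
   alpha acts by linear isometries. *)
Definition orbit_sections : set (gorbits -> forbits) :=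
  [set sigma | (forall o, forbit_proj (sigma o) = o) /\
               finite_set [set o | tagged (repr (sigma o)) != 0]].

(* [a]_{xH} b_y, for u = (x, a) and v = (y, b); for an H-good action neither the
   choice of h in H_{x,y} nor that of u in its H-orbit matters. *)
Definition orbit_mul (u v : total_space A) : Cc :=
  match pselect (exists h, sg_set H h /\ gact (src (tag u)) h = rng (tag v)) with
  | left e => Cc_delta (tmul (tact ((sval (cid e))^-1)%g u) v)
  | right _ => 0
  end.

(* [a]_{xH} as an operator on C_c(A), extended linearly from the b_y, see
   [orbit_gen_delta] *)
Definition orbit_gen (u : total_space A) (f : Cc) : Cc :=
  \sum_(y \in [set: X]) orbit_mul u (Tagged fib (Cc_val f y)).

Lemma Cc_delta0 (x : X) : Cc_delta (Tagged fib (0 : fib x)) = 0.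
Proof.
by apply: val_inj; apply: functional_extensionality_dep => z; exact: in_fib0.
Qed.

Lemma orbit_mul0 u (y : X) : orbit_mul u (Tagged fib (0 : fib y)) = 0.
Proof.
rewrite /orbit_mul; case: pselect => // e; case: (cid e) => h [Hh /= hs].
rewrite /tmul /= fmulr0 ?Cc_delta0 //.
by rewrite gact_src invgK.
Qed.

Lemma orbit_gen_delta u v : orbit_gen u (Cc_delta v) = orbit_mul u v.
Proof.
rewrite /orbit_gen -(@fsbig_widen _ _ _ _ [set tag v]) //; last first.
  move=> y [_ /= /eqP yv] /=; rewrite /delta_sec /in_fib untag_dflt ?orbit_mul0 //.
  by rewrite eq_sym.
rewrite fsbig_set1; case: v => y b /=; congr (orbit_mul u (Tagged fib _)).
by rewrite /delta_sec /in_fib /untag; case: eqP => // p; rewrite /etagged /= eq_axiomK.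
Qed.

(* sigma is the sum of the [a]_{xH}, [a] = sigma (xH) *)
Definition orbit_op (sigma : gorbits -> forbits) : Cc -> Cc :=
  fun f => \sum_(o \in [set: gorbits]) orbit_gen (repr (sigma o)) f.

Definition Cc_orbit : set (Cc -> Cc) := orbit_op @` orbit_sections.

End Orbits.

Section CrossedProduct.
Variable Gam : subgroup G.

(* D(A) *)
Definition DA_set : set (Cc -> Cc) :=
  smallest (@star_subalgebra R X A)
    [set T | exists K : subgroup G, conj_cap Gam K /\ Cc_orbit K T].

Definition DA : star_algebra R :=
  @StarAlgebra R (Cc -> Cc) DA_set (fun S T => S \o T) (@mult_star R X A).

Definition permissible_Cstar_norm (tau : (Cc -> Cc) -> R) :=
  @Cstar_norm R DA tau /\
  forall g T, DA_set T -> forall e : R, 0 < e -> exists2 d : R, 0 < d &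
    forall S, DA_set S -> tau (S - T) < d ->
      tau (mult_act g S - mult_act g T) < e.

Definition cp_mem : set (lcosets Gam -> Cc -> Cc) :=
  [set f | [/\ finite_set [set c | f c != 0],
      forall g, Cc_orbit (capconj Gam g) (f (lcoset_of Gam g))
    & forall gam g, sg_set Gam gam ->
        f (lcoset_of Gam (gam * g)%g) = mult_act gam (f (lcoset_of Gam g))]].

Definition cp_mul (f1 f2 : lcosets Gam -> Cc -> Cc) : lcosets Gam -> Cc -> Cc :=
  fun c => \sum_(d \in [set: lcosets Gam])
    (f1 d \o mult_act (repr d) (f2 (lcoset_of Gam ((repr d)^-1 * repr c)%g))).

Definition cp_star (f : lcosets Gam -> Cc -> Cc) : lcosets Gam -> Cc -> Cc :=
  fun c => Hecke_Delta Gam C ((repr c)^-1)%g *: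
    mult_star (mult_act (repr c) (f (lcoset_of Gam ((repr c)^-1)%g))).

Definition crossed_product : star_algebra R :=
  @StarAlgebra R (lcosets Gam -> Cc -> Cc) cp_mem cp_mul cp_star.

(* C_c(A/Gamma) inside the crossed product *)
Definition cp_incl (T : Cc -> Cc) : crossed_product :=
  fun c => if c == lcoset_of Gam 1%g then T else 0.

Definition tau_continuous (tau : (Cc -> Cc) -> R) (V : inner_product_space R)
    (Phi : crossed_product -> V -> V) :=
  forall T, Cc_orbit Gam T -> forall e : R, 0 < e -> exists2 d : R, 0 < d &
    forall S, Cc_orbit Gam S -> tau (S - T) < d ->
      (opnorm (fun v => Phi (cp_incl S) v - Phi (cp_incl T) v)%R < e%:E)%E.

Definition norm_tau_u (tau : (Cc -> Cc) -> R) (f : crossed_product) : \bar R :=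
  ereal_sup [set r | exists (V : inner_product_space R)
      (Phi : crossed_product -> V -> V),
    [/\ star_rep Phi, tau_continuous tau Phi & r = opnorm (Phi f)]].

Definition full_crossed_product_exists (tau : (Cc -> Cc) -> R) :=
  (forall f : crossed_product, sa_mem f -> norm_tau_u tau f \is a fin_num) /\
  @Cstar_norm R crossed_product (fun f => fine (norm_tau_u tau f)).

End CrossedProduct.
End Action.

(* Main.v *)
Require Import Defs.
From HB Require Import structures.
From mathcomp Require Import all_boot all_order all_algebra.
From mathcomp Require Import all_classical all_reals.
From mathcomp Require Import ereal topology normedtype.
From mathcomp Require Import complex.
From mathcomp Require Import finmap ring lra.

Set Implicit Arguments.
Unset Strict Implicit.
Unset Printing Implicit Defensive.

Import Order.TTheory GRing.Theory Num.Theory numFieldNormedType.Exports.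
Local Open Scope classical_set_scope.
Local Open Scope ring_scope.

(** The proof has two halves: the universal norm is finite, and it vanishes only at 0.
    Both use that the crossed product lies in the algebra of all finitely supported
    equivariant functions on G / Gam with multipliers as values ([cp_memP]). This
    larger algebra contains the Hecke algebra, acting by scalars, and the
    restrictions 1_U to Gam-invariant sets U of units.

    Finiteness. A vector v of a tau-continuous representation Phi defines the positive
    functional f |-> < Phi f v, v > and hence a semi-inner product on the crossed
    product, on which C_c(A / Gam) acts with norm at most tau ([rep_base_contractive])
    and 1_U as a projection. An element of the Hecke algebra acts as well, by left
    multiplication, and has a bound that is the same for all these semi-inner
    products: otherwise the direct sum of a sequence of them would carry an unbounded
    pre-representation of the Hecke algebra ([Hecke_uniform_bound]). By the
    intersection property every element of the crossed product is a finite sum of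
    products T * 1_d * 1_U, with T in C_c(A / Gam) and d a double coset
    ([elementary_orbit_part]). So its norm is bounded uniformly in Phi
    ([rep_uniform_bound]).

    Definiteness. A positive functional phi on D(A) gives the positive functional
    f |-> phi (f(Gam)) on the crossed product ([base_cp_functional]). The action of G does
    not increase tau on C_c(A / Gam) ([tau_act_le]), so if phi is a state for tau then
    this functional is dominated by tau, and by the first half its GNS
    representation is bounded and tau-continuous ([functional_representation]).
    There are enough such phi because tau is a C*-norm, even though D(A) need not
    be complete or unital ([DA_state]): the norm of left
    multiplication is a C*-seminorm on the unitization, the infimum of
    p (h + t) - t over t >= 0 is a sublinear substitute for the largest point of the
    spectrum of h, and the linear functionals below it are states ([state_exists]).

    The C*-identity and the other laws pass from the operator norms to their
    supremum. *)

(** * The Hahn-Banach theorem for sublinear functionals *)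

Section HahnBanach.
Variables (R : realType) (V : lmodType R).
Implicit Types (p q : V -> R) (x y : V).

Definition sublinear p :=
  (forall x y, p (x + y) <= p x + p y) /\
  (forall t x, 0 <= t -> p (t *: x) = t * p x).

Lemma sublinear0 p : sublinear p -> p 0 = 0.
Proof. by move=> [_ h]; rewrite -(scale0r 0) h // mul0r. Qed.

Lemma sublinearN p x : sublinear p -> - p (- x) <= p x.
Proof.
move=> sp; have [a _] := sp; have := a x (- x).
by rewrite subrr (sublinear0 sp); lra.
Qed.

(** Lowering p along x0: the result is still sublinear, and it has the value
    - p x0 at - x0, so that a linear functional below it takes the value p x0 at x0. *)
Definition slope_inf p x0 x : R :=
  inf [set p (x + t *: x0) - t * p x0 | t in [set t : R | 0 <= t]].

Section SlopeInf.
Variables (p : V -> R) (x0 : V).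
Hypothesis sp : sublinear p.

Let slope_lb x : lbound [set p (x + t *: x0) - t * p x0 | t in [set t : R | 0 <= t]]
  (- p (- x)).
Proof.
move=> _ [t /= t0 <-]; have [a h] := sp; rewrite -(h _ _ t0).
by have := a (x + t *: x0) (- x); rewrite addrAC subrr add0r; lra.
Qed.

Lemma slope_inf_le x t : 0 <= t -> slope_inf p x0 x <= p (x + t *: x0) - t * p x0.
Proof.
by move=> t0; apply: ge_inf; [exists (- p (- x)); exact: slope_lb | exists t].
Qed.

Lemma le_slope_inf x c :
  (forall t, 0 <= t -> c <= p (x + t *: x0) - t * p x0) -> c <= slope_inf p x0 x.
Proof.
move=> H; apply: lb_le_inf; first by exists (p (x + 0 *: x0) - 0 * p x0), 0 => /=.
by move=> _ [t /= t0 <-]; exact: H.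
Qed.

Lemma slope_inf_le_id x : slope_inf p x0 x <= p x.
Proof. by have := @slope_inf_le x 0 (lexx _); rewrite scale0r addr0 mul0r subr0. Qed.

Lemma slope_inf_opp : slope_inf p x0 (- x0) <= - p x0.
Proof.
have := @slope_inf_le (- x0) 1 ler01.
by rewrite scale1r addNr (sublinear0 sp) mul1r sub0r.
Qed.

Lemma slope_inf_sublinear : sublinear (slope_inf p x0).
Proof.
have [a h] := sp.
have hom t x : 0 < t -> t * slope_inf p x0 x <= slope_inf p x0 (t *: x).
  move=> t0; apply: le_slope_inf => s s0.
  have -> : p (t *: x + s *: x0) - s * p x0 =
      t * (p (x + (s / t) *: x0) - (s / t) * p x0).
    have e : t * (s / t) = s by rewrite mulrCA mulfV ?gt_eqF // mulr1.
    by rewrite mulrBr -(h t (_ + _)) ?ltW // scalerDr scalerA e mulrA e.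
  by rewrite ler_pM2l //; apply: slope_inf_le; rewrite divr_ge0 // ltW.
split=> [x y|t x].
  rewrite -lerBlDl; apply: le_slope_inf => s s0.
  rewrite lerBlDr -lerBlDl; apply: le_slope_inf => t t0.
  rewrite lerBlDr; apply: (le_trans (slope_inf_le _ (addr_ge0 t0 s0))).
  rewrite scalerDl addrACA.
  by have := a (x + t *: x0) (y + s *: x0); lra.
rewrite le_eqVlt => /predU1P[<-|t0].
  rewrite scale0r mul0r; apply/eqP; rewrite eq_le; apply/andP; split.
    by rewrite -(sublinear0 sp) slope_inf_le_id.
  by apply: le_slope_inf => s s0; rewrite add0r h // subrr.
apply/eqP; rewrite eq_le hom // andbT.
rewrite -ler_pdivrMl //; apply: le_trans (hom _ _ _) _; first by rewrite invr_gt0.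
by rewrite scalerA mulVf ?gt_eqF // scale1r.
Qed.

End SlopeInf.

(** A minimal sublinear functional is linear, because it is not changed by
    passing to its slopes in any direction; minimal ones exist by Zorn's lemma,
    infima of chains of sublinear functionals being sublinear. *)
Lemma linear_below_sublinear p : sublinear p -> exists f : V -> R,
  linear_for *%R f /\ forall x, f x <= p x.
Proof.
move=> sp.
pose T := {q : V -> R | sublinear q /\ forall x, q x <= p x}.
pose below (q q' : T) := `[< forall x, sval q' x <= sval q x >].
have [||||[f [sf fp]] fmin] := @Zorn T below.
- by move=> q; apply/asboolP.
- move=> q1 q2 q3 /asboolP h1 /asboolP h2; apply/asboolP => x.
  exact: le_trans (h1 x).
- move=> [q1 s1] [q2 s2] /asboolP /= h1 /asboolP /= h2; apply: eq_exist.
  by apply/funext => x; apply: le_anti; rewrite h1 h2.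
- move=> A tot; have [[q0 Aq0]|nA] := pselect (exists q : T, A q); last first.
    by exists (exist _ p (conj sp (fun=> lexx _)) : T) => q Aq; case: nA; exists q.
  pose r x := inf [set sval (q : T) x | q in A].
  have lbr x : lbound [set sval (q : T) x | q in A] (- p (- x)).
    move=> _ [[q [sq qp]] Aq <-] /=; apply: le_trans (sublinearN x sq).
    by rewrite lerN2.
  have r_le (q : T) x : A q -> r x <= sval q x.
    by move=> Aq; apply: ge_inf; [exists (- p (- x)) | exists q].
  have le_r x c : (forall q : T, A q -> c <= sval q x) -> c <= r x.
    move=> H; apply: lb_le_inf; first by exists (sval q0 x), q0.
    by move=> _ [q Aq <-]; exact: H.
  have sr : sublinear r.
    split=> [x y|t x t0].
      rewrite -lerBlDl; apply: (le_r) => q1 A1; rewrite lerBlDr -lerBlDl.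
      apply: (le_r) => q2 A2; rewrite lerBlDr.
      have [/asboolP le12|/asboolP le21] := tot _ _ A1 A2.
        apply: (le_trans (r_le _ _ A2)); have [a _] := proj1 (svalP q2).
        by have := a x y; have := le12 y; lra.
      apply: (le_trans (r_le _ _ A1)); have [a _] := proj1 (svalP q1).
      by have := a x y; have := le21 x; lra.
    apply/eqP; rewrite eq_le; apply/andP; split; last first.
      apply: (le_r) => q Aq; have [_ ->] := proj1 (svalP q) => //.
      by rewrite ler_wpM2l // r_le.
    move: t0; rewrite [0 <= t]le_eqVlt => /predU1P[<-|t0].
      rewrite scale0r mul0r; apply: (le_trans (r_le _ _ Aq0)).
      by rewrite (sublinear0 (proj1 (svalP q0))).
    rewrite -ler_pdivrMl //; apply: (le_r) => q Aq.
    rewrite ler_pdivrMl //; have [_ <-] := proj1 (svalP q); last exact: ltW.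
    exact: r_le.
  have rp x : r x <= p x by apply: (le_trans (r_le _ _ Aq0)); have [_ ->] := svalP q0.
  exists (exist _ r (conj sr rp) : T) => q Aq; apply/asboolP => x /=; exact: r_le.
have oddf x : f (- x) = - f x.
  have sl := @slope_inf_sublinear f x sf.
  have slp y : slope_inf f x y <= p y by apply: (le_trans (slope_inf_le_id _ sf _)).
  have /(congr1 sval) /= <- : exist _ _ (conj sl slp) = exist _ f (conj sf fp) :> T.
    by apply: fmin; apply/asboolP => y /=; exact: slope_inf_le_id.
  apply/eqP; rewrite eq_le; apply/andP; split; last first.
    by rewrite lerNl; apply: sublinearN.
  apply: (le_trans (slope_inf_opp _ sf)); rewrite lerN2; exact: slope_inf_le_id.
have addf x y : f (x + y) = f x + f y.
  have [a h] := sf; apply/eqP; rewrite eq_le a /=.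
  by have := a (- x) (- y); rewrite -opprD !oddf; lra.
exists f; split=> // c x y; rewrite addf; congr (_ + _).
have [_ h] := sf; have [c0|c0] := leP 0 c; first exact: h.
by rewrite -[c in LHS]opprK scaleNr oddf h ?oppr_ge0 ?(ltW c0) //= mulNr opprK.
Qed.

Lemma Hahn_Banach p x0 : sublinear p -> exists f : V -> R,
  [/\ linear_for *%R f, forall x, f x <= p x & f x0 = p x0].
Proof.
move=> sp; have [f [lf fp]] := linear_below_sublinear (slope_inf_sublinear x0 sp).
have fp' x : f x <= p x by apply: le_trans (fp x) (slope_inf_le_id _ sp _).
exists f; split=> //; apply/eqP; rewrite eq_le fp' /=.
have f0 : f 0 = 0 by have := lf (-1) 0 0; rewrite scaler0 addr0; lra.
have fN : f (- x0) = - f x0.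
  by have := lf (-1) x0 0; rewrite scaleN1r addr0 f0 mulN1r addr0.
by rewrite -lerN2 -fN; apply: le_trans (fp _) (slope_inf_opp _ sp).
Qed.

End HahnBanach.

(** * Elementary inequalities *)

Section RealInequalities.
Variable R : realType.
Implicit Types x y K : R.

(** Bernoulli's inequality makes the powers of a ratio larger than 1 unbounded,
    so the constant is lost in the limit. *)
Lemma le_of_pow2_le x y K : 0 <= y ->
  (forall n, x ^+ (2 ^ n) <= K * y ^+ (2 ^ n)) -> x <= y.
Proof.
move=> y0 H; rewrite leNgt; apply/negP => yx.
have x0 : 0 < x by exact: le_lt_trans yx.
have [y00|yneq] := eqVneq y 0.
  have := H 0%N; rewrite y00 expn0 !expr1 mulr0; lra.
have yp : 0 < y by rewrite lt_def yneq.
pose d := x / y - 1.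
have d0 : 0 < d by rewrite subr_gt0 ltr_pdivlMr // mul1r.
have Bern n : 1 + n%:R * d <= (x / y) ^+ n.
  elim: n => [|n IH]; first by rewrite mul0r addr0 expr0.
  have e : x / y = 1 + d by rewrite /d addrC subrK.
  rewrite exprS; rewrite e in IH *.
  have n0 : 0 <= n%:R :> R by [].
  apply: le_trans (_ : (1 + d) * (1 + n%:R * d) <= _); last first.
    by rewrite ler_pM2l //; lra.
  by rewrite -natr1; nra.
have Hn n : 1 + n%:R * d <= K.
  have n2 : (n <= 2 ^ n)%N by apply: ltnW; exact: ltn_expl.
  apply: le_trans (_ : 1 + (2 ^ n)%:R * d <= _).
    by rewrite lerD2l ler_pM2r // ler_nat.
  apply: (le_trans (Bern _)); rewrite expr_div_n ler_pdivrMr ?exprn_gt0 //.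
pose N := Num.truncn (K / d).
have := Hn N.+1; have : K / d < N.+1%:R.
  by have := @truncnS_gt R (K / d).
by rewrite ltr_pdivrMr // => H1 H2; lra.
Qed.

Lemma discriminant_le x y K : (forall t, 0 <= x + 2 * t * y + t ^+ 2 * K) ->
  y ^+ 2 <= x * K.
Proof.
move=> H; have [K0|Kneq] := eqVneq K 0.
  have [y0|yneq] := eqVneq y 0; first by rewrite y0 K0 mulr0 expr0n.
  have := H (- (x + 1) / (2 * y)).
  have -> : x + 2 * (- (x + 1) / (2 * y)) * y + (- (x + 1) / (2 * y)) ^+ 2 * K = -1.
    by rewrite K0; field.
  lra.
have := H (- y / K).
have -> : x + 2 * (- y / K) * y + (- y / K) ^+ 2 * K = x - y ^+ 2 / K by field.
have K0 : 0 < K.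
  rewrite lt_def Kneq /= leNgt; apply/negP => Kn.
  have x0 : 0 <= x by have := H 0; rewrite mulr0 mul0r addr0 expr0n mul0r addr0.
  have e t : x + 2 * t * y + t ^+ 2 * K = x + t * (2 * y + t * K) by ring.
  pose t := (2 * `|y| + x + 1) / - K + 1.
  have tK : t * K = - (2 * `|y| + x + 1) + K by rewrite /t; field.
  have t1 : 1 <= t.
    rewrite /t lerDr divr_ge0 ?oppr_ge0 ?(ltW Kn) //.
    by have := normr_ge0 y; lra.
  have := H t; rewrite e tK; have := ler_norm y; have := normr_ge0 y; nra.
by rewrite subr_ge0 ler_pdivrMr.
Qed.

(** The standard bootstrap of the Cauchy-Schwarz inequality: applied to the
    moments of an operator, it bounds the first moment by the spectral radius. *)
Lemma moment_bound (F : nat -> R) (q K : R) : 0 <= q -> 0 <= F 0%N ->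
  (forall j, F j ^+ 2 <= F 0%N * F (2 * j)%N) ->
  (forall j, F j <= K * q ^+ j) -> F 1%N <= q * F 0%N.
Proof.
move=> q0 F0 CS FK; have [F00|Fneq] := eqVneq (F 0%N) 0.
  have := CS 1%N; rewrite F00 mul0r mulr0 => F1; have := sqr_ge0 (F 1%N) => F1'.
  have /eqP : F 1%N ^+ 2 = 0 by lra.
  by rewrite expf_eq0 /= => /eqP ->.
have Fp : 0 < F 0%N by rewrite lt_def Fneq.
rewrite -ler_pdivrMr //; apply: (@le_of_pow2_le _ _ (K / F 0%N)) => // n.
suff H : (F 1%N / F 0%N) ^+ (2 ^ n) <= F (2 ^ n)%N / F 0%N.
  apply: (le_trans H); rewrite mulrAC ler_pM2r ?invr_gt0 //.
elim: n => [|n IH]; first by rewrite expn0 expr1.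
have [n0|n0] := posnP n.
  rewrite n0 expn1 expr_div_n ler_pdivrMr ?exprn_gt0 // mulrAC -mulrA.
  have := CS 1%N; rewrite muln1.
  have -> : F 0%N ^+ 2 / F 0%N = F 0%N by field.
  by rewrite mulrC.
rewrite expnS mulnC exprM.
have pos : 0 <= (F 1%N / F 0%N) ^+ (2 ^ n).
  by case: n n0 {IH} => // n _; rewrite expnS exprM exprn_ge0 // sqr_ge0.
apply: le_trans (_ : (F (2 ^ n)%N / F 0%N) ^+ 2 <= _).
  by rewrite !expr2; apply: ler_pM.
rewrite expr_div_n ler_pdivrMr ?exprn_gt0 //.
have := CS (2 ^ n)%N; rewrite mulnC.
have -> : F (2 ^ n * 2)%N / F 0%N * F 0%N ^+ 2 = F 0%N * F (2 ^ n * 2)%N by field.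
by [].
Qed.

End RealInequalities.

(** * States of a C*-seminormed algebra *)

Lemma cubic_step (S : comNzRingType) (x : S) (n c : nat) :
  (1 + x *+ n + x ^+ 2 *+ c) * (1 + x) =
  1 + x *+ n.+1 + x ^+ 2 *+ (c + n) + x ^+ 3 *+ c.
Proof.
rewrite -(mulr_natr x n) -(mulr_natr x n.+1) -!(mulr_natr (x ^+ 2)).
by rewrite -(mulr_natr (x ^+ 3)) natrD -natr1; ring.
Qed.

Lemma fourth_roots_filter (S : comNzRingType) (x j : S) : j ^+ 2 = -1 ->
  (1 + x) ^+ 4 - (1 - x) ^+ 4 - j * ((1 + j * x) ^+ 4 - (1 - j * x) ^+ 4) =
  x *+ 16.
Proof.
move=> hj; rewrite -[RHS]mulr_natr.
have -> : (1 + x) ^+ 4 - (1 - x) ^+ 4 - j * ((1 + j * x) ^+ 4 - (1 - j * x) ^+ 4)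
  = 8 * x + 8 * x ^+ 3 - 8 * j ^+ 2 * x - 8 * (j ^+ 2) ^+ 2 * x ^+ 3 by ring.
by rewrite hj; ring.
Qed.

Section CstarSeminorm.
Variables (R : realType) (U : algType R[i]) (st : U -> U) (p : U -> R).
Local Notation C := R[i].
Local Notation iu := ('i : C).
Implicit Types x y a h k : U.

(** U as a real vector space, for the real Hahn-Banach theorem. *)
Definition real_scalars : Type := U.
HB.instance Definition _ := GRing.Zmodule.on real_scalars.
Let rscale (t : R) (x : real_scalars) : real_scalars := (t%:C)%C *: (x : U).
Let rscaleA s t x : rscale s (rscale t x) = rscale (s * t) x.
Proof. by rewrite /rscale scalerA rmorphM. Qed.
Let rscale1 : left_id 1 rscale.
Proof. by move=> x; rewrite /rscale rmorph1 scale1r. Qed.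
Let rscaleDr : right_distributive rscale +%R.
Proof. by move=> t x y; exact: scalerDr. Qed.
Let rscaleDl x : {morph rscale^~ x : s t / s + t}.
Proof. by move=> s t; rewrite /rscale rmorphD scalerDl. Qed.
HB.instance Definition _ := GRing.Zmodule_isLmodule.Build R real_scalars
  rscaleA rscale1 rscaleDr rscaleDl.

Local Notation "t *r x" := ((t%:C)%C *: (x : U)) (at level 40).

Hypotheses (stD : forall x y, st (x + y) = st x + st y)
  (stM : forall x y, st (x * y) = st y * st x)
  (stK : involutive st)
  (stZ : forall c x, st (c *: x) = Num.conj c *: st x).
Hypotheses (pD : forall x y, p (x + y) <= p x + p y)
  (pM : forall x y, p (x * y) <= p x * p y)
  (pZ : forall c x, p (c *: x) = complex.Re `|c| * p x)
  (pC : forall x, p (st x * x) = p x ^+ 2)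
  (p1 : p 1 = 1).

Lemma pZr t x : p (t *r x) = `|t| * p x.
Proof. by rewrite pZ normc_def /= expr0n addr0 sqrtr_sqr. Qed.

Lemma p0 : p 0 = 0.
Proof. by rewrite -(scale0r 0) pZ normr0 mul0r. Qed.

Lemma pN x : p (- x) = p x.
Proof. by rewrite -scaleN1r pZ normrN1 mul1r. Qed.

Lemma pB x y : p (x - y) <= p x + p y.
Proof. by rewrite -(pN y). Qed.

Lemma p_ge0 x : 0 <= p x.
Proof. by have := pB x x; rewrite subrr p0; lra. Qed.

Lemma pMn x n : p (x *+ n) = n%:R * p x.
Proof.
have -> : x *+ n = (n%:R : R) *r x by rewrite rmorph_nat scaler_nat.
by rewrite pZr ger0_norm.
Qed.

Lemma pX x n : p (x ^+ n) <= p x ^+ n.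
Proof.
elim: n => [|n IH]; first by rewrite !expr0 p1.
by rewrite !exprS; apply: (le_trans (pM _ _)); rewrite ler_wpM2l ?p_ge0.
Qed.

Lemma p_st x : p (st x) = p x.
Proof.
have le y : p y <= p (st y).
  have [->|y0] := eqVneq (p y) 0; first exact: p_ge0.
  have := pC y; have := pM (st y) y; have := p_ge0 y => h1 h2 h3.
  have h4 : 0 < p y by rewrite lt_def y0.
  by rewrite -(ler_pM2r h4) -expr2 -h3.
by apply: le_anti; rewrite le andbT -{2}(stK x) le.
Qed.

Lemma st1 : st 1 = 1.
Proof. by have := stM (st 1) 1; rewrite mulr1 !stK mulr1. Qed.

Lemma st0 : st 0 = 0.
Proof. by have := stZ 0 0; rewrite rmorph0 !scale0r. Qed.

Lemma stN x : st (- x) = - st x.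
Proof. by rewrite -scaleN1r stZ rmorphN1 scaleN1r. Qed.

Lemma stB x y : st (x - y) = st x - st y.
Proof. by rewrite stD stN. Qed.

Lemma stZr t x : st (t *r x) = t *r st x.
Proof. by rewrite stZ conj_Creal // complex_real. Qed.

Lemma stMn x n : st (x *+ n) = st x *+ n.
Proof. by elim: n => [|n IH]; rewrite ?mulr0n ?st0 // !mulrS stD IH. Qed.

Lemma stX x n : st (x ^+ n) = st x ^+ n.
Proof. by elim: n => [|n IH]; rewrite ?expr0 ?st1 // exprS exprSr stM IH. Qed.

Lemma p_sublinear : @sublinear R real_scalars p.
Proof.
split=> [x y|t x t0]; first exact: pD.
by rewrite -[t *: _]/(t *r x) pZr ger0_norm.
Qed.

(** The logarithmic norm of h: for self-adjoint h this is the largest point of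
    the spectrum, defined without inverses or completeness. *)
Definition lognorm (h : U) : R := @slope_inf R real_scalars p (1 : U) h.

Lemma lognorm_le h t : 0 <= t -> lognorm h <= p (h + t%:C%C%:A) - t.
Proof.
by move=> t0; have := @slope_inf_le R real_scalars p (1 : U) p_sublinear h t t0; rewrite p1 mulr1.
Qed.

Lemma lognorm_le_p h : lognorm h <= p h.
Proof. exact: (@slope_inf_le_id R real_scalars p (1 : U) p_sublinear). Qed.

Lemma lognorm_lt h e : lognorm h < e -> exists2 t, 0 <= t & p (h + t%:C%C%:A) < t + e.
Proof.
move=> he; apply: contrapT => H; move: he; rewrite ltNge; case/negP.
apply: (@le_slope_inf R real_scalars) => t t0; rewrite p1 mulr1.
by rewrite lerBrDl leNgt; apply/negP => lt; apply: H; exists t.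
Qed.

Lemma expr1i_expansion n : exists2 K : R, 0 <= K & forall b : U, p b <= 1 ->
  p ((1 + b) ^+ n - (1 + b *+ n + b ^+ 2 *+ 'C(n, 2))) <= K * p b ^+ 3.
Proof.
elim: n => [|n [K K0 IH]].
  by exists 0 => // b _; rewrite expr0 !mulr0n !addr0 subrr p0 mul0r.
exists (2 * K + 'C(n, 2)%:R) => [|b b1]; first by rewrite addr_ge0 ?mulr_ge0.
have E : (1 + 'X *+ n + 'X ^+ 2 *+ 'C(n, 2)) * (1 + 'X) =
    (1 + 'X *+ n.+1 + 'X ^+ 2 *+ 'C(n.+1, 2)) + 'X ^+ 3 *+ 'C(n, 2) :> {poly C}.
  by rewrite binS bin1 cubic_step.
have {}E := congr1 (horner_alg b) E.
rewrite !(rmorphD, rmorphM, rmorphMn, rmorphXn, rmorph1) /= horner_algX in E.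
have -> : (1 + b) ^+ n.+1 - (1 + b *+ n.+1 + b ^+ 2 *+ 'C(n.+1, 2)) =
   ((1 + b) ^+ n - (1 + b *+ n + b ^+ 2 *+ 'C(n, 2))) * (1 + b) + b ^+ 3 *+ 'C(n, 2).
  rewrite exprSr mulrBl E; move: (b ^+ 3 *+ _) => B.
  by rewrite [in RHS]opprD [in RHS]addrA subrK.
apply: (le_trans (pD _ _)); rewrite pMn [leRHS]mulrDl lerD //; last first.
  by rewrite ler_wpM2l // pX.
apply: (le_trans (pM _ _)).
have h1 : p (1 + b) <= 2 by apply: (le_trans (pD _ _)); rewrite p1; lra.
have := IH b b1; have := p_ge0 (1 + b).
have := p_ge0 ((1 + b) ^+ n - (1 + b *+ n + b ^+ 2 *+ 'C(n, 2))).
have : 0 <= K * p b ^+ 3 by rewrite mulr_ge0 // exprn_ge0 ?p_ge0.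
nra.
Qed.

Lemma p_Re_le x : p (x + st x) <= 2 * p x.
Proof. by have := pD x (st x); rewrite p_st; lra. Qed.

Lemma expr1D_le (m : nat) (s : R) : 0 <= s <= 1 ->
  (1 + s ^+ 2) ^+ m <= 1 + m%:R * s ^+ 2 + (3 ^ m)%:R * s ^+ 4.
Proof.
move=> /andP[s0 s1]; elim: m => [|m IH]; first by rewrite expr0 mul0r addr0 expn0 lerDl mul1r exprn_ge0.
have m3 : m%:R <= (3 ^ m)%:R :> R by rewrite ler_nat ltnW // ltn_expl.
have m0 : 0 <= m%:R :> R by [].
rewrite exprS expnS natrM -natr1; set A := (3 ^ m)%:R in m3 IH *.
have s2 : 0 <= s ^+ 2 <= 1 by rewrite exprn_ge0 // exprn_ile1.
move: IH; have -> : s ^+ 4 = s ^+ 2 ^+ 2 by rewrite -exprM.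
move: (s ^+ 2) s2 ((1 + _) ^+ m) => u /andP[u0 u1] P IH.
apply: le_trans (_ : (1 + u) * (1 + m%:R * u + A * u ^+ 2) <= _).
  by rewrite ler_wpM2l // addr_ge0.
have : 0 <= u ^+ 2 * (A - m%:R) by rewrite mulr_ge0 ?exprn_ge0 // subr_ge0.
have : 0 <= A * u ^+ 2 * (1 - u).
  by rewrite !mulr_ge0 ?exprn_ge0 ?subr_ge0 // (le_trans m0).
lra.
Qed.

Lemma conj_real_i s : Num.conj (s%:C%C * iu) = - (s%:C%C * iu) :> C.
Proof. by rewrite rmorphM /= conjCi conj_Creal ?mulrN // complex_real. Qed.

Lemma sqr_real_i s : (s%:C%C * iu) * (s%:C%C * iu) = - (s ^+ 2)%:C%C :> C.
Proof. by rewrite mulrACA -expr2 -expr2 sqrCi mulrN1 -rmorphXn. Qed.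

Lemma p_one_addi_sqr a s : st a = a -> p a <= 1 ->
  p (1 + (s%:C%C * iu) *: a) ^+ 2 <= 1 + s ^+ 2.
Proof.
move=> ha pa; rewrite -pC stD st1 stZ ha conj_real_i scaleNr; set b := _ *: a.
have -> : (1 - b) * (1 + b) = 1 + (s ^+ 2) *r (a * a).
  rewrite mulrDr mulr1 mulrBl mul1r addrA subrK.
  by rewrite /b -scalerAl -scalerAr scalerA sqr_real_i scaleNr opprK.
apply: (le_trans (pD _ _)); rewrite p1 lerD2l pZr ger0_norm ?sqr_ge0 //.
rewrite ler_piMr ?sqr_ge0 //; apply: (le_trans (pM _ _)).
by have := p_ge0 a; nra.
Qed.

(** The self-adjoint part of (1 + isa)^n is
    1 - C(n,2) s^2 a^2 up to third order, whereas the C*-identity bounds the norm of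
    (1 + isa)^n by (1 + s^2)^(n/2). For n = 2 (m + 1) the coefficient of s^2 in that
    bound is smaller than C(n,2) by the factor 1 / (m + 1). *)
Lemma lognorm_sqr_step a : st a = a -> p a <= 1 -> forall m : nat,
  exists2 K : R, 0 <= K & forall s, 0 < s <= 1 ->
    lognorm (- (a * a)) <= m.+1%:R^-1 + K * s.
Proof.
move=> ha pa m; set n := (2 * m.+1)%N; set c := 'C(n, 2)%:R : R.
have [K K0 HK] := expr1i_expansion n.
have mc : m.+1%:R * m.+1%:R <= c.
  rewrite /c bin2 /n -natrM ler_nat -mulnA -divn2 mulKn //.
  by rewrite leq_mul2l mul2n -addnn addSn /= leq_addl.
exists ((3 ^ m.+1)%:R + K) => [|s /andP[s0 s1]]; first by rewrite addr_ge0.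
set b := (s%:C%C * iu) *: a.
have pb : p b <= s.
  rewrite /b mulrC -scalerA pZ normCi /= mul1r pZr gtr0_norm //.
  by rewrite -[leRHS]mulr1 ler_pM2l.
have pb1 : p b <= 1 by exact: le_trans s1.
have bb : b ^+ 2 = - ((s ^+ 2) *r (a * a)).
  by rewrite expr2 /b -scalerAl -scalerAr scalerA sqr_real_i scaleNr.
have := HK b pb1; set T := 1 + b *+ n + b ^+ 2 *+ 'C(n, 2) => pT.
set W := 1 + b ^+ 2 *+ 'C(n, 2).
have stb : st b = - b by rewrite /b stZ ha conj_real_i scaleNr.
have TT : T + st T = W *+ 2.
  rewrite /T !stD !stMn stX stb sqrrN st1 mulNrn mulr2n addrACA [RHS]addrACA; congr (_ + _).
  by rewrite [1 - _]addrC addrA addrK.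
have pW : p W <= p T.
  by have := p_Re_le T; rewrite TT pMn; lra.
have pX1 : p ((1 + b) ^+ n) <= 1 + m.+1%:R * s ^+ 2 + (3 ^ m.+1)%:R * s ^+ 4.
  apply: (le_trans (pX _ _)); rewrite /n exprM.
  apply: le_trans (@expr1D_le m.+1 s _); last by rewrite s1 ltW.
  by rewrite lerXn2r ?nnegrE ?exprn_ge0 ?p_ge0 ?addr_ge0 ?exprn_ge0 ?(ltW s0) //
    p_one_addi_sqr.
have {}pT : p T <= 1 + m.+1%:R * s ^+ 2 + (3 ^ m.+1)%:R * s ^+ 4 + K * s ^+ 3.
  rewrite -(subKr ((1 + b) ^+ n) T); apply: (le_trans (pB _ _)).
  rewrite lerD //; apply: (le_trans pT); rewrite ler_wpM2l //.
  by rewrite lerXn2r ?nnegrE ?p_ge0 ?(ltW s0).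
have c0 : 0 < c by apply: lt_le_trans mc; rewrite mulr_gt0.
have s20 : 0 < s ^+ 2 by rewrite exprn_gt0.
have t0 : 0 < (c * s ^+ 2)^-1 by rewrite invr_gt0 mulr_gt0.
apply: (le_trans (lognorm_le _ (ltW t0))).
have -> : - (a * a) + ((c * s ^+ 2)^-1)%:C%C%:A = (c * s ^+ 2)^-1 *r W.
  rewrite /W bb mulNrn scalerDr addrC; congr (_ + _).
  have -> : (s ^+ 2) *r (a * a) *+ 'C(n, 2) = (c * s ^+ 2) *r (a * a).
    by rewrite -scaler_nat scalerA -(rmorph_nat (real_complex R)) -rmorphM.
  by rewrite scalerN scalerA -rmorphM /= mulVf ?scale1r // mulf_neq0 ?gt_eqF.
rewrite pZr gtr0_norm //.
apply: le_trans (_ : (c * s ^+ 2)^-1 *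
    (m.+1%:R * s ^+ 2 + (3 ^ m.+1)%:R * s ^+ 4 + K * s ^+ 3) <= _).
  rewrite -[X in _ - X]mulr1 -mulrBr ler_wpM2l ?(ltW t0) //; lra.
have m0 : 0 < m.+1%:R :> R by [].
set M := m.+1%:R in mc m0 *; set A := (3 ^ m.+1)%:R : R.
have A0 : 0 <= A by [].
have c1 : 1 <= c by apply: le_trans mc; rewrite -natrM ler1n.
have -> : (c * s ^+ 2)^-1 * (M * s ^+ 2 + A * s ^+ 4 + K * s ^+ 3) =
   M / c + (A * s + K) * s / c by field; rewrite !gt_eqF.
apply: lerD.
  rewrite ler_pdivrMr // mulrC ler_pdivlMr //.
rewrite ler_pdivrMr //; apply: le_trans (_ : (A + K) * s * 1 <= _); last first.
  by rewrite ler_wpM2l // mulr_ge0 ?addr_ge0 // ltW.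
by rewrite mulr1 ler_pM2r // lerD2r -[leRHS]mulr1 ler_wpM2l.
Qed.

Lemma lognorm_sqr a : st a = a -> p a <= 1 -> lognorm (- (a * a)) <= 0.
Proof.
move=> ha pa; rewrite leNgt; apply/negP => L0; set L := lognorm _ in L0.
pose m := Num.truncn (2 / L).
have [K K0 H] := lognorm_sqr_step ha pa m.
pose s := Num.min 1 (L / (2 * K + 2)).
have d0 : 0 < 2 * K + 2 by lra.
have s0 : 0 < s by rewrite lt_min ltr01 divr_gt0.
have s1 : s <= 1 by rewrite ge_min lexx.
have sK : s * (2 * K + 2) <= L by rewrite -ler_pdivlMr // ge_min lexx orbT.
have := H s; rewrite s0 s1 => /(_ isT); rewrite -/L => LL.
have : m.+1%:R^-1 < L / 2.
  rewrite -[ltRHS]invrK ltf_pV2 ?posrE ?invr_gt0 ?divr_gt0 // invf_div.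
  by have := @truncnS_gt R (2 / L).
move: LL; move: (m.+1%:R^-1) => v LL vL.
have := mulrC s K; nra.
Qed.

Lemma lognorm_le0_near h e : lognorm h <= 0 -> 0 < e ->
  exists2 s0, 0 < s0 & forall s, 0 <= s <= s0 -> p (1 + s *r h) <= 1 + e * s.
Proof.
move=> h0 e0; have [t t0 ht] := lognorm_lt (le_lt_trans h0 e0).
exists (t + 1)^-1 => [|s /andP[s0 st0]]; first by rewrite invr_gt0; lra.
have st1 : s * (t + 1) <= 1 by rewrite -ler_pdivlMr ?div1r //; lra.
have -> : 1 + s *r h = s *r (h + t%:C%C%:A) + (1 - s * t)%:C%C%:A.
  rewrite scalerDr scalerA -rmorphM /= addrAC -addrA -scalerDl -rmorphD /= addrC.
  by rewrite subrK rmorph1 scale1r.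
apply: (le_trans (pD _ _)); rewrite !pZr p1 mulr1 !ger0_norm //; last by nra.
by nra.
Qed.

Lemma p_one_add_double x : p (1 + x *+ 2) <= p (1 + x) ^+ 2 + p x ^+ 2.
Proof.
have -> : 1 + x *+ 2 = (1 + x) ^+ 2 - x ^+ 2.
  by rewrite expr2 mulrDl mul1r mulrDr mulr1 -expr2 !addrA addrK.
by apply: (le_trans (pB _ _)); rewrite lerD // pX.
Qed.

Lemma four_roots x :
  (1 + x) ^+ 4 - (1 - x) ^+ 4 - iu *: ((1 + iu *: x) ^+ 4 - (1 - iu *: x) ^+ 4)
  = x *+ 16.
Proof.
have hi : (iu%:P : {poly C}) ^+ 2 = -1 by rewrite -rmorphXn /= sqrCi rmorphN1.
have fM P Q : horner_alg x (P * Q) = horner_alg x P * horner_alg x Q.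
  exact: rmorphM.
have fB P Q : horner_alg x (P - Q) = horner_alg x P - horner_alg x Q.
  exact: rmorphB.
have fD P Q : horner_alg x (P + Q) = horner_alg x P + horner_alg x Q.
  exact: rmorphD.
have fX P n : horner_alg x (P ^+ n) = horner_alg x P ^+ n by exact: rmorphXn.
have fMn P n : horner_alg x (P *+ n) = horner_alg x P *+ n by exact: rmorphMn.
have f1 : horner_alg x 1 = 1 by exact: rmorph1.
have := congr1 (horner_alg x) (fourth_roots_filter 'X hi).
by rewrite fMn fB fM !fB !fX !fB !fD !fM f1 horner_algC horner_algX !mulr_algl.
Qed.

(** A self-adjoint element of norm 1 has 1 or -1 in its spectrum. If both
    logarithmic norms vanish, p (1 + s h) stays close to 1 at the finite distance
    s = 1/2, too close for the four values of (1 + w h / 2)^4 at fourth roots of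
    unity w to add up to 8 h. *)
Lemma lognorm_gt0 h : st h = h -> p h = 1 -> 0 < lognorm h \/ 0 < lognorm (- h).
Proof.
move=> sh ph; have [hp|h1] := ltP 0 (lognorm h); first by left.
have [hn|h2] := ltP 0 (lognorm (- h)); first by right.
have e0 : 0 < 8^-1 :> R by rewrite invr_gt0.
have [s1 s10 H1] := lognorm_le0_near h1 e0.
have [s2 s20 H2] := lognorm_le0_near h2 e0.
pose P s x := p (1 + s *r x) <= 1 + s / 8 + 5 / 8 * s ^+ 2.
have dbl s x : p x = 1 -> 0 <= s <= 4^-1 -> P s x -> P (2 * s) x.
  move=> px /andP[s0 s4]; rewrite /P => Ps.
  have -> : (2 * s) *r x = (s *r x) *+ 2 by rewrite mulr_natl rmorphMn scalerMnl.
  apply: (le_trans (p_one_add_double _)); rewrite pZr px mulr1 ger0_norm //.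
  have := p_ge0 (1 + s *r x) => q0.
  have : p (1 + s *r x) ^+ 2 <= (1 + s / 8 + 5 / 8 * s ^+ 2) ^+ 2.
    by rewrite lerXn2r ?nnegrE // (le_trans q0).
  have : (1 + s / 8 + 5 / 8 * s ^+ 2) ^+ 2 =
     1 + s / 4 + 5 / 4 * s ^+ 2 + s ^+ 2 * (1 / 8 + 5 / 8 * s) ^+ 2 by field.
  have : (1 / 8 + 5 / 8 * s) ^+ 2 <= 1 / 4 by nra.
  have := sqr_ge0 s; nra.
have half x s0 : p x = 1 -> 0 < s0 ->
    (forall s, 0 <= s <= s0 -> p (1 + s *r x) <= 1 + 8^-1 * s) -> P 2^-1 x.
  move=> px s00 Hs; pose N := Num.truncn s0^-1.
  have N1 : s0^-1 < (2 ^ N.+1)%:R.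
    apply: lt_trans (@truncnS_gt R s0^-1) _; rewrite ltr_nat; exact: ltn_expl.
  suff : forall k : nat, (k <= N.+1)%N -> P (2^-1 / (2 ^ (N.+1 - k))%:R) x.
    by move=> /(_ N.+1 (leqnn _)); rewrite subnn expn0 divr1.
  elim=> [_|k IH kN].
    rewrite subn0 /P; set s := _ / _.
    have s0' : 0 <= s by rewrite divr_ge0 // invr_ge0.
    apply: le_trans (Hs s _) _; last by have := sqr_ge0 s; lra.
    rewrite s0' /s ler_pdivrMr ?ltr0n ?expn_gt0 //.
    have : 1 < s0 * (2 ^ N.+1)%:R by rewrite mulrC -ltr_pdivrMr // div1r.
    lra.
  have e : (N.+1 - k = (N.+1 - k.+1).+1)%N by rewrite subSn // subSS.
  have := IH (ltnW kN); rewrite e expnS natrM.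
  set T := (2 ^ (N.+1 - k.+1))%:R.
  have T1 : 1 <= T by rewrite /T ler1n expn_gt0.
  have T0 : 0 < T by exact: lt_le_trans T1.
  have -> : 2^-1 / (2 * T) = (2^-1 / T) / 2 by field; rewrite gt_eqF.
  have T2 : 0 <= 2^-1 / T <= 2^-1.
    by rewrite divr_ge0 ?invr_ge0 ?(ltW T0) //= ler_pdivrMr // ler_peMr ?invr_ge0.
  move: (2^-1 / T) T2 => u u2 Pu; have := dbl (u / 2) x px _ Pu.
  have -> : 2 * (u / 2) = u by field.
  apply.
  by case/andP: u2 => u0 u1; rewrite divr_ge0 //= ler_pdivrMr //;
    have -> : 4^-1 * 2 = 2^-1 :> R by field.
have pN1 : p (- h) = 1 by rewrite pN.
have := half _ _ ph s10 H1; have := half _ _ pN1 s20 H2; rewrite /P.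
rewrite scalerN => Q2 Q1.
pose x := 2^-1 *r h.

have px : p x = 2^-1 by rewrite pZr ph mulr1 gtr0_norm // invr_gt0.
have four y (c : R) : p y ^+ 2 <= c -> p (y ^+ 4) <= c ^+ 2.
  move=> py; apply: (le_trans (pX _ _)); rewrite (exprM _ 2 2).
  by rewrite lerXn2r ?nnegrE ?exprn_ge0 ?p_ge0 // (le_trans _ py) ?exprn_ge0 ?p_ge0.
have two y (c : R) : p y <= c -> p y ^+ 2 <= c ^+ 2.
  by move=> py; rewrite lerXn2r ?nnegrE ?p_ge0 // (le_trans _ py) ?p_ge0.
have := four_roots x => /(congr1 p); rewrite pMn px => E.
have I1 : p (1 + iu *: x) ^+ 2 <= 1 + 2^-1 ^+ 2.
  by rewrite scalerA mulrC; apply: p_one_addi_sqr; rewrite ?ph.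
have I2 : p (1 - iu *: x) ^+ 2 <= 1 + (- 2^-1) ^+ 2.
  rewrite -scaleNr scalerA.
  have -> : - iu * (2^-1)%:C%C = (- 2^-1)%:C%C * iu.
    by rewrite rmorphN !mulNr mulrC.
  by apply: p_one_addi_sqr; rewrite ?ph.
have J1 : p ((1 + x) ^+ 4) <= 9 / 4.
  apply: (le_trans (four _ _ (two _ _ Q1))); lra.
have J2 : p ((1 - x) ^+ 4) <= 9 / 4.
  by apply: (le_trans (four _ _ (two _ _ Q2))); lra.
have := four _ _ I1; have := four _ _ I2 => J3 J4.
have := pB ((1 + x) ^+ 4 - (1 - x) ^+ 4)
  (iu *: ((1 + iu *: x) ^+ 4 - (1 - iu *: x) ^+ 4)).
rewrite E pZ normCi mul1r => B0.
have := pB ((1 + x) ^+ 4) ((1 - x) ^+ 4).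
have := pB ((1 + iu *: x) ^+ 4) ((1 - iu *: x) ^+ 4).
move: J1 J2 J3 J4 B0; lra.
Qed.

Section RealState.
Variable f : U -> R.
Hypotheses (fD : forall x y, f (x + y) = f x + f y)
  (fZ : forall t x, f (t *r x) = t * f x)
  (fp : forall x, f x <= p x)
  (fsq : forall a, st a = a -> 0 <= f (a * a)).

Let fN x : f (- x) = - f x.
Proof. by have := fZ (-1) x; rewrite rmorphN1 scaleN1r mulN1r. Qed.
Let fB x y : f (x - y) = f x - f y. Proof. by rewrite fD fN. Qed.

Let hermCS a b : st a = a -> st b = b -> a * b = b * a ->
  f (a * b) ^+ 2 <= f (a * a) * f (b * b).
Proof.
move=> sa sb ab; apply: discriminant_le => t.
have : 0 <= f ((a + t *r b) * (a + t *r b)) by apply: fsq; rewrite stD stZr sa sb.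
have -> : (a + t *r b) * (a + t *r b) =
    a * a + t *r (a * b) + (t *r (a * b) + t *r (t *r (b * b))).
  by rewrite mulrDl !mulrDr -!scalerAl -!scalerAr -ab.
rewrite !fD !fZ => H; apply: le_trans H _.
by rewrite le_eqVlt; apply/orP; left; apply/eqP; ring.
Qed.

(** The moments of k at the vector c are bounded because p k <= 1. *)
Let sandwich k c : st k = k -> p k <= 1 -> st c = c -> c * k = k * c ->
  f (c * k * c) <= f (c * c).
Proof.
move=> sk pk sc ck; pose F j := f (c * (k ^+ j * c)).
have kc j : c * k ^+ j = k ^+ j * c by exact: (commrX j ck).
have h : F 1%N <= 1 * F 0%N.
  apply: (@moment_bound R F 1 (p c ^+ 2)) => //.
  - by rewrite /F expr0 mul1r fsq.
  - move=> j; rewrite /F expr0 mul1r.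
    have sj : st (k ^+ j * c) = k ^+ j * c by rewrite stM stX sk sc kc.
    have -> : k ^+ (2 * j) * c = k ^+ j * (k ^+ j * c).
      by rewrite mulrA -exprD mul2n addnn.
    have -> : c * (k ^+ j * (k ^+ j * c)) = (k ^+ j * c) * (k ^+ j * c).
      by rewrite mulrA kc.
    by apply: hermCS => //; rewrite mulrA kc.
  - move=> j; rewrite expr1n mulr1; apply: (le_trans (fp _)).
    apply: (le_trans (pM _ _)); rewrite expr2 ler_wpM2l ?p_ge0 //.
    apply: (le_trans (pM _ _)); rewrite ler_piMl ?p_ge0 //.
    by apply: (le_trans (pX _ _)); rewrite exprn_ile1 ?p_ge0.
by move: h; rewrite mul1r /F expr1 expr0 mul1r mulrA.
Qed.

Section Profile.
Variable k : U.
Hypotheses (sk : st k = k) (pk : p k <= 1).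
Local Notation w := (1 - k).

Let sw j : st (w ^+ j) = w ^+ j.
Proof. by rewrite stX stB st1 sk. Qed.

Let kw j : k * w ^+ j = w ^+ j * k.
Proof. by apply: commrX; rewrite /GRing.comm mulrBl mulrBr mulr1 mul1r. Qed.

Lemma state_decr j : f (k * w ^+ j.+1) <= f (k * w ^+ j).
Proof.
have e : k * w ^+ j - k * w ^+ j.+1 = k * w ^+ j * k.
  by rewrite exprSr mulrA mulrBr mulr1 opprB addrC subrK.
rewrite -subr_ge0 -fB e -{e}(odd_double_half j); move: (odd j) j./2 => b i.
set c := k * w ^+ i.
have sc : st c = c by rewrite /c stM sw sk kw.
have -> : k * w ^+ (b + i.*2) * k = c * w ^+ b * c.
  have -> : (b + i.*2 = i + (b + i))%N by rewrite addnCA addnn.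
  by rewrite {2}[c]kw /c !exprD !mulrA.
case: b; last by rewrite expr0 mulr1 fsq.
have ck : c * k = k * c by rewrite /c -mulrA -kw.
by rewrite expr1 mulrBr mulr1 mulrBl fB subr_ge0; exact: sandwich.
Qed.

Lemma state_profile_le m : f (k * w ^+ m.+1.*2) <= m.+1.*2%:R^-1.
Proof.
set n := m.+1.*2.
have mono i : (i <= n)%N -> f (k * w ^+ n) <= f (k * w ^+ i).
  move=> /subnK <-; elim: (n - i)%N => // d IH; exact: le_trans (state_decr _) IH.
have tele j : \sum_(i < j) f (k * w ^+ i) = f 1 - f (w ^+ j).
  elim: j => [|j IH]; first by rewrite big_ord0 expr0 subrr.
  rewrite big_ord_recr /= IH exprS mulrBl mul1r fB; lra.
have : n%:R * f (k * w ^+ n) <= 1.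
  have -> : n%:R * f (k * w ^+ n) = \sum_(i < n) f (k * w ^+ n).
    by rewrite sumr_const card_ord mulr_natl.
  apply: (@le_trans _ _ (\sum_(i < n) f (k * w ^+ i))).
    by apply: ler_sum => i _; apply: mono; apply: ltnW.
  rewrite tele; have := fp 1; rewrite p1 => f1.
  have : 0 <= f (w ^+ n) by rewrite /n -addnn exprD; exact: fsq.
  lra.
by rewrite mulrC -ler_pdivlMr ?div1r // ltr0n /n double_gt0.
Qed.

Lemma state_profile_ge n : f (k * w ^+ n) <= f k.
Proof.
elim: n => [|n IH]; first by rewrite expr0 mulr1.
exact: le_trans (state_decr _) IH.
Qed.

End Profile.

(** With h = x^* x, k = x x^* and y = x (1 - h)^n one has y^* y = h (1 - h)^2n and
    y y^* = k (1 - k)^2n. The values of f at h (1 - h)^j decrease in j, so f is at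
    most f h at y^* y; at y y^* it is below each of the 2n terms of a telescoping
    sum bounded by f 1, hence at most 1 / 2n. As y^* y + y y^* is a sum of two squares of
    self-adjoint elements, f h >= - 1 / 2n. *)
Lemma state_pos x : 0 <= f (st x * x).
Proof.
wlog px : x / p x <= 1.
  move=> H; pose c := (p x + 1)^-1; have q0 := p_ge0 x.
  have c0 : 0 < c by rewrite invr_gt0; lra.
  have := H (c *r x); rewrite pZr stZr -scalerAl -scalerAr scalerA -rmorphM fZ.
  rewrite gtr0_norm // pmulr_rge0 ?mulr_gt0 //; apply.
  by rewrite mulrC -[_ * c]/(p x / (p x + 1)) ler_pdivrMr; lra.
set h := st x * x; set k := x * st x.
have sh : st h = h by rewrite /h stM stK.
have sk : st k = k by rewrite /k stM stK.
have ph : p h <= 1 by rewrite /h pC exprn_ile1 ?p_ge0.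
have pk : p k <= 1.
  by rewrite /k -{1}(stK x) pC p_st exprn_ile1 ?p_ge0.
have key m : - m.+1.*2%:R^-1 <= f h.
  pose y := x * (1 - h) ^+ m.+1.
  have hw j : h * (1 - h) ^+ j = (1 - h) ^+ j * h.
    by apply: commrX; rewrite /GRing.comm mulrBl mulrBr mulr1 mul1r.
  have yy : st y * y = h * (1 - h) ^+ m.+1.*2.
    rewrite /y stM stX stB st1 sh mulrA -(mulrA _ (st x) x) -/h -hw -mulrA.
    by rewrite -exprD addnn.
  have xw j : (1 - h) ^+ j * st x = st x * (1 - k) ^+ j.
    elim: j => [|j IH]; first by rewrite !expr0 mul1r mulr1.
    rewrite exprSr exprS -mulrA mulrBl mul1r /h -mulrA -/k.
    have -> : st x - st x * k = st x * (1 - k) by rewrite mulrBr mulr1.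
    by rewrite mulrA IH -!mulrA -exprSr -exprS.
  have yy' : y * st y = k * (1 - k) ^+ m.+1.*2.
    rewrite /y stM stX stB st1 sh mulrA -(mulrA x) -exprD addnn -mulrA xw.
    by rewrite mulrA.
  have : 0 <= f (st y * y) + f (y * st y).
    pose a := y + st y; pose b := iu *: (y - st y).
    have sa : st a = a by rewrite /a stD stK addrC.
    have sb : st b = b by rewrite /b stZ conjCi stB stK scaleNr -scalerN opprB.
    have := fsq sa; have := fsq sb.
    rewrite /a /b -scalerAl -scalerAr scalerA -expr2 sqrCi scaleN1r fN.
    rewrite !(mulrDl, mulrDr) !mulrN !mulNr !(fD, fN); lra.
  rewrite yy yy' => P0.
  have := state_profile_le sk pk m; have := state_profile_ge sh ph m.+1.*2.
  rewrite lerNl; move: P0; lra.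
rewrite leNgt; apply/negP => f0.
pose m := Num.truncn (- f h)^-1.
have := key m; have : (m.+1.*2%:R : R)^-1 < - f h; last by lra.
rewrite -[ltRHS]invrK ltf_pV2 ?posrE ?invr_gt0 ?oppr_gt0 //.
apply: lt_le_trans (@truncnS_gt R _) _; rewrite ler_nat -addnn; exact: leq_addr.
Qed.

End RealState.

Lemma sa_state_exists h : st h = h -> exists f : U -> R,
  [/\ (forall x y, f (x + y) = f x + f y) /\ (forall t x, f (t *r x) = t * f x),
      forall x, f x <= p x, forall x, f (st x) = f x,
      forall a, st a = a -> 0 <= f (a * a) & f h = lognorm h].
Proof.
move=> sh; have [g [gD gZ gp gh]] : exists g : U -> R,
    [/\ forall x y, g (x + y) = g x + g y, forall t x, g (t *r x) = t * g x,
        forall x, g x <= lognorm x & g h = lognorm h].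
  have sl := @slope_inf_sublinear R real_scalars p (1 : U) p_sublinear.
  have [g [lg gp gh]] := @Hahn_Banach R real_scalars _ h sl.
  have g0 : g 0 = 0.
    have := lg 1 0 0; rewrite scale1r addr0 mul1r => /eqP.
    by rewrite -subr_eq subrr eq_sym => /eqP.
  exists g; split=> // [x y|t x].
    by have := lg 1 x y; rewrite scale1r mul1r.
  by have := lg t x 0; rewrite !addr0 g0 addr0.
have gsa a : st a = a -> g (2^-1 *r (a + st a)) = g a.
  by move=> sa; rewrite gZ sa gD; lra.
exists (fun x => g (2^-1 *r (x + st x))); split.
- split=> [x y|t x]; first by rewrite -gD stD addrACA scalerDr.
  by rewrite -gZ stZr -scalerDr !scalerA mulrC.
- move=> x; apply: (le_trans (gp _)); apply: (le_trans (lognorm_le_p _)).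
  rewrite pZr gtr0_norm ?invr_gt0 // mulrC ler_pdivrMr // mulrC.
  exact: p_Re_le.
- by move=> x; rewrite stK addrC.
- move=> a sa; rewrite gsa ?stM ?sa //.
  have q0 := p_ge0 a; pose c := (p a + 1)^-1.
  have c0 : 0 < c by rewrite invr_gt0; lra.
  have sca : st (c *r a) = c *r a by rewrite stZr sa.
  have pca : p (c *r a) <= 1.
    by rewrite pZr gtr0_norm // mulrC -[_ * c]/(p a / (p a + 1)) ler_pdivrMr; lra.
  have := le_trans (gp _) (lognorm_sqr sca pca).
  rewrite -scaleN1r -[X in X *: _](rmorphN1 (real_complex R)) gZ.
  rewrite -scalerAl -scalerAr !gZ mulN1r oppr_le0 !pmulr_rge0 //.
- by rewrite gsa.
Qed.

(** By [lognorm_gt0] the logarithmic norm is positive at x^* x or at - x^* x. A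
    functional below it, chosen with equality there, is positive by [state_pos];
    this rules out the second case. The bound on the operators z is the
    Cauchy-Schwarz inequality bootstrapped by [moment_bound]. *)
Lemma state_exists x : p x != 0 -> exists F : U -> C,
  [/\ forall c y z, F (c *: y + z) = c * F y + F z,
      forall y, 0 <= F (st y * y), forall y, F (st y) = Num.conj (F y),
      forall y z, F (st y * (st z * z) * y) <= ((p z) ^+ 2)%:C%C * F (st y * y)
    & F (st x * x) != 0].
Proof.
move=> px.
wlog px1 : x px / p x = 1.
  move=> H; pose c := (p x)^-1.
  have p0' : 0 < p x by rewrite lt_def px p_ge0.
  have pc : p (c *r x) = 1 by rewrite pZr gtr0_norm ?invr_gt0 // mulVf.
  have [|//|F [lF Fp Fs Fb Fx]] := H (c *r x); first by rewrite pc oner_neq0.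
  exists F; split=> //; apply: contra_neq Fx => Fx.
  have F0 : F 0 = 0.
    have := lF 1 0 0; rewrite scaler0 addr0 mul1r => /eqP.
    by rewrite -subr_eq subrr eq_sym => /eqP.
  have FZ (a : C) y : F (a *: y) = a * F y by have := lF a y 0; rewrite !addr0 F0 addr0.
  by rewrite stZr -scalerAl -scalerAr !FZ Fx !mulr0.
set h := st x * x.
have sh : st h = h by rewrite /h stM stK.
have ph : p h = 1 by rewrite /h pC px1 expr1n.
have [f [[fD fZ] fp fst fsq fh]] : exists f : U -> R,
  [/\ (forall x y, f (x + y) = f x + f y) /\ (forall t x, f (t *r x) = t * f x),
      forall x, f x <= p x, forall x, f (st x) = f x,
      forall a, st a = a -> 0 <= f (a * a) & 0 < f h].
  have [hp|hn] := lognorm_gt0 sh ph.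
    by have [f [? ? ? ? fh]] := sa_state_exists sh; exists f; split=> //; rewrite fh.
  have sNh : st (- h) = - h by rewrite stN sh.
  have [f [[fD fZ] fp fst fsq fh]] := sa_state_exists sNh.
  have := state_pos fD fZ fp fsq x; rewrite -/h.
  have := fZ (-1) h; rewrite rmorphN1 scaleN1r fh; lra.
have fpos := state_pos fD fZ fp fsq.
have fN y : f (- y) = - f y.
  by have := fZ (-1) y; rewrite rmorphN1 scaleN1r mulN1r.
have fi h' : st h' = h' -> f (iu *: h') = 0.
  move=> s'; have := fst (iu *: h'); rewrite stZ conjCi s' scaleNr fN; lra.
have fc (c : C) y : f (c *: y) = complex.Re c * f y + complex.Im c * f (iu *: y).
  rewrite {1}[c]complexE scalerDl fD fZ (mulrC 'i%C) -scalerA fZ.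
  by rewrite complexiE.
have fic (c : C) y : f (iu *: (c *: y)) = complex.Re c * f (iu *: y) - complex.Im c * f y.
  rewrite scalerA (mulrC iu) -scalerA fc; congr (_ + _).
  by rewrite scalerA -expr2 sqrCi scaleN1r fN mulrN.
pose F y : C := Complex (f y) (- f (iu *: y)).
have Fsa h' : st h' = h' -> F h' = (f h')%:C%C.
  by move=> s'; rewrite /F fi // oppr0.
have sts y : st (st y * y) = st y * y by rewrite stM stK.
have CS u v : f (st u * v) ^+ 2 <= f (st u * u) * f (st v * v).
  apply: discriminant_le => t; have := fpos (u + t *r v).
  have -> : st (u + t *r v) * (u + t *r v) =
     st u * u + t *r (st u * v) + (t *r (st v * u) + t *r (t *r (st v * v))).
    by rewrite stD stZr mulrDl !mulrDr -!scalerAl -!scalerAr.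
  have -> : st v * u = st (st u * v) by rewrite stM stK.
  rewrite !fD !fZ fst => H; apply: le_trans H _.
  by rewrite le_eqVlt; apply/orP; left; apply/eqP; ring.
exists F; split.
- move=> c y z; apply/eqP; rewrite eq_complex /= scalerDr !fD (fc c y) fic.
  case: c => a b /=; apply/andP; split; apply/eqP; ring.
- by move=> y; rewrite Fsa // ler0c.
- move=> y; rewrite /F fst; apply/eqP; rewrite eq_complex /= eqxx /=.
  have -> : iu *: st y = - st (iu *: y) by rewrite stZ conjCi scaleNr opprK.
  by rewrite fN fst opprK.
- move=> y z; set k := st z * z.
  have sk : st k = k by rewrite sts.
  have syk j : st (st y * k ^+ j * y) = st y * k ^+ j * y.
    by rewrite !stM stK stX sk mulrA.
  have := syk 1%N; rewrite expr1 => sy1.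
  rewrite !Fsa // -rmorphM lecR.
  have -> : p z ^+ 2 = p k by rewrite pC.
  have := @moment_bound R (fun j => f (st y * k ^+ j * y)) (p k) (p y ^+ 2).
  rewrite /= expr0 mulr1 expr1; apply=> //; first exact: p_ge0.
    move=> j; rewrite -mulrA; apply: (le_trans (CS _ _)).
    by rewrite stM stX sk -!mulrA (mulrA (k ^+ j)) -exprD addnn mul2n.
  move=> j; apply: (le_trans (fp _)); apply: (le_trans (pM _ _)).
  rewrite expr2 mulrAC ler_wpM2r ?p_ge0 //; apply: (le_trans (pM _ _)).
  by rewrite p_st ler_wpM2l ?p_ge0 // pX.
- by rewrite Fsa // (inj_eq (@complexI R)) gt_eqF.
Qed.

End CstarSeminorm.

(** * Sequences of complex numbers *)

Section ComplexSequences.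
Variable R : realType.
Local Notation C := R[i].
Implicit Types (z w l : C) (a b : nat -> C).

Definition cnorm z : R := complex.Re `|z|.

Lemma cnormE z : `|z| = (cnorm z)%:C%C.
Proof. by rewrite /cnorm normc_def. Qed.

Lemma cnorm_ge0 z : 0 <= cnorm z.
Proof. by have := normr_ge0 z; rewrite cnormE ler0c. Qed.

Lemma cnormD z w : cnorm (z + w) <= cnorm z + cnorm w.
Proof. by have := ler_normD z w; rewrite !cnormE -rmorphD lecR. Qed.

Lemma cnormM z w : cnorm (z * w) = cnorm z * cnorm w.
Proof. by have := normrM z w; rewrite !cnormE -rmorphM => /(@complexI R). Qed.

Lemma cnormN z : cnorm (- z) = cnorm z.
Proof. by rewrite /cnorm normrN. Qed.

Lemma cnormB z w : cnorm (z - w) <= cnorm z + cnorm w.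
Proof. by rewrite -(cnormN w); exact: cnormD. Qed.

Lemma cnorm0 : cnorm 0 = 0. Proof. by rewrite /cnorm normr0. Qed.

Lemma cnorm_eq0 z : cnorm z = 0 -> z = 0.
Proof. by move=> z0; apply/eqP; rewrite -normr_eq0 cnormE z0. Qed.

Lemma cnorm_conj z : cnorm (Num.conj z) = cnorm z.
Proof. by rewrite /cnorm norm_conjC. Qed.

Lemma cnorm_real (r : R) : 0 <= r -> cnorm (r%:C%C : C) = r.
Proof. by move=> r0; rewrite /cnorm ger0_norm // ler0c. Qed.

Lemma cnorm_sqr z : ((cnorm z) ^+ 2)%:C%C = z * Num.conj z.
Proof. by rewrite rmorphXn /= -cnormE normCK. Qed.

Lemma cnorm_Re z : `|complex.Re z| <= cnorm z.
Proof. by have := normc_ge_Re z; rewrite cnormE lecR. Qed.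

Lemma cnorm_Im z : `|complex.Im z| <= cnorm z.
Proof.
have -> : complex.Im z = - complex.Re (z * 'i%C) by rewrite ReiNIm opprK.
rewrite normrN; apply: (le_trans (cnorm_Re _)); rewrite cnormM.
have -> : cnorm ('i%C : C) = 1 by rewrite /cnorm complexiE normCi.
by rewrite mulr1.
Qed.

Lemma cnorm_le_ReIm z : cnorm z <= `|complex.Re z| + `|complex.Im z|.
Proof.
rewrite {1}[z]complexE; apply: (le_trans (cnormD _ _)); rewrite cnormM.
have -> : cnorm ('i%C : C) = 1 by rewrite /cnorm complexiE normCi.
by rewrite mul1r /cnorm !normc_def /= !expr0n !addr0 !sqrtr_sqr.
Qed.

Definition tendsto a l := forall e : R, 0 < e ->
  exists N, forall n, (N <= n)%N -> cnorm (a n - l) < e.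

Definition ccauchy a := forall e : R, 0 < e ->
  exists N, forall m n, (N <= m)%N -> (N <= n)%N -> cnorm (a m - a n) < e.

Lemma tendsto_unique a l l' : tendsto a l -> tendsto a l' -> l = l'.
Proof.
move=> al al'; apply/eqP; rewrite -subr_eq0; apply/eqP/cnorm_eq0/le_anti.
rewrite cnorm_ge0 andbT; apply/ler_addgt0Pl => e e0; rewrite addr0.
have e2 : 0 < e / 2 by rewrite divr_gt0.
have [N1 H1] := al _ e2; have [N2 H2] := al' _ e2.
have := H1 _ (leq_maxl N1 N2); have := H2 _ (leq_maxr N1 N2).
set n := maxn N1 N2; have -> : l - l' = (a n - l') - (a n - l).
  by ring.
have := cnormB (a n - l') (a n - l); lra.
Qed.

Lemma tendsto_cst l : tendsto (fun=> l) l.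
Proof. by move=> e e0; exists 0%N => n _; rewrite subrr cnorm0. Qed.

Lemma eq_tendsto a b l : a =1 b -> tendsto a l -> tendsto b l.
Proof.
by move=> ab al e e0; have [N H] := al _ e0; exists N => n /H; rewrite ab.
Qed.

Lemma tendsto_squeeze a b l l' : tendsto a l ->
  (forall e : R, 0 < e -> exists N, forall n, (N <= n)%N ->
     cnorm (b n - l') <= cnorm (a n - l) + e) -> tendsto b l'.
Proof.
move=> al H e e0; have e2 : 0 < e / 2 by rewrite divr_gt0.
have [N1 H1] := al _ e2; have [N2 H2] := H _ e2.
exists (maxn N1 N2) => n; rewrite geq_max => /andP[/H1 h1 /H2 h2]; lra.
Qed.

Lemma tendsto_lin c a b l l' : tendsto a l -> tendsto b l' ->
  tendsto (fun n => c * a n + b n) (c * l + l').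
Proof.
move=> al bl e e0; have c0 := cnorm_ge0 c.
have e1 : 0 < e / 2 by rewrite divr_gt0.
have e2 : 0 < e / 2 / (cnorm c + 1) by rewrite divr_gt0 //; lra.
have [N1 H1] := al _ e2; have [N2 H2] := bl _ e1.
exists (maxn N1 N2) => n; rewrite geq_max => /andP[/H1 h1 /H2 h2].
have -> : c * a n + b n - (c * l + l') = c * (a n - l) + (b n - l') by ring.
apply: (le_lt_trans (cnormD _ _)); rewrite cnormM.
have : cnorm c * cnorm (a n - l) <= e / 2.
  move: h1; rewrite ltr_pdivlMr; last lra.
  by have := cnorm_ge0 (a n - l); nra.
lra.
Qed.

Lemma tendsto_conj a l : tendsto a l ->
  tendsto (fun n => Num.conj (a n)) (Num.conj l).
Proof.
move=> al e e0; have [N H] := al e e0; exists N => n /H.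
by rewrite -rmorphB cnorm_conj.
Qed.

Lemma tendsto_le a l (M : R) N0 : tendsto a l ->
  (forall n, (N0 <= n)%N -> cnorm (a n) <= M) -> cnorm l <= M.
Proof.
move=> al aM; apply/ler_addgt0Pl => e e0; have [N H] := al _ e0.
have := H _ (leq_maxl N N0); have := aM _ (leq_maxr N N0).
set n := maxn N N0; have := cnormB (a n) (a n - l).
by rewrite opprB addrC subrK; lra.
Qed.

Lemma tendsto_real (r : nat -> R) l : tendsto (fun n => (r n)%:C%C) l ->
  l = (complex.Re l)%:C%C /\
  forall e : R, 0 < e -> exists N, forall n, (N <= n)%N -> `|r n - complex.Re l| < e.
Proof.
case: l => x y H; split.
  suff -> : y = 0 by [].
  apply/eqP; rewrite -normr_le0; apply/ler_addgt0Pl => e /H[N HN].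
  have := le_lt_trans (cnorm_Im _) (HN N (leqnn _)).
  by rewrite /= sub0r normrN addr0 => /ltW.
by move=> e /H[N HN]; exists N => n /HN /(le_lt_trans (cnorm_Re _)).
Qed.

Lemma real_cauchy (u : nat -> R) :
  (forall e : R, 0 < e -> exists N, forall m n, (N <= m)%N -> (N <= n)%N ->
     `|u m - u n| < e) ->
  exists r : R, forall e : R, 0 < e -> exists N, forall n, (N <= n)%N ->
     `|u n - r| < e.
Proof.
move=> H; have cu : cauchy (u @ \oo).
  apply: cauchy_exP => e e0; have [N HN] := H _ e0.
  exists (u N); exists N => // n /= Nn; rewrite -ball_normE /=.
  exact: HN.
have /cvg_ex[/= l /cvgrPdist_lt ul] : cvg (u @ \oo) by exact: cauchy_cvg.
exists l => e e0; have := ul e e0.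
by move=> [N _ HN]; exists N => n Nn; rewrite distrC; exact: HN.
Qed.

Lemma ccauchy_tendsto a : ccauchy a -> exists l, tendsto a l.
Proof.
move=> ca.
have [e e0|x Hx] := @real_cauchy (fun n => complex.Re (a n)).
  have [N HN] := ca _ e0; exists N => m n Nm Nn.
  have -> : complex.Re (a m) - complex.Re (a n) = complex.Re (a m - a n).
    by case: (a m); case: (a n).
  exact: le_lt_trans (cnorm_Re _) (HN _ _ Nm Nn).
have [e e0|y Hy] := @real_cauchy (fun n => complex.Im (a n)).
  have [N HN] := ca _ e0; exists N => m n Nm Nn.
  have -> : complex.Im (a m) - complex.Im (a n) = complex.Im (a m - a n).
    by case: (a m); case: (a n).
  exact: le_lt_trans (cnorm_Im _) (HN _ _ Nm Nn).
exists (Complex x y) => e e0; have e2 : 0 < e / 2 by rewrite divr_gt0.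
have [N1 H1] := Hx _ e2; have [N2 H2] := Hy _ e2.
exists (maxn N1 N2) => n; rewrite geq_max => /andP[/H1 h1 /H2 h2].
apply: (le_lt_trans (cnorm_le_ReIm _)).
have -> : complex.Re (a n - Complex x y) = complex.Re (a n) - x by case: (a n).
have -> : complex.Im (a n - Complex x y) = complex.Im (a n) - y by case: (a n).
lra.
Qed.

End ComplexSequences.

(** * Hilbert spaces from positive semidefinite forms *)

Record psd_form (R : realType) (V : lmodType R[i]) (D : set V)
    (s : V -> V -> R[i]) : Prop := PsdForm {
  psd_D0 : D 0;
  psd_Dlin : forall (c : R[i]) x y, D x -> D y -> D (c *: x + y);
  psd_linl : forall (c : R[i]) x y z, D x -> D y -> D z ->
    s (c *: x + y) z = c * s x z + s y z;
  psd_herm : forall x y, D x -> D y -> s y x = Num.conj (s x y);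
  psd_ge0 : forall x, D x -> 0 <= s x x }.

Section PsdForm.
Variables (R : realType) (V : lmodType R[i]) (D : set V) (s : V -> V -> R[i]).
Local Notation C := R[i].
Implicit Types x y z : V.
Hypothesis hs : psd_form D s.
Let D0 := psd_D0 hs.
Let Dlin := psd_Dlin hs.
Let s_linl := psd_linl hs.
Let s_herm := psd_herm hs.
Let s_ge0 := psd_ge0 hs.

Lemma form_linr (c : C) x y z : D x -> D y -> D z ->
  s z (c *: x + y) = Num.conj c * s z x + s z y.
Proof.
move=> Dx Dy Dz; rewrite (s_herm (Dlin c Dx Dy) Dz) s_linl // rmorphD rmorphM /=.
by rewrite -!s_herm.
Qed.

Lemma psd_DB x y : D x -> D y -> D (x - y).
Proof. by move=> Dx Dy; rewrite addrC -scaleN1r; exact: Dlin. Qed.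
Lemma psd_DZ (c : C) x : D x -> D (c *: x).
Proof. by move=> Dx; rewrite -[_ *: _]addr0; exact: Dlin. Qed.
Lemma psd_DD x y : D x -> D y -> D (x + y).
Proof. by move=> Dx Dy; rewrite -[x]scale1r; exact: Dlin. Qed.

Lemma form_addl x y z : D x -> D y -> D z -> s (x + y) z = s x z + s y z.
Proof. by move=> *; rewrite -[x]scale1r s_linl // mul1r scale1r. Qed.
Lemma form_addr x y z : D x -> D y -> D z -> s z (x + y) = s z x + s z y.
Proof. by move=> *; rewrite -[x]scale1r form_linr // rmorph1 mul1r scale1r. Qed.
Lemma form_0l z : D z -> s 0 z = 0.
Proof.
move=> Dz; have := form_addl D0 D0 Dz; rewrite addr0 => /eqP.
by rewrite -subr_eq subrr eq_sym => /eqP.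
Qed.
Lemma form_scalel (c : C) x z : D x -> D z -> s (c *: x) z = c * s x z.
Proof. by move=> *; rewrite -[_ *: _]addr0 s_linl // form_0l // addr0. Qed.
Lemma form_scaler (c : C) x z : D x -> D z -> s z (c *: x) = Num.conj c * s z x.
Proof.
by move=> *; rewrite s_herm ?form_scalel // 1?rmorphM /= -?s_herm //; exact: psd_DZ.
Qed.
Lemma form_subl x y z : D x -> D y -> D z -> s (x - y) z = s x z - s y z.
Proof. by move=> *; rewrite addrC -scaleN1r s_linl // mulN1r addrC. Qed.
Lemma form_subr x y z : D x -> D y -> D z -> s z (x - y) = s z x - s z y.
Proof. by move=> *; rewrite addrC -scaleN1r form_linr // rmorphN1 mulN1r addrC. Qed.

Definition seminorm x : R := Num.sqrt (complex.Re (s x x)).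

Lemma seminorm_ge0 x : 0 <= seminorm x. Proof. exact: sqrtr_ge0. Qed.

Lemma form_diag x : D x -> s x x = ((seminorm x) ^+ 2)%:C%C.
Proof.
move=> Dx; have := s_ge0 Dx; rewrite /seminorm lecE /= => /andP[/eqP im re].
rewrite sqr_sqrtr //; case: (s x x) im => a b /= ->; by [].
Qed.

Lemma form_CS x y : D x -> D y -> cnorm (s x y) <= seminorm x * seminorm y.
Proof.
move=> Dx Dy; set z := s x y.
have [N zz NE] : exists2 N : R, z * Num.conj z = N%:C%C & N = cnorm z ^+ 2.
  by exists (cnorm z ^+ 2) => //; rewrite cnorm_sqr.
have H t : 0 <= seminorm x ^+ 2 + 2 * t * N + t ^+ 2 * (N * seminorm y ^+ 2).
  set c := t%:C%C * z; have Dcy : D (c *: y) by exact: psd_DZ.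
  have := s_ge0 (psd_DD Dx Dcy).
  rewrite form_addl ?form_addr ?form_scalel ?form_scaler //; try exact: psd_DD.
  rewrite (s_herm Dx Dy) -/z !form_diag //.
  have cc : Num.conj c = t%:C%C * Num.conj z.
    by rewrite rmorphM /= conj_Creal // complex_real.
  have -> : ((seminorm x) ^+ 2)%:C%C + Num.conj c * z +
      (c * Num.conj z + c * (Num.conj c * ((seminorm y) ^+ 2)%:C%C)) =
     (seminorm x ^+ 2 + 2 * t * N + t ^+ 2 * (N * seminorm y ^+ 2))%:C%C.
    rewrite cc /c !(rmorphD, rmorphM, rmorphXn) /= -zz rmorph1; ring.
  by rewrite ler0c.
have := discriminant_le H.
have [N0|N0] := eqVneq (cnorm z) 0; first by rewrite N0 mulr_ge0 ?seminorm_ge0.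
have Np : 0 < N by rewrite NE exprn_gt0 // lt_def N0 cnorm_ge0.
rewrite expr2 mulrCA ler_pM2l // NE -exprMn ler_pXn2r // nnegrE ?cnorm_ge0 //.
by rewrite mulr_ge0 ?seminorm_ge0.
Qed.

Lemma seminormD x y : D x -> D y -> seminorm (x + y) <= seminorm x + seminorm y.
Proof.
move=> Dx Dy; have qx := seminorm_ge0 x; have qy := seminorm_ge0 y.
rewrite -(@ler_pXn2r _ 2) ?nnegrE ?seminorm_ge0 ?addr_ge0 //.
have := form_diag (psd_DD Dx Dy); rewrite form_addl ?form_addr //; try exact: psd_DD.
rewrite !form_diag // (s_herm Dx Dy) => /(congr1 (@complex.Re R)).
have := le_trans (ler_norm _) (le_trans (cnorm_Re _) (form_CS Dx Dy)).
have -> : Num.conj (s x y) = (complex.Re (s x y) -i* complex.Im (s x y))%C.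
  by case: (s x y).
case: (s x y) => a b /= h <-; rewrite sqrrD; lra.
Qed.

Lemma seminormZ (c : C) x : D x -> seminorm (c *: x) = cnorm c * seminorm x.
Proof.
move=> Dx; apply/eqP; rewrite -(@eqrXn2 _ 2) ?seminorm_ge0 //; last first.
  by rewrite mulr_ge0 ?seminorm_ge0 ?cnorm_ge0.
apply/eqP/(@complexI R); rewrite -(form_diag (psd_DZ c Dx)) (form_scalel _ Dx) ?(form_scaler _ Dx) //;
  last exact: psd_DZ.
by rewrite mulrA -cnorm_sqr (form_diag Dx) -rmorphM -exprMn.
Qed.

Lemma form_lipschitz x x' y y' : D x -> D x' -> D y -> D y' ->
  cnorm (s x y - s x' y') <=
    seminorm (x - x') * seminorm y + seminorm x' * seminorm (y - y').
Proof.
move=> Dx Dx' Dy Dy'; have -> : s x y - s x' y' = s (x - x') y + s x' (y - y').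
  by rewrite form_subl // form_subr //; ring.
by apply: (le_trans (cnormD _ _)); rewrite lerD // form_CS //; exact: psd_DB.
Qed.

Lemma seminorm0 : seminorm 0 = 0.
Proof. by rewrite /seminorm form_0l // sqrtr0. Qed.

End PsdForm.

Section InnerProductNorm.
Variables (R : realType) (W : inner_product_space R).
Implicit Types v w : W.

Lemma ips_psd : psd_form [set: W] (ips_dot W).
Proof.
split=> //.
  by move=> c x y z _ _ _; rewrite linearPl.
by move=> x y _ _; rewrite hermC /= expr0 mul1r.
Qed.

Lemma hnorm_ge0 v : 0 <= hnorm v. Proof. exact: sqrtr_ge0. Qed.

Lemma hnormD v w : hnorm (v + w) <= hnorm v + hnorm w.
Proof. exact: (seminormD ips_psd (x := v) (y := w)). Qed.

Lemma hnormZ (c : R[i]) v : hnorm (c *: v) = cnorm c * hnorm v.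
Proof. exact: (seminormZ ips_psd c (x := v)). Qed.

Lemma hnormN v : hnorm (- v) = hnorm v.
Proof. by rewrite -scaleN1r hnormZ /cnorm normrN1 mul1r. Qed.

Lemma hnormB v w : hnorm (v - w) <= hnorm v + hnorm w.
Proof. by rewrite -(hnormN w); exact: hnormD. Qed.

Lemma hnorm_CS v w : cnorm (ips_dot W v w) <= hnorm v * hnorm w.
Proof. exact: (form_CS ips_psd (x := v) (y := w)). Qed.

Lemma hnorm_dot v : ips_dot W v v = ((hnorm v) ^+ 2)%:C%C.
Proof. exact: (form_diag ips_psd (x := v)). Qed.

End InnerProductNorm.

Section FormSpace.
Variables (R : realType) (V : lmodType R[i]) (D : set V) (s : V -> V -> R[i]).
Variables (full : bool) (hs : psd_form D s).
Local Notation C := R[i].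
Implicit Types (x y z : V) (u w : nat -> V) (F G : V -> C).
Local Notation D0 := (psd_D0 hs).
Local Notation Dlin := (psd_Dlin hs).
Local Notation s_linl := (psd_linl hs).
Local Notation s_herm := (psd_herm hs).
Local Notation DB := (psd_DB hs).
Local Notation DZ := (psd_DZ hs).
Local Notation s0l := (form_0l hs).
Local Notation sBl := (form_subl hs).
Local Notation form_CS := (form_CS hs).
Local Notation form_diag := (form_diag hs).
Local Notation seminorm := (seminorm s).
Local Notation seminorm_ge0 := (seminorm_ge0 s).
Local Notation seminormD := (seminormD hs).
Local Notation seminormZ := (seminormZ hs).
Local Notation seminorm0 := (seminorm0 hs).
Local Notation form_lipschitz := (form_lipschitz hs).

Definition cauchy_in u := forall e : R, 0 < e -> exists N, forall m n,
  (N <= m)%N -> (N <= n)%N -> seminorm (u m - u n) < e.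

(** Constant sequences yield the quotient by the null vectors, Cauchy sequences
    its completion. *)
Definition admissible u := (forall n, D (u n)) /\
  if full then cauchy_in u else forall n, u n = u 0%N.

Lemma admissible_cauchy u : admissible u -> cauchy_in u.
Proof.
rewrite /admissible; case: full => -[Du] // cu e e0.
by exists 0%N => m n _ _; rewrite (cu m) (cu n) subrr seminorm0.
Qed.

Lemma admissible_D u n : admissible u -> D (u n).
Proof. by case. Qed.

Lemma admissible_cst x : D x -> admissible (fun=> x).
Proof.
split=> //; case: full => // e e0.
by exists 0%N => m n _ _; rewrite subrr seminorm0.
Qed.

Lemma admissible_lin (c : C) u w : admissible u -> admissible w ->
  admissible (fun n => c *: u n + w n).
Proof.
move=> au aw; split=> [n|]; first by apply: Dlin; exact: admissible_D.
have [cu cw] := (admissible_cauchy au, admissible_cauchy aw).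
have [Du Dw] := (au.1, aw.1).
move: au aw; rewrite /admissible; case: full => -[_ ku] [_ kw]; last first.
  by move=> n; rewrite ku kw.
move=> e e0; have c0 := cnorm_ge0 c.
have e1 : 0 < e / 2 by rewrite divr_gt0.
have e2 : 0 < e / 2 / (cnorm c + 1) by rewrite divr_gt0 //; lra.
have [N1 H1] := cu _ e2; have [N2 H2] := cw _ e1.
exists (maxn N1 N2) => m n; rewrite !geq_max => /andP[m1 m2] /andP[n1 n2].
have -> : c *: u m + w m - (c *: u n + w n) = c *: (u m - u n) + (w m - w n).
  by rewrite scalerBr opprD addrACA.
have Duu : D (u m - u n) by exact: DB.
apply: (le_lt_trans (seminormD _ _)); [exact: DZ|exact: DB|].
rewrite seminormZ //; have := H2 _ _ m2 n2; have := H1 _ _ m1 n1.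
have c1 : 0 < cnorm c + 1 by lra.
rewrite (ltr_pdivlMr _ _ c1).
by have := seminorm_ge0 (u m - u n); nra.
Qed.

Lemma admissible_bounded u : admissible u ->
  exists2 M : R, 0 < M & exists N, forall n, (N <= n)%N -> seminorm (u n) <= M.
Proof.
move=> au; have [N HN] := admissible_cauchy au ltr01.
exists (seminorm (u N) + 1); first by have := seminorm_ge0 (u N); lra.
exists N => n Nn; have := HN _ _ Nn (leqnn N).
have := seminormD (x := u n - u N) (DB (admissible_D n au) (admissible_D N au)) (admissible_D N au).
by rewrite subrK; lra.
Qed.

Lemma form_ccauchy u w : admissible u -> admissible w ->
  ccauchy (fun n => s (u n) (w n)).
Proof.
move=> au aw e e0.
have [M1 M10 [N1 H1]] := admissible_bounded au.
have [M2 M20 [N2 H2]] := admissible_bounded aw.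
have eu : 0 < e / 2 / M2 by rewrite !divr_gt0.
have ew : 0 < e / 2 / M1 by rewrite !divr_gt0.
have [N3 H3] := admissible_cauchy au eu.
have [N4 H4] := admissible_cauchy aw ew.
exists (maxn (maxn N1 N2) (maxn N3 N4)) => m n.
rewrite !geq_max => /andP[/andP[m1 m2] /andP[m3 m4]] /andP[/andP[n1 n2] /andP[n3 n4]].
apply: (le_lt_trans (form_lipschitz _ _ _ _)); try exact: admissible_D.
have := H3 _ _ m3 n3; have := H4 _ _ m4 n4; rewrite !ltr_pdivlMr //.
have := H1 _ n1; have := H2 _ m2.
have := seminorm_ge0 (u m - u n); have := seminorm_ge0 (w m - w n).
have := seminorm_ge0 (u n); have := seminorm_ge0 (w m).
move: (seminorm _) (seminorm _) (seminorm _) (seminorm _) => a b c d.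
nra.
Qed.

(** The functional limit of the s (u n); it determines u up to null sequences. *)
Definition represents u F := [/\ admissible u,
  forall x, D x -> tendsto (fun n => s (u n) x) (F x) & forall x, ~ D x -> F x = 0].

Lemma represents_exists u : admissible u -> exists F, represents u F.
Proof.
move=> au.
have lim x : exists l, (D x -> tendsto (fun n => s (u n) x) l) /\ (~ D x -> l = 0).
  have [Dx|nDx] := pselect (D x); last by exists 0; split.
  have [l Hl] := ccauchy_tendsto (form_ccauchy au (admissible_cst Dx)).
  by exists l.
exists (fun x => sval (cid (lim x))); split=> // x Dx.
  exact: (svalP (cid (lim x))).1.
exact: (svalP (cid (lim x))).2.
Qed.

Lemma represents_fun u F G : represents u F -> represents u G -> F = G.
Proof.
move=> [_ hF zF] [_ hG zG]; apply/funext => x.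
have [Dx|nDx] := pselect (D x); last by rewrite zF // zG.
exact: tendsto_unique (hF x Dx) (hG x Dx).
Qed.

Lemma represents_lin (c : C) u w F G : represents u F -> represents w G ->
  represents (fun n => c *: u n + w n) (fun x => c * F x + G x).
Proof.
move=> [au hF zF] [aw hG zG]; split; first exact: admissible_lin.
- move=> x Dx; apply: eq_tendsto (tendsto_lin c (hF x Dx) (hG x Dx)) => n.
  by rewrite s_linl //; apply: admissible_D.
- by move=> x nDx; rewrite zF // zG // mulr0 addr0.
Qed.

Definition representable : {pred (V -> C : lmodType C)} :=
  fun F => `[< exists u, represents u F >].

Lemma representableP F : reflect (exists u, represents u F) (F \in representable).
Proof. exact: asboolP. Qed.

Lemma representable_submod : submod_closed representable.
Proof.
split=> [|c F G /representableP[u uF] /representableP[w wG]].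
  apply/representableP; exists (fun=> 0); split; first exact: admissible_cst D0.
    by move=> x Dx; rewrite s0l //; exact: tendsto_cst.
  by [].
apply/representableP; exists (fun n => c *: u n + w n).
exact: represents_lin.
Qed.
HB.instance Definition _ := GRing.isSubmodClosed.Build C (V -> C) representable
  (GRing.submod_closed_semi representable_submod).

Record form_space := FormSpace { form_val :> V -> C; _ : form_val \in representable }.
HB.instance Definition _ := [isSub for form_val].
HB.instance Definition _ := [Choice of form_space by <:].
HB.instance Definition _ := [SubChoice_isSubLmodule of form_space by <:].
Implicit Types f g : form_space.

Lemma form_spaceP f : exists u, represents u f.
Proof. by apply/representableP; case: f. Qed.

(** The inner product is the diagonal limit; this lemma shows that a sequence
    may be replaced by the functional that it represents. *)
Lemma diag_approx u w F (e : R) : represents u F -> admissible w -> 0 < e ->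
  exists N, forall m, (N <= m)%N -> cnorm (F (w m) - s (u m) (w m)) <= e.
Proof.
move=> [au hF _] aw e0; have [M M0 [N1 H1]] := admissible_bounded aw.
have [N2 H2] := admissible_cauchy au (divr_gt0 e0 M0).
exists (maxn N1 N2) => m; rewrite geq_max => /andP[m1 m2].
have Dwm : D (w m) by exact: admissible_D.
have lim : tendsto (fun n => s (u n) (w m) - s (u m) (w m)) (F (w m) - s (u m) (w m)).
  apply: eq_tendsto (_ : tendsto (fun n => 1 * s (u n) (w m) + - s (u m) (w m)) _) => [n|].
    by rewrite mul1r.
  rewrite -[F (w m)]mul1r; apply: tendsto_lin; [exact: hF|exact: tendsto_cst].
apply: (tendsto_le (N0 := N2) lim) => n n2.
have Dn := admissible_D n au; have Dm := admissible_D m au.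
rewrite -sBl //; apply: (le_trans (form_CS (DB Dn Dm) Dwm)).
have := H2 _ _ n2 m2; rewrite ltr_pdivlMr // => h.
apply: le_trans (ltW h); rewrite ler_wpM2l ?seminorm_ge0 //; exact: H1.
Qed.

Lemma diag_change u u' w F (l : C) : represents u F -> represents u' F ->
  admissible w -> tendsto (fun n => s (u n) (w n)) l ->
  tendsto (fun n => s (u' n) (w n)) l.
Proof.
move=> uF u'F aw ul; apply: (tendsto_squeeze ul) => e e0.
have e2 : 0 < e / 2 by rewrite divr_gt0.
have [N1 H1] := diag_approx uF aw e2; have [N2 H2] := diag_approx u'F aw e2.
exists (maxn N1 N2) => n; rewrite geq_max => /andP[/H1 h1 /H2 h2].
have -> : s (u' n) (w n) - l = (s (u n) (w n) - l) +
    ((F (w n) - s (u n) (w n)) - (F (w n) - s (u' n) (w n))) by ring.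
apply: (le_trans (cnormD _ _)); rewrite lerD2l.
apply: (le_trans (cnormB _ _)); lra.
Qed.

Definition form_dot f g : C := xget 0 [set l | exists u w,
  [/\ represents u f, represents w g & tendsto (fun n => s (u n) (w n)) l]].

Lemma diag_herm u w (l : C) : admissible u -> admissible w ->
  tendsto (fun n => s (u n) (w n)) l -> tendsto (fun n => s (w n) (u n)) (Num.conj l).
Proof.
move=> au aw /tendsto_conj; apply: eq_tendsto => n.
by rewrite -s_herm //; exact: admissible_D.
Qed.

Lemma form_dotP u w f g : represents u f -> represents w g ->
  tendsto (fun n => s (u n) (w n)) (form_dot f g).
Proof.
move=> uf wg; have [au _ _] := uf; have [aw _ _] := wg.
rewrite /form_dot; case: xgetP => [l _ [u' [w' [u'f w'g H]]]|H].
  have [au' _ _] := u'f; have [aw' _ _] := w'g.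
  have H1 := diag_herm au aw' (diag_change u'f uf aw' H).
  have := diag_herm aw au (diag_change w'g wg au H1).
  by rewrite conjCK.
have [l Hl] := ccauchy_tendsto (form_ccauchy au aw).
by case: (H l); exists u, w.
Qed.

Lemma form_dot_linear_l g : GRing.linear_for *%R (form_dot ^~ g).
Proof.
move=> c f f'; have [w wg] := form_spaceP g; have [aw _ _] := wg.
have [u uf] := form_spaceP f; have [u' u'f] := form_spaceP f'.
have r : represents (fun n => c *: u n + u' n) (c *: f + f').
  exact: (represents_lin c uf u'f).
apply: tendsto_unique (form_dotP r wg) _.
apply: eq_tendsto (tendsto_lin c (form_dotP uf wg) (form_dotP u'f wg)) => n.
by rewrite s_linl //; apply: admissible_D => //; [case: uf|case: u'f].
Qed.

Lemma form_dot_herm f g : form_dot f g = (-1) ^+ false * Num.conj (form_dot g f).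
Proof.
rewrite expr0 mul1r; have [w wg] := form_spaceP g; have [u uf] := form_spaceP f.
apply: tendsto_unique (form_dotP uf wg) _.
by apply: diag_herm (form_dotP wg uf); [case: wg|case: uf].
Qed.

Lemma form_dot_linear_r f : GRing.linear_for (Num.conj \; *%R) (form_dot f).
Proof.
move=> c g g' /=; rewrite form_dot_herm expr0 mul1r form_dot_linear_l rmorphD rmorphM /=.
by rewrite [form_dot f g]form_dot_herm [form_dot f g']form_dot_herm !expr0 !mul1r.
Qed.

Lemma form_dot_gt0 f : f != 0 -> 0 < form_dot f f.
Proof.
move=> f0; have [u uf] := form_spaceP f; have [au hF zf] := uf.
have lim : tendsto (fun n => ((seminorm (u n)) ^+ 2)%:C%C) (form_dot f f).
  apply: eq_tendsto (form_dotP uf uf) => n.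
  by apply: form_diag; exact: admissible_D.
have [re H] := tendsto_real lim.
suff : 0 < complex.Re (form_dot f f) by rewrite [X in _ -> 0 < X]re ltcR.
move: (complex.Re _) H => l H.
have l0 : 0 <= l.
  apply/ler_addgt0Pl => e /H[N /(_ N (leqnn _))].
  by rewrite ltr_norml => /andP[_ h]; have := sqr_ge0 (seminorm (u N)); lra.
rewrite lt_def l0 andbT; apply: contra_neq f0 => l00.
apply: val_inj; apply/funext => x /=.
have [Dx|/zf //] := pselect (D x).
apply/cnorm_eq0/le_anti; rewrite cnorm_ge0 andbT; apply/ler_addgt0Pl => e e0.
rewrite addr0; have q0 := seminorm_ge0 x; pose d := e / (seminorm x + 1).
have d0 : 0 < d by rewrite divr_gt0 //; lra.
have [N HN] := H _ (exprn_gt0 2 d0).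
apply: (tendsto_le (N0 := N) (hF x Dx)) => n /HN.
rewrite l00 subr0 ger0_norm ?sqr_ge0 // ltr_pXn2r ?nnegrE ?seminorm_ge0 ?(ltW d0) //.
move=> un; apply: (le_trans (form_CS (admissible_D n au) Dx)).
have : d * (seminorm x + 1) = e by rewrite /d divfK // gt_eqF //; lra.
by have := seminorm_ge0 (u n); nra.
Qed.

HB.instance Definition _ := bilinear_isBilinear.Build C form_space form_space C
  *%R (Num.conj \; *%R) form_dot (conj form_dot_linear_l form_dot_linear_r).
HB.instance Definition _ := isHermitianSesquilinear.Build C form_space false
  (Num.conj : C -> C) form_dot form_dot_herm.
HB.instance Definition _ := isDotProduct.Build C form_space form_dot form_dot_gt0.

Definition form_ips : inner_product_space R :=
  @InnerProductSpace R form_space form_dot.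

Lemma represents_norm_le u f (M : R) N : 0 <= M -> represents u f ->
  (forall n, (N <= n)%N -> seminorm (u n) <= M) -> @hnorm R form_ips f <= M.
Proof.
move=> M0 uf uM; have [au _ _] := uf.
have lim : tendsto (fun n => s (u n) (u n)) (form_dot f f) by exact: form_dotP.
rewrite /hnorm -[leRHS]ger0_norm // -sqrtr_sqr ler_wsqrtr //.
apply: le_trans (ler_norm _) (le_trans (cnorm_Re _) _).
apply: (tendsto_le (N0 := N) lim) => n /uM un.
rewrite form_diag ?cnorm_real ?sqr_ge0 //; last exact: admissible_D.
by rewrite ler_pXn2r ?nnegrE ?seminorm_ge0.
Qed.

Lemma represents_norm_ge u f (e : R) : 0 < e -> represents u f ->
  exists N, forall n, (N <= n)%N -> seminorm (u n) <= @hnorm R form_ips f + e.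
Proof.
move=> e0 uf; have [au _ _] := uf.
have lim : tendsto (fun n => ((seminorm (u n)) ^+ 2)%:C%C) (form_dot f f).
  by apply: eq_tendsto (form_dotP uf uf) => n; apply: form_diag; exact: admissible_D.
have [re H] := tendsto_real lim.
have l0 : 0 <= complex.Re (form_dot f f).
  have := dnorm_ge0 (form_dot : {dot _ for _}) f.
  by rewrite lecE => /andP[].
have [N HN] := H _ (exprn_gt0 2 e0); exists N => n /HN.
have h0 : 0 <= @hnorm R form_ips f by exact: sqrtr_ge0.
rewrite -[complex.Re _]sqr_sqrtr // -/(@hnorm R form_ips f) ltr_norml => /andP[_ h].
have q0 := seminorm_ge0 (u n).
rewrite -(@ler_pXn2r _ 2) ?nnegrE //; last by rewrite addr_ge0 ?(ltW e0).
by rewrite sqrrD; have := mulr_ge0 h0 (ltW e0); move: h; lra.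
Qed.

Definition form_emb x : form_space :=
  insubd 0 (fun y => if `[< D y >] then s x y else 0).

Lemma represents_insubd u F : represents u F -> represents u (insubd (0 : form_space) F).
Proof. by move=> uF; rewrite insubdK //; apply/representableP; exists u. Qed.

Lemma represents_emb x : D x -> represents (fun=> x) (form_emb x).
Proof.
move=> Dx; apply: represents_insubd; split; first exact: admissible_cst.
  by move=> y Dy; rewrite asboolT //; exact: tendsto_cst.
by move=> y nDy; rewrite asboolF.
Qed.

Lemma form_dot_emb x y : D x -> D y -> form_dot (form_emb x) (form_emb y) = s x y.
Proof.
move=> Dx Dy; apply: tendsto_unique (tendsto_cst _).
exact: form_dotP (represents_emb Dx) (represents_emb Dy).
Qed.

Lemma form_space_eq u f g : represents u f -> represents u g -> f = g.
Proof. by move=> uf ug; apply: val_inj; exact: represents_fun uf ug. Qed.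

Lemma form_emb_dense u f (e : R) : 0 < e -> represents u f ->
  exists N, forall n, (N <= n)%N -> @hnorm R form_ips (f - form_emb (u n)) <= e.
Proof.
move=> e0 uf; have [au _ _] := uf; have [N HN] := admissible_cauchy au e0.
exists N => n Nn; have Dn := admissible_D n au.
have r : represents (fun m => -1 *: u n + u m) (f - form_emb (u n)).
  have -> : f - form_emb (u n) = -1 *: form_emb (u n) + f by rewrite scaleN1r addrC.
  exact: represents_lin (represents_emb Dn) uf.
apply: (represents_norm_le (ltW e0) r (N := N)) => m Nm.
by rewrite scaleN1r addrC ltW // HN.
Qed.

(** An operator acts on the functionals through composition with its adjoint. *)
Definition form_op (T' : V -> V) f : form_space :=
  insubd 0 (fun y => if `[< D y >] then f (T' y) else 0).

Lemma form_opP (T T' : V -> V) u f :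
  (forall x, D x -> D (T x)) -> (forall x, D x -> D (T' x)) ->
  (forall (c : C) x y, D x -> D y -> T (c *: x + y) = c *: T x + T y) ->
  (forall x y, D x -> D y -> s (T x) y = s x (T' y)) ->
  (full -> exists2 M : R, 0 <= M & forall x, D x -> seminorm (T x) <= M * seminorm x) ->
  represents u f -> represents (T \o u) (form_op T' f).
Proof.
move=> DT DT' Tlin adj bd [au hf zf]; apply: represents_insubd; split.
- split=> [n|]; first by apply: DT; exact: admissible_D.
  have := au.2; move: bd; case: full => [/(_ isT)[M M0 bd] cu|_ ku n]; last first.
    by rewrite /= ku.
  move=> e e0; have e1 : 0 < e / (M + 1) by rewrite divr_gt0 //; lra.
  have [N HN] := cu _ e1; exists N => m n Nm Nn /=.
  have Dm := admissible_D m au; have Dn := admissible_D n au.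
  have -> : T (u m) - T (u n) = T (u m - u n).
    by rewrite addrC -scaleN1r -Tlin // scaleN1r addrC.
  apply: (le_lt_trans (bd _ (DB Dm Dn))); have := HN _ _ Nm Nn.
  have M1 : 0 < M + 1 by lra.
  by rewrite (ltr_pdivlMr _ _ M1); have := seminorm_ge0 (u m - u n); nra.
- move=> y Dy; rewrite asboolT //; apply: eq_tendsto (hf _ (DT' _ Dy)) => n.
  by rewrite /= adj //; exact: admissible_D.
- by move=> y nDy; rewrite asboolF.
Qed.

Lemma form_emb_sub x y : D x -> D y -> form_emb (x - y) = form_emb x - form_emb y.
Proof.
move=> Dx Dy; have r : represents (fun=> -1 *: y + x) (form_emb x - form_emb y).
  have -> : form_emb x - form_emb y = -1 *: form_emb y + form_emb x.
    by rewrite scaleN1r addrC.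
  exact: represents_lin (represents_emb Dy) (represents_emb Dx).
rewrite scaleN1r addrC in r; exact: form_space_eq (represents_emb (DB Dx Dy)) r.
Qed.

Lemma hnorm_emb x : D x -> @hnorm R form_ips (form_emb x) = seminorm x.
Proof. by move=> Dx; rewrite /hnorm /= form_dot_emb. Qed.

(** Approximating each term of a Cauchy sequence by a vector of D gives a Cauchy
    sequence in D, which represents the limit. *)
Lemma form_complete : full -> complete_ips form_ips.
Proof.
move=> fl U cU.
have pos k : 0 < k.+1%:R^-1 :> R by rewrite invr_gt0.
have app k : exists x, D x /\ @hnorm R form_ips (U k - form_emb x) <= k.+1%:R^-1.
  have [u uU] := form_spaceP (U k); have [N HN] := form_emb_dense (pos k) uU.
  exists (u N); split; last exact: HN.
  by apply: admissible_D; case: uU.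
have [X HX] := choice app.
have small (e : R) : 0 < e -> exists N, forall k, (N <= k)%N -> k.+1%:R^-1 < e.
  move=> e0; exists (Num.truncn e^-1) => k Nk.
  rewrite -[ltRHS]invrK ltf_pV2 ?posrE ?invr_gt0 //.
  by apply: lt_le_trans (@truncnS_gt R _) _; rewrite ler_nat ltnS.
have aX : admissible X.
  split=> [n|]; first by have [] := HX n.
  rewrite fl => e e0; have e3 : 0 < e / 3 by rewrite divr_gt0.
  have [N1 H1] := cU _ e3; have [N2 H2] := small _ e3.
  exists (maxn N1 N2) => m n; rewrite !geq_max => /andP[m1 m2] /andP[n1 n2].
  have [[Dm hm] [Dn hn]] := (HX m, HX n).
  rewrite -(hnorm_emb (DB Dm Dn)) form_emb_sub //.
  have -> : form_emb (X m) - form_emb (X n) =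
     (U m - U n) - ((U m - form_emb (X m)) - (U n - form_emb (X n))).
    by rewrite [in RHS]opprB [in RHS]opprB [in RHS]addrA subrKA [in RHS]addrC subrKA.
  apply: (le_lt_trans (hnormB _ _)).
  apply: (le_lt_trans (lerD (ltW (H1 _ _ m1 n1))
    (le_trans (hnormB _ _) (lerD hm hn)))).
  have := H2 _ m2; have := H2 _ n2; move: (m.+1%:R^-1) (n.+1%:R^-1) => a b.
  by lra.
have [G XG] := represents_exists aX.
exists (insubd (0 : form_space) G) => e e0.
have XL := represents_insubd XG.
have e2 : 0 < e / 2 by rewrite divr_gt0.
have e4 : 0 < e / 4 by rewrite divr_gt0.
have [N1 H1] := form_emb_dense e4 XL; have [N2 H2] := small _ e2.
exists (maxn N1 N2) => n; rewrite geq_max => /andP[/H1 h1 /H2 h2].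
have [_ hn] := HX n; set L := insubd _ _ in h1 *.
have -> : U n - L = (U n - form_emb (X n)) - (L - form_emb (X n)).
  by rewrite opprB addrA subrK.
apply: (le_lt_trans (hnormB _ _)); apply: (le_lt_trans (lerD hn h1)).
by move: h2; move: (n.+1%:R^-1) => a; lra.
Qed.

Lemma form_op_bounded (T T' : V -> V) (M : R) f :
  (forall x, D x -> D (T x)) -> (forall x, D x -> D (T' x)) ->
  (forall (c : C) x y, D x -> D y -> T (c *: x + y) = c *: T x + T y) ->
  (forall x y, D x -> D y -> s (T x) y = s x (T' y)) ->
  0 <= M -> (forall x, D x -> seminorm (T x) <= M * seminorm x) ->
  @hnorm R form_ips (form_op T' f) <= M * @hnorm R form_ips f.
Proof.
move=> DT DT' Tlin adj M0 bd; have [u uf] := form_spaceP f.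
have uT : represents (T \o u) (form_op T' f).
  by apply: form_opP => // _; exists M.
apply/ler_addgt0Pr => e e0; have e1 : 0 < e / (M + 1) by rewrite divr_gt0 //; lra.
have [N HN] := represents_norm_ge e1 uf.
have h0 : 0 <= @hnorm R form_ips f by exact: sqrtr_ge0.
apply: (represents_norm_le _ uT (N := N)) => [|n Nn].
  by rewrite addr_ge0 ?mulr_ge0 ?(ltW e0).
apply: (le_trans (bd _ _)); first by apply: admissible_D; case: uf.
apply: le_trans (_ : M * (@hnorm R form_ips f + e / (M + 1)) <= _).
  by rewrite ler_wpM2l // HN.
rewrite mulrDr lerD2l; have : e / (M + 1) * (M + 1) = e by rewrite divfK // gt_eqF //; lra.
by move: (e / (M + 1)) e1 => d d0; nra.
Qed.

End FormSpace.

(** The GNS construction for a *-algebra acting on a semi-inner product space;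
    an unbounded action is only represented on the uncompleted quotient. *)
Lemma form_representation (R : realType) (V : lmodType R[i]) (D : set V)
    (s : V -> V -> R[i]) (full : bool) (B : star_algebra R) (act : B -> V -> V) :
  psd_form D s ->
  (forall (c : R[i]) b1 b2, sa_mem b1 -> sa_mem b2 -> @sa_mem R B (c *: b1 + b2)) ->
  (forall b1 b2, sa_mem b1 -> sa_mem b2 -> @sa_mem R B (sa_mul b1 b2)) ->
  (forall b, sa_mem b -> @sa_mem R B (sa_star b)) ->
  (forall b x, sa_mem b -> D x -> D (act b x)) ->
  (forall b (c : R[i]) x y, sa_mem b -> D x -> D y ->
     act b (c *: x + y) = c *: act b x + act b y) ->
  (forall b x y, sa_mem b -> D x -> D y -> s (act b x) y = s x (act (sa_star b) y)) ->
  (forall (c : R[i]) b1 b2 x, sa_mem b1 -> sa_mem b2 -> D x ->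
     act (c *: b1 + b2) x = c *: act b1 x + act b2 x) ->
  (forall b1 b2 x, sa_mem b1 -> sa_mem b2 -> D x ->
     act (sa_mul b1 b2) x = act b1 (act b2 x)) ->
  (full -> forall b, sa_mem b -> exists2 M : R, 0 <= M & forall x, D x ->
     seminorm s (act b x) <= M * seminorm s x) ->
  exists (W : inner_product_space R) (pi : B -> W -> W) (j : V -> W),
    [/\ pre_star_rep pi,
        forall x, D x -> hnorm (j x) = seminorm s x,
        forall b x, sa_mem b -> D x -> pi b (j x) = j (act b x),
        full -> complete_ips W &
        forall b (M : R), sa_mem b -> 0 <= M ->
          (forall x, D x -> seminorm s (act b x) <= M * seminorm s x) ->
          forall v, hnorm (pi b v) <= M * hnorm v].
Proof.
move=> hs Blin Bmul Bst Dact alin adj actlin actmul bd.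
pose pi b (f : form_ips full hs) : form_ips full hs :=
  form_op hs (act (sa_star b)) f.
have rep b u (f : form_ips full hs) : sa_mem b ->
    represents D s full u f -> represents D s full (act b \o u) (pi b f).
  move=> Bb uf; apply: (form_opP hs) uf.
  - by move=> x Dx; exact: Dact.
  - by move=> x Dx; apply: Dact => //; exact: Bst.
  - by move=> *; exact: alin.
  - by move=> *; exact: adj.
  - by move=> fl; exact: bd.
exists (form_ips full hs), pi, (form_emb full hs); split.
- have pilin b : sa_mem b -> linear (pi b).
    move=> Bb c f g; have [u uf] := form_spaceP f; have [w wg] := form_spaceP g.
    have := rep b _ (c *: f + g) Bb (represents_lin hs c uf wg).
    have := represents_lin hs c (rep _ _ _ Bb uf) (rep _ _ _ Bb wg) => r1 r2.
    apply: (form_space_eq r2); move: r1; congr (represents _ _ _ _ _).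
    apply/funext => n /=; rewrite alin //.
      by case: uf => -[].
    by case: wg => -[].
  have piadj b : sa_mem b -> adjoint_pair (pi b) (pi (sa_star b)).
    move=> Bb f g; have [u uf] := form_spaceP f; have [w wg] := form_spaceP g.
    apply: tendsto_unique (form_dotP hs (rep _ _ _ Bb uf) wg) _.
    apply: eq_tendsto (form_dotP hs uf (rep _ _ _ (Bst _ Bb) wg)) => n /=.
    by rewrite adj //; [case: uf => -[]|case: wg => -[]].
  split=> //.
  + move=> b Bb; split; first exact: pilin.
    by exists (pi (sa_star b)); split; [apply: pilin; exact: Bst|exact: piadj].
  + move=> c b1 b2 B1 B2 f; have [u uf] := form_spaceP f.
    have r1 := rep _ _ _ (Blin c _ _ B1 B2) uf.
    have r2 := represents_lin hs c (rep _ _ _ B1 uf) (rep _ _ _ B2 uf).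
    apply: (form_space_eq r1); move: r2; congr (represents _ _ _ _ _).
    by apply/funext => n /=; rewrite actlin //; case: uf => -[].
  + move=> b1 b2 B1 B2 f; have [u uf] := form_spaceP f.
    have r1 := rep _ _ _ (Bmul _ _ B1 B2) uf.
    have r2 := rep _ _ _ B1 (rep _ _ _ B2 uf).
    apply: (form_space_eq r1); move: r2; congr (represents _ _ _ _ _).
    by apply/funext => n /=; rewrite actmul //; case: uf => -[].
- by move=> x Dx; exact: hnorm_emb.
- move=> b x Bb Dx; have r1 := rep _ _ _ Bb (represents_emb full hs Dx).
  exact: form_space_eq r1 (represents_emb full hs (Dact _ _ Bb Dx)).
- exact: form_complete.
- move=> b M Bb M0 bM v; apply: (form_op_bounded hs (T := act b)) => //.
  + by move=> x Dx; exact: Dact.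
  + by move=> x Dx; apply: Dact => //; exact: Bst.
  + by move=> *; exact: alin.
  + by move=> *; exact: adj.
Qed.

(** * The *-algebra of finitely supported sections *)

Lemma fsumTE (M : zmodType) (I : choiceType) (S : set I) (F : I -> M) :
  finite_set S -> (forall i, ~ S i -> F i = 0) ->
  \sum_(i \in [set: I]) F i = \sum_(i <- fset_set S) F i.
Proof.
move=> fS HF; rewrite (fsbigTE (fset_set S)) // => i.
by rewrite in_fset_set // notin_setE; exact: HF.
Qed.

Lemma fsumT1 (M : zmodType) (I : choiceType) (i : I) (F : I -> M) :
  (forall j, j != i -> F j = 0) -> \sum_(j \in [set: I]) F j = F i.
Proof.
move=> HF; rewrite (fsumTE (S := [set i])) ?fset_set1 ?big_seq_fset1 //.
by move=> j /= /eqP; exact: HF.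
Qed.

Section FibreAccess.
Variables (R : realType) (X : groupoid) (A : Fell_bundle R X).
Local Notation C := R[i].
Local Notation fib := (fib A).
Implicit Types (u v : total_space A) (f k : Cc A).

Lemma in_fibE x (a : fib x) : in_fib x (Tagged fib a) = a.
Proof. by rewrite /in_fib /untag; case: eqP => // p; rewrite /etagged /= eq_axiomK. Qed.

Lemma in_fib_tag u : in_fib (tag u) u = tagged u.
Proof. by case: u => x a; rewrite in_fibE. Qed.

Lemma in_fib_ne z u : tag u != z -> in_fib z u = 0.
Proof. by move=> uz; rewrite /in_fib untag_dflt. Qed.

Lemma in_fib_lin z (c : C) x (a b : fib x) :
  in_fib z (Tagged fib (c *: a + b)) =
  c *: in_fib z (Tagged fib a) + in_fib z (Tagged fib b).
Proof.
have [<-|xz] := eqVneq x z; first by rewrite !in_fibE.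
by rewrite !in_fib_ne // scaler0 addr0.
Qed.

Lemma Cc_eqP f k : (forall x, Cc_val f x = Cc_val k x) -> f = k.
Proof. by move=> H; apply: val_inj; exact: functional_extensionality_dep. Qed.

Lemma Cc_linE (c : C) f k x : Cc_val (c *: f + k) x = c *: Cc_val f x + Cc_val k x.
Proof. by []. Qed.

Lemma Cc_sumE (I : Type) (r : seq I) (P : pred I) (F : I -> Cc A) x :
  Cc_val (\sum_(i <- r | P i) F i) x = \sum_(i <- r | P i) Cc_val (F i) x.
Proof. by elim/big_rec2: _ => // i f a _ <-. Qed.

Lemma Cc_deltaE u z : Cc_val (Cc_delta u) z = in_fib z u. Proof. by []. Qed.

Lemma Cc_delta_lin (c : C) x (a b : fib x) :
  Cc_delta (Tagged fib (c *: a + b)) =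
  c *: Cc_delta (Tagged fib a) + Cc_delta (Tagged fib b).
Proof. by apply: Cc_eqP => z; exact: in_fib_lin. Qed.

Lemma Cc_sum_delta f (S : set X) : finite_set S ->
  (forall x, ~ S x -> Cc_val f x = 0) ->
  f = \sum_(x <- fset_set S) Cc_delta (Tagged fib (Cc_val f x)).
Proof.
move=> fS HS; apply: Cc_eqP => z; rewrite Cc_sumE.
have [Sz|nSz] := pselect (S z).
  rewrite (big_fsetD1 z); last by rewrite in_fset_set //; exact: mem_set.
  rewrite Cc_deltaE in_fibE big1_fset /= ?addr0 // => x.
  by rewrite !inE => /andP[xz _] _; exact: in_fib_ne.
rewrite HS // big1_fset // => x; rewrite in_fset_set // => /set_mem Sx _.
by rewrite Cc_deltaE in_fib_ne //; apply: contra_notN nSz => /eqP <-.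
Qed.

Lemma Cc_ind (P : Cc A -> Prop) : P 0 -> (forall f k, P f -> P k -> P (f + k)) ->
  (forall u, P (Cc_delta u)) -> forall f, P f.
Proof.
move=> P0 PD Pd f; rewrite (@Cc_sum_delta f _ (Cc_finite f)); last first.
  by move=> x /= /negP; rewrite negbK => /eqP.
by elim/big_rec: _ => // x k _; exact: PD.
Qed.

(** ** Multiplication *)

(** The summand of the convolution at z, extended by zero to all pairs so that sums
    over different finite ranges can be compared. *)
Definition mul_term f1 f2 z (p : X * X) : fib z :=
  if (src p.1 == rng p.2) && (gpd_mul p.1 p.2 == z) then
    in_fib z (tmul (Tagged fib (Cc_val f1 p.1)) (Tagged fib (Cc_val f2 p.2))) else 0.

Lemma mul_term_linl (c : C) f1 f2 k z p :
  mul_term (c *: f1 + f2) k z p = c *: mul_term f1 k z p + mul_term f2 k z p.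
Proof.
rewrite /mul_term; case: ifP => [/andP[/eqP xy _]|_]; last by rewrite scaler0 addr0.
by rewrite Cc_linE -in_fib_lin /tmul /= (fmul_linl _ xy).
Qed.

Lemma mul_term_linr (c : C) f1 f2 k z p :
  mul_term k (c *: f1 + f2) z p = c *: mul_term k f1 z p + mul_term k f2 z p.
Proof.
rewrite /mul_term; case: ifP => [/andP[/eqP xy _]|_]; last by rewrite scaler0 addr0.
by rewrite Cc_linE -in_fib_lin /tmul /= (fmul_linr _ xy).
Qed.

Lemma mul_term0l f1 f2 z p : Cc_val f1 p.1 = 0 -> mul_term f1 f2 z p = 0.
Proof.
move=> f0; rewrite /mul_term; case: ifP => // /andP[/eqP xy _].
by rewrite /tmul /= f0 fmul0r // in_fib0.
Qed.

Lemma mul_term0r f1 f2 z p : Cc_val f2 p.2 = 0 -> mul_term f1 f2 z p = 0.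
Proof.
move=> f0; rewrite /mul_term; case: ifP => // /andP[/eqP xy _].
by rewrite /tmul /= f0 fmulr0 // in_fib0.
Qed.

Lemma Cc_mulE f1 f2 z (S : set (X * X)) : finite_set S ->
  (forall p, ~ S p -> mul_term f1 f2 z p = 0) ->
  Cc_val (Cc_mul f1 f2) z = \sum_(p <- fset_set S) mul_term f1 f2 z p.
Proof.
move=> fS HS; rewrite -(fsumTE fS HS) /= /mul_sec fsbig_mkcond; apply: eq_fsbigr => p _.
rewrite /patch /mul_term; case: ifPn => [|/negP np].
  by move=> /set_mem[-> ->]; rewrite !eqxx.
by case: ifP => // /andP[/eqP h1 /eqP h2]; case: np; exact: mem_set.
Qed.

Let supp f := [set x | Cc_val f x != 0].

Lemma Cc_mul_linl (c : C) f1 f2 k :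
  Cc_mul (c *: f1 + f2) k = c *: Cc_mul f1 k + Cc_mul f2 k.
Proof.
apply: Cc_eqP => z; rewrite Cc_linE.
pose S := (supp f1 `|` supp f2) `*` supp k.
have fS : finite_set S.
  by apply: finite_setX; rewrite ?finite_setU; repeat split; exact: Cc_finite.
have HS1 p : ~ S p -> mul_term f1 k z p = 0.
  move=> nS; have [h|k0] := eqVneq (Cc_val k p.2) 0; first exact: mul_term0r.
  apply: mul_term0l; apply/eqP; apply: contra_notT nS => f0.
  by split=> //; left.
have HS2 p : ~ S p -> mul_term f2 k z p = 0.
  move=> nS; have [h|k0] := eqVneq (Cc_val k p.2) 0; first exact: mul_term0r.
  apply: mul_term0l; apply/eqP; apply: contra_notT nS => f0.
  by split=> //; right.
rewrite (Cc_mulE fS HS1) (Cc_mulE fS HS2) (@Cc_mulE _ _ _ S) //; last first.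
  by move=> p nS; rewrite mul_term_linl HS1 // HS2 // scaler0 addr0.
rewrite scaler_sumr -big_split; apply: eq_bigr => p _; exact: mul_term_linl.
Qed.

Lemma Cc_mul_linr (c : C) f1 f2 k :
  Cc_mul k (c *: f1 + f2) = c *: Cc_mul k f1 + Cc_mul k f2.
Proof.
apply: Cc_eqP => z; rewrite Cc_linE.
pose S := supp k `*` (supp f1 `|` supp f2).
have fS : finite_set S.
  by apply: finite_setX; rewrite ?finite_setU; repeat split; exact: Cc_finite.
have HS1 p : ~ S p -> mul_term k f1 z p = 0.
  move=> nS; have [h|k0] := eqVneq (Cc_val k p.1) 0; first exact: mul_term0l.
  apply: mul_term0r; apply/eqP; apply: contra_notT nS => f0.
  by split=> //; left.
have HS2 p : ~ S p -> mul_term k f2 z p = 0.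
  move=> nS; have [h|k0] := eqVneq (Cc_val k p.1) 0; first exact: mul_term0l.
  apply: mul_term0r; apply/eqP; apply: contra_notT nS => f0.
  by split=> //; right.
rewrite (Cc_mulE fS HS1) (Cc_mulE fS HS2) (@Cc_mulE _ _ _ S) //; last first.
  by move=> p nS; rewrite mul_term_linr HS1 // HS2 // scaler0 addr0.
rewrite scaler_sumr -big_split; apply: eq_bigr => p _; exact: mul_term_linr.
Qed.

Lemma Cc_mul_delta u v : Cc_mul (Cc_delta u) (Cc_delta v) =
  if src (tag u) == rng (tag v) then Cc_delta (tmul u v) else 0.
Proof.
apply: Cc_eqP => z; rewrite (@Cc_mulE _ _ _ [set (tag u, tag v)]) //; last first.
  move=> [x y] /= np; have [e|xu] := eqVneq (tag u) x; last first.
    by apply: mul_term0l; rewrite Cc_deltaE in_fib_ne.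
  apply: mul_term0r; rewrite Cc_deltaE in_fib_ne //.
  by apply: contra_notN np => /eqP /= <-; rewrite e.
rewrite fset_set1 big_seq_fset1 /mul_term /= /delta_sec !in_fib_tag.
have -> : Tagged fib (tagged u) = u by case: u.
have -> : Tagged fib (tagged v) = v by case: v.
case: ifPn => [/andP[-> _] //|]; case: ifP => //= _ uvz.
by rewrite /delta_sec in_fib_ne.
Qed.

(** ** Involution and action *)

Definition tstar u : total_space A := Tagged fib (fstar (tagged u)).

Lemma Cc_star_lin (c : C) f k :
  Cc_star (c *: f + k) = Num.conj c *: Cc_star f + Cc_star k.
Proof.
apply: Cc_eqP => z; rewrite Cc_linE.
rewrite -[LHS]/(in_fib z (Tagged fib (fstar
  (c *: Cc_val f (gpd_inv z) + Cc_val k (gpd_inv z))))).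
by rewrite fstar_conj in_fib_lin.
Qed.

Lemma Cc_star_delta u : Cc_star (Cc_delta u) = Cc_delta (tstar u).
Proof.
apply: Cc_eqP => z; rewrite /= /star_sec /= /delta_sec.
have [e|ne] := eqVneq (tag u) (gpd_inv z).
  have aux y : tag u = y -> Tagged fib (fstar (in_fib y u)) = tstar u.
    by move=> <-; rewrite in_fib_tag.
  by rewrite aux.
rewrite (in_fib_ne ne) fstar0 in_fib0 in_fib_ne //=.
by apply: contra_neq ne => <-; rewrite gpd_invK.
Qed.

Lemma tstarK : involutive tstar.
Proof. by case=> x a; exact: fstarK. Qed.

Lemma tstar_mul u v : src (tag u) = rng (tag v) ->
  tstar (tmul u v) = tmul (tstar v) (tstar u).
Proof. by case: u => x a; case: v => y b /= xy; exact: fstar_mul. Qed.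

Lemma tmulA u v w : src (tag u) = rng (tag v) -> src (tag v) = rng (tag w) ->
  tmul (tmul u v) w = tmul u (tmul v w).
Proof. by case: u => x a; case: v => y b; case: w => z c /= *; exact: fmulA. Qed.

Lemma Cc_mul0l k : Cc_mul 0 k = 0.
Proof.
by have := Cc_mul_linl (-1) 0 0 k; rewrite scaler0 addr0 scaleN1r addNr.
Qed.

Lemma Cc_mul0r k : Cc_mul k 0 = 0.
Proof.
by have := Cc_mul_linr (-1) 0 0 k; rewrite scaler0 addr0 scaleN1r addNr.
Qed.

Lemma Cc_mulDl f1 f2 k : Cc_mul (f1 + f2) k = Cc_mul f1 k + Cc_mul f2 k.
Proof. by have := Cc_mul_linl 1 f1 f2 k; rewrite !scale1r. Qed.

Lemma Cc_mulDr f1 f2 k : Cc_mul k (f1 + f2) = Cc_mul k f1 + Cc_mul k f2.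
Proof. by have := Cc_mul_linr 1 f1 f2 k; rewrite !scale1r. Qed.

Lemma Cc_starD f k : Cc_star (f + k) = Cc_star f + Cc_star k.
Proof. by have := Cc_star_lin 1 f k; rewrite rmorph1 !scale1r. Qed.

Lemma Cc_star0 : Cc_star (0 : Cc A) = 0.
Proof.
have := Cc_starD 0 0; rewrite addr0 => /eqP.
by rewrite -subr_eq subrr eq_sym => /eqP.
Qed.

Lemma Cc_mulA : associative (@Cc_mul R X A).
Proof.
move=> f1 f2 f3.
elim/Cc_ind: f1 => [|f f' Hf Hf'|u]; first by rewrite !Cc_mul0l.
  by rewrite !Cc_mulDl Hf Hf'.
elim/Cc_ind: f2 => [|f f' Hf Hf'|v]; first by rewrite !(Cc_mul0l, Cc_mul0r).
  by rewrite !(Cc_mulDl, Cc_mulDr) Hf Hf'.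
elim/Cc_ind: f3 => [|f f' Hf Hf'|w]; first by rewrite !Cc_mul0r.
  by rewrite !Cc_mulDr Hf Hf'.
rewrite !Cc_mul_delta; case: ifP => vw; case: ifP => uv.
- rewrite !Cc_mul_delta /= rng_mul ?(eqP vw) // uv src_mul ?(eqP uv) // vw.
  by rewrite tmulA //; exact/eqP.
- by rewrite Cc_mul_delta /= rng_mul ?(eqP vw) // uv Cc_mul0l.
- by rewrite Cc_mul_delta /= src_mul ?(eqP uv) // vw Cc_mul0r.
- by rewrite Cc_mul0l Cc_mul0r.
Qed.

Lemma Cc_starK : involutive (@Cc_star R X A).
Proof.
move=> f; elim/Cc_ind: f => [|f f' Hf Hf'|u]; first by rewrite !Cc_star0.
  by rewrite !Cc_starD Hf Hf'.
by rewrite !Cc_star_delta tstarK.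
Qed.

Lemma Cc_star_mul f k : Cc_star (Cc_mul f k) = Cc_mul (Cc_star k) (Cc_star f).
Proof.
elim/Cc_ind: f => [|f f' Hf Hf'|u].
- by rewrite Cc_mul0l Cc_star0 Cc_mul0r.
- by rewrite Cc_mulDl !Cc_starD Cc_mulDr Hf Hf'.
elim/Cc_ind: k => [|f f' Hf Hf'|v].
- by rewrite Cc_mul0r Cc_star0 Cc_mul0l.
- by rewrite Cc_mulDr !Cc_starD Cc_mulDl Hf Hf'.
rewrite !Cc_star_delta !Cc_mul_delta /= src_inv rng_inv eq_sym.
case: ifP => uv; last by rewrite Cc_star0.
by rewrite Cc_star_delta tstar_mul //; apply/eqP; rewrite eq_sym.
Qed.

(** C_c(A) acts faithfully on itself, as a^* a = 0 only for a = 0. *)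
Lemma Cc_faithful k : (forall f, Cc_mul (Cc_star f) k = 0) -> k = 0.
Proof.
move=> H; apply: Cc_eqP => x; set a := Cc_val k x.
have := H (Cc_delta (Tagged fib a)); rewrite Cc_star_delta => /(congr1 (fun f => Cc_val f (src x))).
rewrite (@Cc_mulE _ _ _ [set (gpd_inv x, x)]) //; last first.
  move=> [y z] np; have [e|ne] := eqVneq (gpd_inv x) y; last first.
    by apply: mul_term0l; rewrite Cc_deltaE in_fib_ne.
  rewrite /mul_term; case: ifP => //= /andP[/eqP yz /eqP yzx].
  case: np; rewrite -e; congr pair => //.
  rewrite -e src_inv in yz; rewrite -e in yzx.
  rewrite -[RHS]gpd_mul_src -yzx -gpd_mulA ?rng_inv ?src_inv //.
  by rewrite gpd_mulV yz gpd_mul_rng.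
rewrite fset_set1 big_seq_fset1 /mul_term /= src_inv gpd_mulVx !eqxx /=.
rewrite /delta_sec in_fibE -/a => H0.
have e0 : fmul (fstar a) a = 0.
  have eq0 z (u : total_space A) : tag u = z -> in_fib z u = 0 -> tagged u = 0.
    by move=> <-; rewrite in_fib_tag.
  exact: (eq0 _ (Tagged fib (fmul (fstar a) a)) (gpd_mulVx x) H0).
have := fcstar a; rewrite e0 normr0 => /esym/eqP; rewrite expf_eq0 /= normr_eq0.
by move/eqP.
Qed.

End FibreAccess.

(** * Multipliers *)

Section Multipliers.
Variables (R : realType) (X : groupoid) (A : Fell_bundle R X).
Local Notation C := R[i].
Local Notation Cc := (Cc A).
Implicit Types (f k : Cc) (S T : Cc -> Cc).

Lemma linear0_fun (V W : lmodType C) (T : V -> W) : linear T -> T 0 = 0.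
Proof. by move=> lT; have := lT (-1) 0 0; rewrite scaler0 addr0 scaleN1r addNr. Qed.

Lemma linearD_fun (V W : lmodType C) (T : V -> W) x y : linear T -> T (x + y) = T x + T y.
Proof. by move=> lT; have := lT 1 x y; rewrite !scale1r. Qed.

Lemma mult_adjoint_sym T S : mult_adjoint T S -> mult_adjoint S T.
Proof.
move=> TS f1 f2; rewrite -[LHS]Cc_starK Cc_star_mul Cc_starK -TS Cc_star_mul.
by rewrite Cc_starK.
Qed.

Lemma mult_adjoint_unique T S S' : mult_adjoint T S -> mult_adjoint T S' -> S = S'.
Proof.
move=> TS TS'; apply/funext => f; apply/eqP; rewrite -subr_eq0; apply/eqP.
apply: Cc_faithful => k; rewrite addrC -scaleN1r Cc_mul_linr -TS -TS'.
by rewrite scaleN1r addNr.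
Qed.

Lemma mult_starP T : multipliers T -> linear (mult_star T) /\ mult_adjoint T (mult_star T).
Proof.
move=> [lT [S [lS TS]]]; rewrite /mult_star; case: xgetP => [S' _ //|/(_ S)].
by case.
Qed.

Lemma mult_star_eq T S : linear S -> mult_adjoint T S -> mult_star T = S.
Proof.
move=> lS TS; rewrite /mult_star; case: xgetP => [S' _ [_ TS']|/(_ S)]; last by case.
exact: mult_adjoint_unique TS' TS.
Qed.

Lemma mult_star_linear T : multipliers T -> linear (mult_star T).
Proof. by case/mult_starP. Qed.

Lemma mult_starE T : multipliers T -> mult_adjoint T (mult_star T).
Proof. by case/mult_starP. Qed.

Lemma mult_linear T : multipliers T -> linear T. Proof. by case. Qed.

Lemma mult_starM T : multipliers T -> multipliers (mult_star T).
Proof.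
move=> mT; split; first exact: mult_star_linear.
exists T; split; first exact: mult_linear.
exact/mult_adjoint_sym/mult_starE.
Qed.

Lemma mult_starK T : multipliers T -> mult_star (mult_star T) = T.
Proof.
move=> mT; apply: mult_star_eq; first exact: mult_linear.
exact/mult_adjoint_sym/mult_starE.
Qed.

Lemma comp_linear S T : linear S -> linear T -> linear (S \o T).
Proof. by move=> lS lT c x y; rewrite /= lT lS. Qed.

Lemma adjoint_comp S S' T T' : mult_adjoint S S' -> mult_adjoint T T' ->
  mult_adjoint (S \o T) (T' \o S').
Proof. by move=> SS TT f1 f2; rewrite /= SS TT. Qed.

Lemma mult_comp S T : multipliers S -> multipliers T -> multipliers (S \o T).
Proof.
move=> mS mT; split; first by apply: comp_linear; exact: mult_linear.
exists (mult_star T \o mult_star S); split.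
  by apply: comp_linear; exact: mult_star_linear.
by apply: adjoint_comp; exact: mult_starE.
Qed.

Lemma mult_star_comp S T : multipliers S -> multipliers T ->
  mult_star (S \o T) = mult_star T \o mult_star S.
Proof.
move=> mS mT; apply: mult_star_eq.
  by apply: comp_linear; exact: mult_star_linear.
by apply: adjoint_comp; exact: mult_starE.
Qed.

Lemma linear_lin (c : C) S T : linear S -> linear T -> linear (c *: S + T).
Proof.
move=> lS lT a x y; rewrite -![(c *: S + T) _]/(c *: S _ + T _) lS lT !scalerDr !scalerA.
by rewrite mulrC addrACA.
Qed.

Lemma adjoint_lin (c : C) S S' T T' : mult_adjoint S S' -> mult_adjoint T T' ->
  mult_adjoint (c *: S + T) (Num.conj c *: S' + T').
Proof.
move=> SS TT f1 f2; rewrite -[(c *: S + T) _]/(c *: S _ + T _).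
rewrite -[(_ *: S' + T') _]/(_ *: S' _ + T' _) Cc_star_lin Cc_mul_linl Cc_mul_linr.
by rewrite SS TT.
Qed.

Lemma mult_lin (c : C) S T : multipliers S -> multipliers T -> multipliers (c *: S + T).
Proof.
move=> mS mT; split; first by apply: linear_lin; exact: mult_linear.
exists (Num.conj c *: mult_star S + mult_star T); split.
  by apply: linear_lin; exact: mult_star_linear.
by apply: adjoint_lin; exact: mult_starE.
Qed.

Lemma mult_star_lin (c : C) S T : multipliers S -> multipliers T ->
  mult_star (c *: S + T) = Num.conj c *: mult_star S + mult_star T.
Proof.
move=> mS mT; apply: mult_star_eq.
  by apply: linear_lin; exact: mult_star_linear.
by apply: adjoint_lin; exact: mult_starE.
Qed.

Lemma mult_id : multipliers (id : Cc -> Cc).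
Proof. by split=> //; exists id. Qed.

Lemma mult_star_id : mult_star (id : Cc -> Cc) = id.
Proof. exact: mult_star_eq. Qed.

Lemma linear_zero : linear (0 : Cc -> Cc).
Proof. by move=> c x y; rewrite -![(0 : Cc -> Cc) _]/(0 : Cc) scaler0 addr0. Qed.

Lemma adjoint_zero : mult_adjoint (0 : Cc -> Cc) 0.
Proof.
by move=> f1 f2; rewrite -![(0 : Cc -> Cc) _]/(0 : Cc) Cc_star0 Cc_mul0l Cc_mul0r.
Qed.

Lemma mult_zero : multipliers (0 : Cc -> Cc).
Proof.
split; first exact: linear_zero.
by exists 0; split; [exact: linear_zero|exact: adjoint_zero].
Qed.

Lemma mult_star0 : mult_star (0 : Cc -> Cc) = 0.
Proof. exact: mult_star_eq linear_zero adjoint_zero. Qed.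

Lemma mult_scale (c : C) T : multipliers T -> multipliers (c *: T).
Proof. by move=> mT; rewrite -[_ *: _]addr0; apply: mult_lin mult_zero. Qed.

Lemma mult_starZ (c : C) T : multipliers T ->
  mult_star (c *: T) = Num.conj c *: mult_star T.
Proof.
by move=> mT; rewrite -[c *: _]addr0 mult_star_lin ?mult_star0 ?addr0 //; exact: mult_zero.
Qed.

Lemma mult_add S T : multipliers S -> multipliers T -> multipliers (S + T).
Proof. by move=> mS mT; rewrite -[S]scale1r; exact: mult_lin. Qed.

Lemma mult_starD S T : multipliers S -> multipliers T ->
  mult_star (S + T) = mult_star S + mult_star T.
Proof. by move=> mS mT; rewrite -[S]scale1r mult_star_lin // rmorph1 !scale1r. Qed.

Lemma mult_sum (I : eqType) (r : seq I) (F : I -> Cc -> Cc) :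
  (forall i, i \in r -> multipliers (F i)) -> multipliers (\sum_(i <- r) F i).
Proof.
move=> H; rewrite big_seq; elim/big_rec: _ => [|i T ir mT]; first exact: mult_zero.
by apply: mult_add => //; exact: H.
Qed.

Lemma mult_star_sum (I : eqType) (r : seq I) (F : I -> Cc -> Cc) :
  (forall i, i \in r -> multipliers (F i)) ->
  mult_star (\sum_(i <- r) F i) = \sum_(i <- r) mult_star (F i).
Proof.
elim: r => [|i r IH] H; first by rewrite !big_nil mult_star0.
rewrite !big_cons mult_starD ?IH //.
- by move=> j jr; apply: H; rewrite inE jr orbT.
- by apply: H; rewrite mem_head.
- by apply: mult_sum => j jr; apply: H; rewrite inE jr orbT.
Qed.

Lemma star_subalgebra_multipliers : star_subalgebra (@multipliers R X A).
Proof.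
split=> //; [exact: mult_zero|exact: mult_lin|exact: mult_comp|exact: mult_starM].
Qed.

End Multipliers.

Section ActionOnMultipliers.
Variables (R : realType) (G : groupType) (X : groupoid) (A : Fell_bundle R X).
Variable alpha : Fell_action G A.
Local Notation C := R[i].
Local Notation fib := (fib A).
Local Notation Cc := (Cc A).
Local Notation gact := (gact alpha).
Local Notation tact := (tact alpha).
Local Notation Cc_act := (Cc_act alpha).
Local Notation mult_act := (mult_act alpha).
Implicit Types (u v : total_space A) (f k : Cc) (S T : Cc -> Cc) (g h : G).

Lemma Cc_act_lin g (c : C) f k : Cc_act g (c *: f + k) = c *: Cc_act g f + Cc_act g k.
Proof.
apply: Cc_eqP => z; rewrite Cc_linE.
rewrite -[LHS]/(in_fib z (Tagged fib (bact alpha g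
  (c *: Cc_val f (gact z g) + Cc_val k (gact z g))))).
by rewrite bact_linear in_fib_lin.
Qed.

Lemma Cc_act_delta g u : Cc_act g (Cc_delta u) = Cc_delta (tact g u).
Proof.
apply: Cc_eqP => z; rewrite /= /act_sec /= /delta_sec.
have [e|ne] := eqVneq (tag u) (gact z g).
  have aux y : tag u = y -> Tagged fib (bact alpha g (in_fib y u)) = tact g u.
    by move=> <-; rewrite in_fib_tag.
  by rewrite aux.
rewrite (in_fib_ne ne) bact0 in_fib0 in_fib_ne //=.
by apply: contra_neq ne => <-; rewrite -gactM mulVg gact1.
Qed.

Lemma Cc_act0 g : Cc_act g 0 = 0.
Proof. by have := Cc_act_lin g (-1) 0 0; rewrite scaler0 addr0 scaleN1r addNr. Qed.

Lemma Cc_actD g f k : Cc_act g (f + k) = Cc_act g f + Cc_act g k.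
Proof. by have := Cc_act_lin g 1 f k; rewrite !scale1r. Qed.

Lemma Cc_actM g h f : Cc_act (g * h)%g f = Cc_act g (Cc_act h f).
Proof.
elim/Cc_ind: f => [|f f' Hf Hf'|u]; first by rewrite !Cc_act0.
  by rewrite !Cc_actD Hf Hf'.
by rewrite !Cc_act_delta tactM.
Qed.

Lemma Cc_act1 f : Cc_act 1%g f = f.
Proof.
elim/Cc_ind: f => [|f f' Hf Hf'|u]; first by rewrite !Cc_act0.
  by rewrite !Cc_actD Hf Hf'.
by rewrite !Cc_act_delta tact1.
Qed.

Lemma Cc_actK g : cancel (Cc_act g) (Cc_act g^-1%g).
Proof. by move=> f; rewrite -Cc_actM mulVg Cc_act1. Qed.

Lemma Cc_actVK g : cancel (Cc_act g^-1%g) (Cc_act g).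
Proof. by move=> f; rewrite -Cc_actM mulgV Cc_act1. Qed.

Lemma tact_mul g u v : src (tag u) = rng (tag v) ->
  tact g (tmul u v) = tmul (tact g u) (tact g v).
Proof. by case: u => x a; case: v => y b /= xy; exact: bact_mul. Qed.

Lemma gact_inj g : injective (gact ^~ g).
Proof.
by move=> x y /(congr1 (gact ^~ g^-1%g)); rewrite -!gactM mulgV !gact1.
Qed.

Lemma Cc_act_mul g f k : Cc_act g (Cc_mul f k) = Cc_mul (Cc_act g f) (Cc_act g k).
Proof.
elim/Cc_ind: f => [|f f' Hf Hf'|u]; first by rewrite Cc_mul0l !Cc_act0 Cc_mul0l.
  by rewrite Cc_mulDl !Cc_actD Cc_mulDl Hf Hf'.
elim/Cc_ind: k => [|f f' Hf Hf'|v]; first by rewrite Cc_mul0r !Cc_act0 Cc_mul0r.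
  by rewrite Cc_mulDr !Cc_actD Cc_mulDr Hf Hf'.
rewrite !Cc_act_delta !Cc_mul_delta /= gact_src gact_rng (inj_eq (@gact_inj _)).
case: ifP => uv; last by rewrite Cc_act0.
by rewrite Cc_act_delta tact_mul //; exact/eqP.
Qed.

Lemma tact_star g u : tact g (tstar u) = tstar (tact g u).
Proof. by case: u => x a; exact: bact_star. Qed.

Lemma Cc_act_star g f : Cc_act g (Cc_star f) = Cc_star (Cc_act g f).
Proof.
elim/Cc_ind: f => [|f f' Hf Hf'|u]; first by rewrite Cc_star0 !Cc_act0 Cc_star0.
  by rewrite Cc_starD !Cc_actD Cc_starD Hf Hf'.
by rewrite Cc_star_delta !Cc_act_delta Cc_star_delta tact_star.
Qed.

Lemma mult_act_linear g T : linear T -> linear (mult_act g T).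
Proof. by move=> lT c f k; rewrite /Defs.mult_act Cc_act_lin lT Cc_act_lin. Qed.

Lemma mult_act_adjoint g T S : mult_adjoint T S ->
  mult_adjoint (mult_act g T) (mult_act g S).
Proof.
move=> TS f1 f2; rewrite /Defs.mult_act -Cc_act_star.
rewrite -[in LHS](Cc_actVK g f2) -Cc_act_mul TS Cc_act_mul Cc_act_star.
by rewrite Cc_actVK.
Qed.

Lemma mult_actP g T : multipliers T -> multipliers (mult_act g T).
Proof.
move=> mT; split; first exact/mult_act_linear/mult_linear.
exists (mult_act g (mult_star T)); split.
  exact/mult_act_linear/mult_star_linear.
exact/mult_act_adjoint/mult_starE.
Qed.

Lemma mult_star_act g T : multipliers T ->
  mult_star (mult_act g T) = mult_act g (mult_star T).
Proof.
move=> mT; apply: mult_star_eq; first exact/mult_act_linear/mult_star_linear.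
exact/mult_act_adjoint/mult_starE.
Qed.

Lemma mult_actM g h T : mult_act (g * h)%g T = mult_act g (mult_act h T).
Proof. by apply/funext => f; rewrite /Defs.mult_act invgM !Cc_actM. Qed.

Lemma mult_act1 T : mult_act 1%g T = T.
Proof. by apply/funext => f; rewrite /Defs.mult_act invg1 !Cc_act1. Qed.

Lemma mult_act_comp g S T : mult_act g (S \o T) = mult_act g S \o mult_act g T.
Proof. by apply/funext => f; rewrite /Defs.mult_act /= Cc_actK. Qed.

Lemma mult_act_lin g (c : C) S T :
  mult_act g (c *: S + T) = c *: mult_act g S + mult_act g T.
Proof. by apply/funext => f; rewrite /Defs.mult_act Cc_act_lin. Qed.

Lemma mult_act0 g : mult_act g 0 = 0.
Proof. by apply/funext => f; exact: Cc_act0. Qed.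

Lemma mult_actD g S T : mult_act g (S + T) = mult_act g S + mult_act g T.
Proof. by apply/funext => f; exact: Cc_actD. Qed.

Lemma mult_actZ g (c : C) T : mult_act g (c *: T) = c *: mult_act g T.
Proof. by rewrite -[c *: T]addr0 mult_act_lin mult_act0 addr0. Qed.

Lemma mult_act_sum g (I : Type) (r : seq I) (F : I -> Cc -> Cc) :
  mult_act g (\sum_(i <- r) F i) = \sum_(i <- r) mult_act g (F i).
Proof.
elim: r => [|i r IH]; first by rewrite !big_nil mult_act0.
by rewrite !big_cons mult_actD IH.
Qed.

Lemma mult_act_id g : mult_act g id = id.
Proof. by apply/funext => f; exact: Cc_actVK. Qed.

End ActionOnMultipliers.

(** * The modular function of a Hecke pair *)

Section OrbitCounting.
Variables (G : groupType) (S : choiceType) (act : G -> S -> S).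
Hypotheses (act1 : forall s, act 1%g s = s)
  (actM : forall g h s, act (g * h)%g s = act g (act h s)).

Definition stab_orbit (s t : S) : set S := [set act x t | x in [set x | act x s = s]].
Definition stab2_orbit (s t u : S) : set S :=
  [set act x u | x in [set x | act x s = s /\ act x t = t]].
Definition stab_orbit2 (s t u : S) : set (S * S) :=
  [set (act x t, act x u) | x in [set x | act x s = s]].
Definition orbit_size (s t : S) : nat := #|` fset_set (stab_orbit s t)|.

Hypothesis fin : forall s t, finite_set (stab_orbit s t).

Lemma card_fset_set_seq (T : choiceType) (P : set T) (r : seq T) :
  uniq r -> (forall x, P x <-> x \in r) -> #|` fset_set P| = size r.
Proof.
move=> ur Pr; have -> : P = [set` r] by apply/seteqP; split=> x /Pr.
have -> : size r = #|` [fset x in r]%fset| by rewrite card_fseq undup_id.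
congr #|` _|; apply/fsetP => x; rewrite !inE in_fset_set //.
by rewrite mem_setE.
Qed.

Lemma actK x s : act x^-1%g (act x s) = s.
Proof. by rewrite -actM mulVg act1. Qed.

Lemma actVK x s : act x (act x^-1%g s) = s.
Proof. by rewrite -actM mulgV act1. Qed.

Lemma stab2_finite s t u : finite_set (stab2_orbit s t u).
Proof.
apply: sub_finite_set (fin s u) => _ [x [xs _] <-]; by exists x.
Qed.

(** Orbit-stabilizer counting for pairs: the orbit of (t, u) under the stabilizer
    of s fibres over the orbit of t. *)
Lemma card_stab_orbit2 s t u : #|` fset_set (stab_orbit2 s t u)| =
  (orbit_size s t * #|` fset_set (stab2_orbit s t u)|)%N.
Proof.
have ch y : exists x, stab_orbit s t y -> act x s = s /\ act x t = y.
  have [[x xs <-]|n] := pselect (stab_orbit s t y); first by exists x.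
  by exists 1%g.
have [x0 Hx0] := choice ch.
pose O := fset_set (stab_orbit s t); pose N := fset_set (stab2_orbit s t u).
pose r := [seq (y, act (x0 y) v) | y <- O, v <- N].
rewrite (@card_fset_set_seq _ _ r) ?size_allpairs //.
  apply: allpairs_uniq; rewrite ?fset_uniq // => -[y v] [y' v'] _ _ /= [<- e].
  by congr pair; rewrite -(actK (x0 y) v) e actK.
move=> [y w]; split.
  move=> [x xs [ey ew]]; have Oy : stab_orbit s t y by exists x.
  have [x0s x0t] := Hx0 y Oy.
  apply/allpairsP; exists (y, act (x0 y)^-1%g w); split => /=.
  - by rewrite in_fset_set //; exact: mem_set.
  - rewrite in_fset_set; last exact: stab2_finite.
    apply: mem_set; exists ((x0 y)^-1 * x)%g; last by rewrite actM ew.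
    by rewrite /= !actM xs ey -{1}x0s actK -{2}x0t actK.
  - by rewrite actVK.
move=> /allpairsP[[y' v] /= [+ + [-> ->]]].
rewrite !in_fset_set //; last exact: stab2_finite.
move=> /set_mem Oy /set_mem[x [xs xt] <-].
have [x0s x0t] := Hx0 y' Oy.
exists (x0 y' * x)%g; first by rewrite /= actM xs.
by rewrite !actM xt x0t.
Qed.

Lemma stab_orbit2_swap s t u :
  #|` fset_set (stab_orbit2 s t u)| = #|` fset_set (stab_orbit2 s u t)|.
Proof.
have finO a b : finite_set (stab_orbit2 s a b).
  apply: sub_finite_set (finite_setX (fin s a) (fin s b)) => _ [x xs <-].
  by split; exists x.
have -> : stab_orbit2 s u t = (fun p => (p.2, p.1)) @` stab_orbit2 s t u.
  apply/seteqP; split=> [_ [x xs <-]|_ [_ [x xs <-] <-]]; last by exists x.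
  by exists (act x t, act x u) => //; exists x.
by rewrite [in RHS](fset_set_image _ (finO t u)) card_imfset // => -[a b] [c d] /= [-> ->].
Qed.

Lemma stab2_swap s t u : stab2_orbit s t u = stab2_orbit t s u.
Proof. by apply/seteqP; split=> _ [x [h1 h2] <-]; exists x. Qed.

Lemma orbit_size_gt0 s t : (0 < orbit_size s t)%N.
Proof.
rewrite cardfs_gt0; apply/fset0Pn; exists t; rewrite in_fset_set //.
by apply: mem_set; exists 1%g => /=; rewrite act1.
Qed.

Lemma stab2_gt0 s t u : (0 < #|` fset_set (stab2_orbit s t u)|)%N.
Proof.
rewrite cardfs_gt0; apply/fset0Pn; exists u; rewrite in_fset_set; last exact: stab2_finite.
by apply: mem_set; exists 1%g => /=; rewrite ?act1.
Qed.

(** Counting the orbits of pairs in two ways for each of s, t and u. For cosets this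
    says that Delta is multiplicative. *)
Lemma orbit_size_cocycle s t u :
  (orbit_size s u * orbit_size u t * orbit_size t s =
   orbit_size u s * orbit_size t u * orbit_size s t)%N.
Proof.
have e1 : (orbit_size s t * #|` fset_set (stab2_orbit s t u)| =
    orbit_size s u * #|` fset_set (stab2_orbit s u t)|)%N.
  by rewrite -!card_stab_orbit2 stab_orbit2_swap.
have e2 : (orbit_size t s * #|` fset_set (stab2_orbit s t u)| =
    orbit_size t u * #|` fset_set (stab2_orbit t u s)|)%N.
  by rewrite stab2_swap -!card_stab_orbit2 stab_orbit2_swap.
have e3 : (orbit_size u s * #|` fset_set (stab2_orbit s u t)| =
    orbit_size u t * #|` fset_set (stab2_orbit t u s)|)%N.
  by rewrite (stab2_swap s) (stab2_swap t) -!card_stab_orbit2 stab_orbit2_swap.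
have := stab2_gt0 s t u; have := stab2_gt0 s u t; have := stab2_gt0 t u s.
move: #|` _| #|` _| #|` _| e1 e2 e3 => m3 m2 m1 e1 e2 e3 h3 h2 h1.
apply/eqP; rewrite -(@eqn_pmul2r (m1 * m2 * m3)) ?muln_gt0 ?h1 ?h2 //.
apply/eqP; transitivity ((orbit_size s u * m2) * (orbit_size u t * m3) *
  (orbit_size t s * m1))%N; first by ring.
by rewrite -e1 -e3 e2; ring.
Qed.

Lemma orbit_size_act x s t : orbit_size (act x s) (act x t) = orbit_size s t.
Proof.
rewrite /orbit_size; have -> : stab_orbit (act x s) (act x t) = act x @` stab_orbit s t.
  apply/seteqP; split=> [_ [y ys <-]|_ [_ [y ys <-] <-]].
    exists (act (x^-1 * y * x)%g t); last by rewrite -!actM !mulgA mulgV mul1g.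
    by exists (x^-1 * y * x)%g => //=; rewrite !actM ys actK.
  exists (x * y * x^-1)%g; last by rewrite -!actM mulgVK.
  by rewrite /= -actM mulgVK actM ys.
rewrite [in LHS](fset_set_image _ (fin s t)) card_imfset // => a b e.
by rewrite -(actK x a) e actK.
Qed.

End OrbitCounting.

Section HeckeModular.
Variables (G : groupType) (Gam : subgroup G).
Local Notation cos := (lcoset_of Gam).
Implicit Types (g h : G) (c : lcosets Gam).

Lemma lcoset_eqP g h : cos g = cos h <-> sg_set Gam (g^-1 * h)%g.
Proof.
split=> [/eqP|H]; first by rewrite eqmodE => /asboolP.
by apply/eqP; rewrite eqmodE; apply/asboolP.
Qed.

Lemma lcoset_repr c : cos (repr c) = c.
Proof. exact: reprK. Qed.

Lemma repr_lcoset g : sg_set Gam (g^-1 * repr (cos g))%g.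
Proof. by apply/lcoset_eqP; rewrite lcoset_repr. Qed.

Lemma lcosetMr g k : sg_set Gam k -> cos (g * k)%g = cos g.
Proof.
move=> Hk; apply/lcoset_eqP; rewrite invgM -mulgA mulVg mulg1.
exact: sg_inv.
Qed.

Definition lact g c := cos (g * repr c)%g.

Lemma lact_of g h : lact g (cos h) = cos (g * h)%g.
Proof.
apply/lcoset_eqP; rewrite invgM -mulgA mulKg.
by apply/lcoset_eqP; rewrite lcoset_repr.
Qed.

Lemma lact1 c : lact 1%g c = c.
Proof. by rewrite -(lcoset_repr c) lact_of mul1g. Qed.

Lemma lactM g h c : lact (g * h)%g c = lact g (lact h c).
Proof. by rewrite -(lcoset_repr c) !lact_of mulgA. Qed.

Lemma lactK g : cancel (lact g) (lact g^-1%g).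
Proof. by move=> c; rewrite -lactM mulVg lact1. Qed.

Lemma lactVK g : cancel (lact g^-1%g) (lact g).
Proof. by move=> c; rewrite -lactM mulgV lact1. Qed.

Lemma lact_bij g : bijective (lact g).
Proof. by exists (lact g^-1%g); [exact: lactK|exact: lactVK]. Qed.

Lemma stab_base x : lact x (cos 1%g) = cos 1%g <-> sg_set Gam x.
Proof.
rewrite lact_of mulg1; split=> [/esym/lcoset_eqP|H]; first by rewrite invg1 mul1g.
by apply/esym/lcoset_eqP; rewrite invg1 mul1g.
Qed.

Lemma stab_orbit_base g : stab_orbit lact (cos 1%g) (cos g) = cos @` dcoset_set Gam g.
Proof.
apply/seteqP; split=> [_ [x /stab_base Gx <-]|_ [_ [a [b [Ga Gb ->]]] <-]].
  rewrite lact_of; exists (x * g)%g => //; exists x, 1%g.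
  by split; rewrite ?mulg1 //; exact: sg_one.
rewrite lcosetMr //; exists a; last by rewrite lact_of.
exact/stab_base.
Qed.

Hypothesis HP : Hecke_pair Gam.

Lemma stab_orbit_finite s t : finite_set (stab_orbit lact s t).
Proof.
have es : lact (repr s)^-1%g s = cos 1%g.
  by rewrite -{2}(lcoset_repr s) lact_of mulVg.
have es' : lact (repr s) (cos 1%g) = s by rewrite lact_of mulg1 lcoset_repr.
have -> : stab_orbit lact s t =
    lact (repr s) @` stab_orbit lact (cos 1%g) (cos ((repr s)^-1 * repr t)%g).
  apply/seteqP; split=> [_ [x xs <-]|_ [_ [x xs <-] <-]].
    exists (lact ((repr s)^-1 * x * repr s)%g (cos ((repr s)^-1 * repr t)%g)).
      exists ((repr s)^-1 * x * repr s)%g => //=.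
      by rewrite !lactM es' xs es.
    rewrite !lact_of !mulgA mulgV mul1g mulgK.
    by rewrite -lact_of lcoset_repr.
  exists (repr s * x * (repr s)^-1)%g => /=.
    by rewrite !lactM es xs es'.
  by rewrite -{1}(lcoset_repr t) !lact_of !mulgA.
by apply: finite_image; rewrite stab_orbit_base; have [] := HP ((repr s)^-1 * repr t)%g.
Qed.

Lemma Hecke_LE g : Hecke_L Gam g = orbit_size lact (cos 1%g) (cos g).
Proof. by rewrite /Hecke_L /orbit_size stab_orbit_base. Qed.

Lemma rcoset_eqP g h : rcoset_of Gam g = rcoset_of Gam h <-> sg_set Gam (h * g^-1)%g.
Proof.
split=> [/eqP|H]; first by rewrite eqmodE => /asboolP.
by apply/eqP; rewrite eqmodE; apply/asboolP.
Qed.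

(** Inversion turns the right cosets in the double coset of g into the left cosets
    in that of g^-1. *)
Lemma Hecke_RE g : Hecke_R Gam g = orbit_size lact (cos g) (cos 1%g).
Proof.
have -> : orbit_size lact (cos g) (cos 1%g) = orbit_size lact (cos 1%g) (cos g^-1%g).
  rewrite -(orbit_size_act lact1 lactM stab_orbit_finite g^-1%g) !lact_of mulVg.
  by rewrite mulg1.
rewrite -Hecke_LE /Hecke_L /Hecke_R.
pose phi (c : rcosets Gam) := cos (repr c)^-1%g.
have phiE k : phi (rcoset_of Gam k) = cos k^-1%g.
  apply/lcoset_eqP; rewrite invgK.
  have : sg_set Gam (k * (repr (rcoset_of Gam k))^-1)%g.
    by apply/rcoset_eqP; exact: reprK.
  by move/sg_inv; rewrite invgM invgK.
have phi_inj : injective phi.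
  move=> c d; rewrite -[c]reprK -[d]reprK => e; apply/rcoset_eqP.
  have : phi (rcoset_of Gam (repr c)) = phi (rcoset_of Gam (repr d)) by [].
  by rewrite !phiE => /esym/lcoset_eqP; rewrite invgK.
have -> : cos @` dcoset_set Gam g^-1%g = phi @` (rcoset_of Gam @` dcoset_set Gam g).
  apply/seteqP; split=> [_ [_ [a [b [Ga Gb ->]]] <-]|_ [_ [_ [a [b [Ga Gb ->]]] <-] <-]].
    exists (rcoset_of Gam (b^-1 * g * a^-1)%g).
      exists (b^-1 * g * a^-1)%g => //; exists b^-1%g, a^-1%g.
      by split=> //; exact: sg_inv.
    by rewrite phiE !invgM !invgK mulgA.
  exists (b^-1 * g^-1 * a^-1)%g.
    by exists b^-1%g, a^-1%g; split=> //; exact: sg_inv.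
  by rewrite phiE !invgM mulgA.
by rewrite [in RHS](fset_set_image _ (HP g).2) card_imfset.
Qed.

Variable K : numFieldType.
Local Notation delta := (Hecke_Delta Gam K).

Let size_neq0 s t : (orbit_size lact s t)%:R != 0 :> K.
Proof.
rewrite pnatr_eq0 -lt0n; exact: (orbit_size_gt0 lact1 stab_orbit_finite).
Qed.

Lemma DeltaE g : delta g =
  (orbit_size lact (cos 1%g) (cos g))%:R / (orbit_size lact (cos g) (cos 1%g))%:R.
Proof. by rewrite /Hecke_Delta Hecke_LE Hecke_RE. Qed.

Lemma Delta_gt0 g : 0 < delta g.
Proof. by rewrite DeltaE divr_gt0 // ltr0n; exact: (orbit_size_gt0 lact1 stab_orbit_finite). Qed.

Lemma DeltaM g h : delta (g * h)%g = delta g * delta h.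
Proof.
have shift a b d : orbit_size lact (cos (a * b)%g) (cos (a * d)%g) =
    orbit_size lact (cos b) (cos d).
  by rewrite -!lact_of; exact: (orbit_size_act lact1 lactM stab_orbit_finite).
rewrite !DeltaE -(shift g 1%g h) -(shift g h 1%g) !mulg1.
have := orbit_size_cocycle lact1 lactM stab_orbit_finite (cos 1%g) (cos g) (cos (g * h)%g).
move/(congr1 (fun n => n%:R : K)); rewrite !natrM => E.
rewrite mulf_div; apply/eqP; rewrite eqr_div ?mulf_neq0 //; apply/eqP.
rewrite [X in _ * X]mulrC mulrA E; ring.
Qed.

Lemma Delta1 : delta 1%g = 1.
Proof. by rewrite DeltaE divff. Qed.

Lemma DeltaVr g : delta g * delta g^-1%g = 1.
Proof. by rewrite -DeltaM mulgV Delta1. Qed.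

Lemma Delta_base k : sg_set Gam k -> delta k = 1.
Proof.
move=> Gk; by rewrite DeltaE -[k]mul1g lcosetMr // divff.
Qed.

Lemma DeltaMr g k : sg_set Gam k -> delta (g * k)%g = delta g.
Proof. by move=> Gk; rewrite DeltaM (Delta_base Gk) mulr1. Qed.

Lemma DeltaMl g k : sg_set Gam k -> delta (k * g)%g = delta g.
Proof. by move=> Gk; rewrite DeltaM (Delta_base Gk) mul1r. Qed.

End HeckeModular.

(** * Equivariant multiplier-valued functions on G/Gam *)

Section EquivariantAlgebra.
Variables (R : realType) (G : groupType) (X : groupoid) (A : Fell_bundle R X).
Variables (alpha : Fell_action G A) (Gam : subgroup G).
Hypothesis HP : Hecke_pair Gam.
Local Notation C := R[i].
Local Notation Cc := (Cc A).
Local Notation cos := (lcoset_of Gam).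
Local Notation L := (lcosets Gam).
Local Notation mact := (mult_act alpha).
Local Notation delta := (Hecke_Delta Gam C).
Local Notation "f1 ** f2" := (cp_mul alpha f1 f2) (at level 40, left associativity).
Local Notation stf := (cp_star alpha).
Implicit Types (f k : L -> Cc -> Cc) (S T : Cc -> Cc) (g h : G) (c d : L).

Definition equivariant f := forall gam g, sg_set Gam gam ->
  f (cos (gam * g)%g) = mact gam (f (cos g)).

(** The action of G on functions for which equivariance is invariance under Gam; it
    makes formulas independent of coset representatives. *)
Definition translate g f c := mact g (f (lact g^-1%g c)).

(** A larger algebra than the crossed product, which also contains the Hecke algebra
    and the restrictions to Gam-invariant sets of units. *)
Definition emem f := [/\ finite_set [set c | f c != 0], equivariant f &
  forall c, multipliers (f c)].

Lemma translate_base f gam : equivariant f -> sg_set Gam gam -> translate gam f = f.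
Proof.
move=> ef Gg; apply/funext => c; rewrite /translate -(lcoset_repr c) lact_of.
by rewrite -ef // mulgA mulgV mul1g.
Qed.

Lemma translateM g h f : translate (g * h)%g f = translate g (translate h f).
Proof. by apply/funext => c; rewrite /translate mult_actM invgM lactM. Qed.

Lemma translate1 f : translate 1%g f = f.
Proof. by apply/funext => c; rewrite /translate mult_act1 invg1 lact1. Qed.

Lemma translate_coset f g h : equivariant f -> cos g = cos h ->
  translate g f = translate h f.
Proof.
move=> ef /lcoset_eqP gh; have -> : h = (g * (g^-1 * h))%g by rewrite mulgA mulgV mul1g.
by rewrite translateM (translate_base ef gh).
Qed.

Lemma translate_pt f g h c : equivariant f -> cos g = cos h ->
  translate g f c = translate h f c.
Proof. by move=> ef gh; rewrite (translate_coset ef gh). Qed.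

Lemma translate_repr f g : equivariant f -> translate (repr (cos g)) f = translate g f.
Proof. by move=> ef; apply: translate_coset => //; exact: lcoset_repr. Qed.

Lemma translate_mult g f c : (forall c, multipliers (f c)) -> multipliers (translate g f c).
Proof. by move=> mf; apply: mult_actP. Qed.

Lemma emem_fin f : emem f -> finite_set [set c | f c != 0]. Proof. by case. Qed.
Lemma emem_eqv f : emem f -> equivariant f. Proof. by case. Qed.
Lemma compf0 T : linear T -> T \o (0 : Cc -> Cc) = 0.
Proof. by move=> lT; apply/funext => x; exact: linear0_fun. Qed.

Lemma comp_suml (I : Type) (r : seq I) (F : I -> Cc -> Cc) T :
  (\sum_(i <- r) F i) \o T = \sum_(i <- r) (F i \o T).
Proof. by elim: r => [|i r IH]; rewrite ?big_nil // !big_cons -IH. Qed.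

Lemma comp_sumr (I : Type) (r : seq I) (F : I -> Cc -> Cc) T : linear T ->
  T \o (\sum_(i <- r) F i) = \sum_(i <- r) (T \o F i).
Proof.
move=> lT; elim: r => [|i r IH]; first by rewrite !big_nil compf0.
by rewrite !big_cons -IH; apply/funext => x; exact: linearD_fun.
Qed.

Let supp f := [set c | f c != 0].
Let notsupp f c : ~ supp f c -> f c = 0.
Proof. by move=> /negP; rewrite negbK => /eqP. Qed.

Lemma cp_mul_sum f1 f2 c (D : set L) : finite_set D ->
  (forall d, ~ D d -> f1 d = 0) ->
  (f1 ** f2) c = \sum_(d <- fset_set D) (f1 d \o translate (repr d) f2 c).
Proof.
move=> fD HD; rewrite -(fsumTE (S := D)) // => d nD.
by rewrite HD.
Qed.

Let mul_supp f1 f2 : set L :=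
  \bigcup_(d in supp f1) [set lact (repr d) e | e in supp f2].

Let mul_supp_fin f1 f2 : emem f1 -> emem f2 -> finite_set (mul_supp f1 f2).
Proof.
move=> [fin1 _ _] [fin2 _ _]; apply: bigcup_finite => // d _.
exact: finite_image.
Qed.

Let mul_supp0 f1 f2 d e : ~ mul_supp f1 f2 e -> supp f1 d -> translate (repr d) f2 e = 0.
Proof.
move=> ne Hd; rewrite /translate notsupp ?mult_act0 // => He; apply: ne.
by exists d => //; exists (lact (repr d)^-1%g e) => //; exact: lactVK.
Qed.

Lemma translate_cp_mul g f1 f2 c : emem f1 -> emem f2 ->
  translate g (f1 ** f2) c =
  \sum_(d <- fset_set (supp f1)) (mact g (f1 d) \o translate (g * repr d)%g f2 c).
Proof.
move=> E1 E2; rewrite {1}/translate (cp_mul_sum _ _ (emem_fin E1) (@notsupp f1)).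
rewrite mult_act_sum; apply: eq_bigr => d _; rewrite mult_act_comp translateM.
by [].
Qed.

Lemma emem_mul f1 f2 : emem f1 -> emem f2 -> emem (f1 ** f2).
Proof.
move=> E1 E2; have [F1 Q1 M1] := E1; have [F2 Q2 M2] := E2.
have mulE c := cp_mul_sum f2 c F1 (@notsupp f1).
split.
- apply: sub_finite_set (mul_supp_fin E1 E2) => c /=; apply: contra_neqP => nc.
  rewrite mulE big_seq big1 // => d; rewrite in_fset_set // => /set_mem Hd.
  by rewrite (mul_supp0 nc Hd) compf0 //; exact/mult_linear.
- move=> gam g Gg; have -> : cos (gam * g)%g = lact gam (cos g) by rewrite lact_of.
  have -> : mact gam ((f1 ** f2) (cos g)) = translate gam (f1 ** f2) (lact gam (cos g)).
    by rewrite /translate lactK.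
  rewrite translate_cp_mul //; set c := lact gam _.
  rewrite -(fsumTE (S := supp f1)) //; last first.
    by move=> d nd; rewrite notsupp // mult_act0.
  have bj : bijective (lact (Gam := Gam) gam^-1%g) by exact: lact_bij.
  rewrite [RHS](reindex_fsbigT (lact gam^-1%g) _ bj); apply: eq_fsbigr => d _.
  have -> : mact gam (f1 (lact gam^-1%g d)) = f1 d.
    by rewrite -{2}(translate_base Q1 Gg).
  congr (_ \o _); rewrite -[LHS]/(translate (repr d) f2 _); apply: translate_pt => //.
  by rewrite lcoset_repr -lact_of lcoset_repr lactVK.
- move=> c; rewrite mulE; apply: mult_sum => d _; apply: mult_comp => //.
  exact: translate_mult.
Qed.

Lemma cp_mulA f1 f2 f3 : emem f1 -> emem f2 -> emem f3 ->
  f1 ** (f2 ** f3) = (f1 ** f2) ** f3.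
Proof.
move=> E1 E2 E3; have [F1 Q1 M1] := E1; have [F2 Q2 M2] := E2; have [F3 Q3 M3] := E3.
apply/funext => c; set D := mul_supp f1 f2.
have FD : finite_set D by exact: mul_supp_fin.
have mul0 e : ~ D e -> (f1 ** f2) e = 0.
  move=> ne; rewrite (cp_mul_sum f2 e F1 (@notsupp f1)) big_seq big1 // => d.
  rewrite in_fset_set // => /set_mem Hd.
  by rewrite (mul_supp0 ne Hd) compf0 //; exact/mult_linear.
rewrite (cp_mul_sum (f2 ** f3) c F1 (@notsupp f1)).
rewrite (cp_mul_sum f3 c FD mul0).
transitivity (\sum_(d <- fset_set (supp f1)) \sum_(e <- fset_set D)
   (f1 d \o translate (repr d) f2 e \o translate (repr e) f3 c)); last first.
  rewrite exchange_big /=; apply: eq_bigr => e _.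
  by rewrite (cp_mul_sum f2 e F1 (@notsupp f1)) comp_suml.
rewrite big_seq [RHS]big_seq; apply: eq_bigr => d.
rewrite in_fset_set // => /set_mem Hd.
transitivity (f1 d \o \sum_(e <- fset_set D)
    (translate (repr d) f2 e \o translate (repr e) f3 c)); last first.
  by rewrite comp_sumr //; exact/mult_linear.
congr (_ \o _); rewrite translate_cp_mul //.
rewrite -(fsumTE (S := supp f2)) //; last first.
  by move=> e ne; rewrite notsupp // mult_act0.
rewrite -(fsumTE (S := D)) //; last first.
  by move=> e ne; rewrite (mul_supp0 ne Hd).
have bj : bijective (lact (Gam := Gam) (repr d)^-1%g) by exact: lact_bij.
rewrite (reindex_fsbigT (lact (repr d)^-1%g) _ bj); apply: eq_fsbigr => e _.
congr (_ \o _); apply: translate_pt => //.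
by rewrite lcoset_repr -lact_of lcoset_repr lactVK.
Qed.

Lemma emem_lin (a : C) f1 f2 : emem f1 -> emem f2 -> emem (a *: f1 + f2).
Proof.
move=> [F1 Q1 M1] [F2 Q2 M2]; split.
- have : finite_set (supp f1 `|` supp f2) by rewrite finite_setU.
  apply: sub_finite_set => c /= H; have [e|] := eqVneq (f1 c) 0; last by left.
  right; apply: contra_neq H => e2.
  by rewrite -[LHS]/(a *: f1 c + f2 c) e e2 scaler0 addr0.
- move=> gam g Gg; rewrite -[LHS]/(a *: f1 _ + f2 _) Q1 // Q2 // -mult_act_lin.
  by [].
- by move=> c; apply: mult_lin.
Qed.

Lemma cp_mul_linl (a : C) f1 f2 k : emem f1 -> emem f2 ->
  (a *: f1 + f2) ** k = a *: (f1 ** k) + f2 ** k.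
Proof.
move=> [F1 Q1 M1] [F2 Q2 M2]; apply/funext => c.
have FD : finite_set (supp f1 `|` supp f2) by rewrite finite_setU.
have H1 d : ~ (supp f1 `|` supp f2) d -> f1 d = 0.
  by move=> nd; apply: notsupp => h; apply: nd; left.
have H2 d : ~ (supp f1 `|` supp f2) d -> f2 d = 0.
  by move=> nd; apply: notsupp => h; apply: nd; right.
have H3 d : ~ (supp f1 `|` supp f2) d -> (a *: f1 + f2) d = 0.
  by move=> nd; rewrite -[LHS]/(a *: f1 d + f2 d) H1 // H2 // scaler0 addr0.
rewrite -[RHS]/(a *: (f1 ** k) c + (f2 ** k) c).
rewrite (cp_mul_sum k c FD H1) (cp_mul_sum k c FD H2) (cp_mul_sum k c FD H3).
by rewrite scaler_sumr -big_split.
Qed.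

Lemma translate_lin g (a : C) f1 f2 : translate g (a *: f1 + f2) =
  a *: translate g f1 + translate g f2.
Proof. by apply/funext => c; exact: mult_act_lin. Qed.

Lemma cp_mul_linr (a : C) f1 f2 k : emem k ->
  k ** (a *: f1 + f2) = a *: (k ** f1) + k ** f2.
Proof.
move=> [F Q M]; apply/funext => c.
rewrite -[RHS]/(a *: (k ** f1) c + (k ** f2) c).
rewrite !(cp_mul_sum _ c F (@notsupp k)) scaler_sumr -big_split; apply: eq_bigr => d _.
rewrite translate_lin; apply/funext => x; exact: (mult_linear (M d)).
Qed.

(** ** Involution *)

Lemma conj_delta g : Num.conj (delta g) = delta g.
Proof. by apply: conj_Creal; apply: ger0_real; apply: ltW; exact: Delta_gt0. Qed.

Lemma deltaV g : delta g^-1%g != 0.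
Proof. by rewrite gt_eqF // Delta_gt0. Qed.

Lemma cp_starE f g : emem f ->
  stf f (cos g) = delta g^-1%g *: mult_star (translate g f (cos 1%g)).
Proof.
move=> [F Q M]; rewrite /cp_star.
have -> : mact (repr (cos g)) (f (cos (repr (cos g))^-1%g)) =
    translate (repr (cos g)) f (cos 1%g) by rewrite /translate lact_of mulg1.
rewrite translate_repr //; congr (_ *: _).
have Hk := repr_lcoset Gam g.
have -> : repr (cos g) = (g * (g^-1 * repr (cos g)))%g by rewrite mulgA mulgV mul1g.
by rewrite invgM DeltaMl //; exact: sg_inv.
Qed.

Lemma emem_star f : emem f -> emem (stf f).
Proof.
move=> E; have [F Q M] := E.
have mT g : multipliers (translate g f (cos 1%g)) by exact: translate_mult.
split.
- apply: (@sub_finite_set _ _ [set d | exists2 c, supp f c & exists2 k,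
      sg_set Gam k & d = cos ((repr c * k)^-1)%g]); last first.
    have -> : [set d | exists2 c, supp f c & exists2 k,
      sg_set Gam k & d = cos ((repr c * k)^-1)%g] =
      \bigcup_(c in supp f) (cos @` dcoset_set Gam (repr c)^-1%g).
      apply/seteqP; split=> [d [c Hc [k Gk ->]]|d [c Hc [_ [a [b [Ga Gb ->]]] <-]]].
        exists c => //; exists (k^-1 * (repr c)^-1)%g; last by rewrite invgM.
        by exists k^-1%g, 1%g; split; [exact: sg_inv|exact: sg_one|rewrite mulg1].
      exists c => //; exists a^-1%g; first exact: sg_inv.
      by rewrite lcosetMr // invgM invgK.
    by apply: bigcup_finite => // c _; have [] := HP (repr c)^-1%g.
  move=> d /= nd; exists (cos (repr d)^-1%g).
    apply: contra_neq nd => f0; rewrite -(lcoset_repr d) cp_starE //.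
    by rewrite /translate lact_of mulg1 f0 mult_act0 mult_star0 scaler0.
  exists ((repr (cos (repr d)^-1))^-1 * (repr d)^-1)%g.
    by have := sg_inv (repr_lcoset Gam (repr d)^-1%g); rewrite !invgM !invgK.
  by rewrite mulgA mulgV mul1g invgK lcoset_repr.
- move=> gam g Gg; rewrite !cp_starE // mult_actZ -mult_star_act //; congr (_ *: mult_star _).
    by rewrite invgM DeltaMr //; exact: sg_inv.
  rewrite translateM {1}/translate lact_of mulg1; congr (mact _ (_ _)).
  by apply/lcoset_eqP; rewrite invgK mulg1.
- move=> c; rewrite -(lcoset_repr c) cp_starE //.
  by apply: mult_scale; apply: mult_starM.
Qed.

Lemma cp_starK f : emem f -> stf (stf f) = f.
Proof.
move=> E; have [F Q M] := E; apply/funext => c; rewrite -(lcoset_repr c).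
rewrite cp_starE; last exact: emem_star.
rewrite {1}/translate lact_of mulg1 cp_starE // /translate lact_of mulg1 invgK.
rewrite mult_actZ -mult_star_act; last exact: mult_actP.
rewrite -mult_actM mulgV mult_act1 mult_starZ; last exact: mult_starM.
rewrite mult_starK // scalerA conj_delta mulrC.
by rewrite DeltaVr ?scale1r.
Qed.

(** Reindexing by the translation with g; the modular factors of the two terms
    combine because Delta is multiplicative. *)
Lemma cp_star_mul f1 f2 : emem f1 -> emem f2 -> stf (f1 ** f2) = stf f2 ** stf f1.
Proof.
move=> E1 E2; have [F1 Q1 M1] := E1; have [F2 Q2 M2] := E2.
have ES1 := emem_star E1; have ES2 := emem_star E2.
apply/funext => c; rewrite -(lcoset_repr c); set g := repr c.
rewrite cp_starE; last exact: emem_mul.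
rewrite translate_cp_mul // mult_star_sum; last first.
  by move=> d _; apply: mult_comp; [exact: mult_actP|exact: translate_mult].
rewrite scaler_sumr -(fsumTE (S := supp f1)) //; last first.
  by move=> d nd; rewrite notsupp // mult_act0 (_ : 0 \o _ = 0) // mult_star0 scaler0.
rewrite [RHS](reindex_fsbigT (lact g) _ (lact_bij Gam g)); apply: eq_fsbigr => d _.
rewrite -[X in _ = _ \o X]/(translate (repr (lact g d)) (stf f1) (cos g)).
have e : lact g d = cos (g * repr d)%g by [].
rewrite (translate_pt (g := repr (lact g d)) (h := (g * repr d)%g)) ?lcoset_repr //; last first.
  by case: ES1.
have tE : translate (g * repr d)%g (stf f1) c =
    delta (repr d) *: mact (g * repr d)%g (mult_star (mact (repr d)^-1%g (f1 d))).
  rewrite {1}/translate -(lcoset_repr c) -/g lact_of invgM mulgVK cp_starE // mult_actZ invgK.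
  by rewrite /translate lact_of mulg1 invgK lcoset_repr.
rewrite e cp_starE // tE.
rewrite mult_star_comp; last 2 first.
- exact: mult_actP.
- exact: translate_mult.
rewrite -mult_star_act; last exact: mult_actP.
rewrite -mult_actM mulgK.
apply/funext => x /=.
set S := mult_star _; set T := mult_star _.
have lS : linear S by apply: mult_star_linear; exact: translate_mult.
rewrite -![(_ *: _) _]/(_ *: _ : Cc).
have -> : S (delta (repr d) *: T x) = delta (repr d) *: S (T x).
  by rewrite -[_ *: T x]addr0 lS (linear0_fun lS) addr0.
rewrite scalerA; congr (_ *: _).
by rewrite ?invgM DeltaM // mulrAC [_ * delta (repr d)]mulrC DeltaVr // mul1r.
Qed.

(** ** Coefficients on the base coset *)

Local Notation incl := (@cp_incl R G X A alpha Gam).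

Lemma cp_incl1 T : incl T (cos 1%g) = T.
Proof. by rewrite /cp_incl eqxx. Qed.

Lemma cp_incl0 T c : c <> cos 1%g -> incl T c = 0.
Proof. by move=> /eqP/negbTE ne; rewrite /cp_incl ne. Qed.

Lemma emem_incl T : multipliers T -> (forall gam, sg_set Gam gam -> mact gam T = T) ->
  emem (incl T).
Proof.
move=> mT iT; split.
- apply: (@sub_finite_set _ _ [set cos 1%g]); last exact: finite_set1.
  move=> c /= /eqP n; apply: contrapT => ne; apply: n; exact: cp_incl0.
- move=> gam g Gg; rewrite -lact_of.
  have [->|ne] := pselect (cos g = cos 1%g).
    by rewrite (iffRL (stab_base Gam gam) Gg) cp_incl1 iT.
  rewrite !cp_incl0 ?mult_act0 // -(iffRL (stab_base Gam gam) Gg) => e; apply: ne.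
  exact: (can_inj (@lactK _ Gam gam)).
- move=> c; have [->|ne] := pselect (c = cos 1%g); first by rewrite cp_incl1.
  by rewrite cp_incl0 //; exact: mult_zero.
Qed.

Lemma cp_mul_incll T f : equivariant f -> incl T ** f = fun c => T \o f c.
Proof.
move=> ef; apply/funext => c; rewrite /cp_mul (fsumT1 (i := cos 1%g)); last first.
  by move=> d /eqP nd; rewrite cp_incl0.
rewrite cp_incl1 -[mact _ _]/(translate (repr (cos 1%g)) f c) translate_repr //.
by rewrite translate1.
Qed.

Lemma cp_mul_inclr T f c : emem f -> linear T ->
  (f ** incl T) c = f c \o mact (repr c) T.
Proof.
move=> [F Q M] lT; rewrite /cp_mul (fsumT1 (i := c)); last first.
  move=> d /eqP nd; rewrite cp_incl0 ?mult_act0 ?compf0 //; first exact/mult_linear.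
  rewrite -[cos _]/(lact (repr d)^-1%g c) => e; apply: nd.
  by rewrite -(lactVK (repr d) c) e lact_of mulg1 lcoset_repr.
by rewrite mulVg cp_incl1.
Qed.

Lemma cp_star_incl T : multipliers T -> (forall gam, sg_set Gam gam -> mact gam T = T) ->
  stf (incl T) = incl (mult_star T).
Proof.
move=> mT iT; apply/funext => c; rewrite -(lcoset_repr c) cp_starE; last exact: emem_incl.
rewrite /translate lact_of mulg1; set g := repr c.
have [Gg|nG] := pselect (sg_set Gam g).
  have Gg' := sg_inv Gg.
  have cG x : sg_set Gam x -> cos x = cos 1%g.
    by move=> Gx; rewrite -[x]mul1g lcosetMr.
  by rewrite !cG // !cp_incl1 iT // Delta_base ?scale1r.
rewrite !cp_incl0 ?mult_act0 ?mult_star0 ?scaler0 // => /esym/lcoset_eqP; rewrite invg1 mul1g //.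
by move=> /sg_inv; rewrite invgK.
Qed.

(** ** The Hecke algebra acts *)

Local Notation dc := (dcoset_of Gam).
Implicit Types (w : dcosets Gam -> C).
Local Notation H := (Hecke_algebra R Gam).

Lemma dcoset_eqP g h : dc g = dc h <-> dcoset_set Gam g h.
Proof.
split=> [/eqP|e]; first by rewrite eqmodE => /asboolP.
by apply/eqP; rewrite eqmodE; apply/asboolP.
Qed.

Lemma dcoset_repr (d : dcosets Gam) : dc (repr d) = d.
Proof. exact: reprK. Qed.

Lemma dcosetMr g (k : G) : sg_set Gam k -> dc (g * k)%g = dc g.
Proof.
move=> Gk; apply/esym/dcoset_eqP; exists 1%g, k.
by split=> //; [exact: sg_one|rewrite mul1g].
Qed.

Lemma dcosetMl g (k : G) : sg_set Gam k -> dc (k * g)%g = dc g.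
Proof.
move=> Gk; apply/esym/dcoset_eqP; exists k, 1%g.
by split=> //; [exact: sg_one|rewrite mulg1].
Qed.

Lemma dcoset_lcoset g h : cos g = cos h -> dc g = dc h.
Proof.
move=> /lcoset_eqP e; rewrite -(dcosetMr g e); congr dc.
by rewrite mulgA mulgV mul1g.
Qed.

Lemma repr_dcoset g : exists a b, [/\ sg_set Gam a, sg_set Gam b &
  repr (dc g) = (a * g * b)%g].
Proof. by apply/dcoset_eqP; rewrite dcoset_repr. Qed.

Lemma Hecke_mulE w1 w2 g : Hecke_mul w1 w2 (dc g) =
  \sum_(c \in [set: L]) w1 (dc (repr c)) * w2 (dc ((repr c)^-1 * g)%g).
Proof.
have [a [b [Ga Gb e]]] := repr_dcoset g.
rewrite /Hecke_mul e [LHS](reindex_fsbigT (lact a) _ (lact_bij Gam a)).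
apply: eq_fsbigr => c _; congr (w1 _ * w2 _).
  rewrite -(dcosetMl (repr c) Ga); apply: dcoset_lcoset.
  by rewrite lcoset_repr.
have [k Gk ->] : exists2 k, sg_set Gam k & repr (lact a c) = (a * repr c * k)%g.
  exists ((a * repr c)^-1 * repr (lact a c))%g; first exact: repr_lcoset.
  by rewrite mulgA mulgV mul1g.
rewrite !invgM -!mulgA mulKg dcosetMl; last exact: sg_inv.
by rewrite mulgA dcosetMr.
Qed.

Lemma Hecke_starE w g : Hecke_star w (dc g) = delta g^-1%g * Num.conj (w (dc g^-1%g)).
Proof.
have [a [b [Ga Gb e]]] := repr_dcoset g.
rewrite /Hecke_star e !invgM.
have Ga' := sg_inv Ga; have Gb' := sg_inv Gb.
by rewrite DeltaMl // DeltaMr // dcosetMl // dcosetMr.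
Qed.

Definition Hecke_emb w : L -> Cc -> Cc := fun c => w (dc (repr c)) *: id.

Lemma Hecke_embE w g : Hecke_emb w (cos g) = w (dc g) *: id.
Proof.
rewrite /Hecke_emb; congr (w _ *: _); apply: dcoset_lcoset; exact: lcoset_repr.
Qed.

Lemma Hecke_lift_finite w : sa_mem (w : H) ->
  finite_set [set c : L | w (dc (repr c)) != 0].
Proof.
move=> fw; apply: (@sub_finite_set _ _
  (\bigcup_(d in [set d | w d != 0]) (cos @` dcoset_set Gam (repr d)))).
  move=> c /= wc; exists (dc (repr c)) => //; exists (repr c); last exact: lcoset_repr.
  by apply/dcoset_eqP; rewrite dcoset_repr.
by apply: bigcup_finite => // d _; have [] := HP (repr d).
Qed.

Lemma translate_Hecke g w h : translate g (Hecke_emb w) (cos h) = w (dc (g^-1 * h)%g) *: id.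
Proof. by rewrite /translate lact_of Hecke_embE mult_actZ mult_act_id. Qed.

Lemma emem_Hecke w : sa_mem (w : H) -> emem (Hecke_emb w).
Proof.
move=> fw; split.
- apply: sub_finite_set (Hecke_lift_finite fw) => c /=.
  by apply: contra_neq; rewrite /Hecke_emb => ->; rewrite scale0r.
- move=> gam g Gg; rewrite !Hecke_embE mult_actZ mult_act_id dcosetMl //.
- by move=> c; apply: mult_scale; exact: mult_id.
Qed.

Lemma Hecke_emb_lin (a : C) w1 w2 :
  Hecke_emb (a *: w1 + w2) = a *: Hecke_emb w1 + Hecke_emb w2.
Proof.
apply/funext => c; rewrite -[RHS]/(a *: Hecke_emb w1 c + Hecke_emb w2 c) /Hecke_emb.
by rewrite scalerA -scalerDl.
Qed.

Lemma Hecke_emb_mul w1 w2 : sa_mem (w1 : H) ->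
  Hecke_emb (Hecke_mul w1 w2) = Hecke_emb w1 ** Hecke_emb w2.
Proof.
move=> m1; have F1 := Hecke_lift_finite m1; apply/funext => c.
rewrite -(lcoset_repr c) Hecke_embE Hecke_mulE (fsumTE F1); last first.
  by move=> d /= /negP; rewrite negbK => /eqP ->; rewrite mul0r.
rewrite (cp_mul_sum _ _ F1); last first.
  by move=> d /= /negP; rewrite negbK => /eqP; rewrite /Hecke_emb => ->; rewrite scale0r.
rewrite scaler_suml; apply: eq_bigr => d _; rewrite translate_Hecke.
by apply/funext => x; rewrite -[RHS]/(_ *: (_ *: _) : Cc) scalerA.
Qed.

Lemma Hecke_emb_star w : sa_mem (w : H) -> Hecke_emb (Hecke_star w) = stf (Hecke_emb w).
Proof.
move=> mw; apply/funext => c; rewrite -(lcoset_repr c) Hecke_embE cp_starE; last exact: emem_Hecke.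
rewrite translate_Hecke mulg1 mult_starZ ?mult_star_id; last exact: mult_id.
by rewrite Hecke_starE scalerA.
Qed.

Lemma Hecke_mem_lin (a : C) w1 w2 : sa_mem (w1 : H) -> sa_mem (w2 : H) ->
  sa_mem (a *: w1 + w2 : H).
Proof.
move=> m1 m2; have : finite_set ([set d | w1 d != 0] `|` [set d | w2 d != 0]).
  by rewrite finite_setU.
apply: sub_finite_set => d /= n; have [e1|] := eqVneq (w1 d) 0; last by left.
right; apply: contra_neq n => e2.
by rewrite -[LHS]/(a *: w1 d + w2 d) e1 e2 scaler0 addr0.
Qed.

Lemma Hecke_mem_star w : sa_mem (w : H) -> sa_mem (Hecke_star w : H).
Proof.
move=> mw; rewrite -[sa_mem _]/(finite_set [set d | Hecke_star w d != 0]).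
apply: (@sub_finite_set _ _ ((fun d : dcosets Gam => dc (repr d)^-1%g) @` [set d | w d != 0])).
  move=> d /= nd; exists (dc (repr d)^-1%g).
    by apply: contra_neq nd; rewrite /Hecke_star => ->; rewrite conjC0 mulr0.
  have [a [b [Ga Gb ->]]] := repr_dcoset (repr d)^-1%g.
  rewrite !invgM invgK mulgA dcosetMr ?dcosetMl ?dcoset_repr //; exact: sg_inv.
exact: finite_image.
Qed.

Lemma Hecke_mem_mul w1 w2 : sa_mem (w1 : H) -> sa_mem (w2 : H) ->
  sa_mem (Hecke_mul w1 w2 : H).
Proof.
move=> m1 m2; pose P w := [set c : L | w (dc (repr c)) != 0].
rewrite -[sa_mem _]/(finite_set [set d | Hecke_mul w1 w2 d != 0]).
apply: (@sub_finite_set _ _ (\bigcup_(c in P w1) [set dc (repr c * repr e)%g | e in P w2])).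
  move=> d /= nd; apply: contrapT => nex; case/negP: nd; apply/eqP.
  rewrite /Hecke_mul fsbig1 // => c _; apply/eqP/negPn/negP; rewrite mulf_eq0 => /norP[n1 n2].
  apply: nex; exists c => //; exists (cos ((repr c)^-1 * repr d)%g).
    rewrite /P /=; have -> // : dc (repr (cos ((repr c)^-1 * repr d)%g)) = dc ((repr c)^-1 * repr d)%g.
    by apply: dcoset_lcoset; rewrite lcoset_repr.
  rewrite -{2}(dcoset_repr d); apply: dcoset_lcoset; rewrite -lact_of lcoset_repr lact_of.
  by rewrite mulgA mulgV mul1g.
apply: bigcup_finite; first exact: Hecke_lift_finite.
by move=> c _; apply: finite_image; exact: Hecke_lift_finite.
Qed.

End EquivariantAlgebra.

(** * Operators given by locally finite sections *)

Section SectionOperators.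
Variables (R : realType) (X : groupoid) (A : Fell_bundle R X).
Local Notation C := R[i].
Local Notation fib := (fib A).
Local Notation Cc := (Cc A).
Implicit Types (s : sections A) (f k : Cc) (w : total_space A).

Lemma in_fib_eq0 z w : tag w = z -> in_fib z w = 0 -> tagged w = 0.
Proof. by move=> <-; rewrite in_fib_tag. Qed.

Lemma Cc_delta_in_fib z w : tag w = z ->
  Cc_delta (Tagged fib (in_fib z w)) = Cc_delta w.
Proof. by move=> <-; rewrite in_fib_tag; case: w. Qed.

Lemma linear_sum_fun (V W : lmodType C) (I : Type) (r : seq I) (F : I -> V) (T : V -> W) :
  linear T -> T (\sum_(i <- r) F i) = \sum_(i <- r) T (F i).
Proof.
move=> lT; elim: r => [|i r IH]; first by rewrite !big_nil linear0_fun.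
by rewrite !big_cons linearD_fun // IH.
Qed.

Lemma Cc_mul_suml (I : Type) (r : seq I) (P : pred I) (F : I -> Cc) k :
  Cc_mul (\sum_(i <- r | P i) F i) k = \sum_(i <- r | P i) Cc_mul (F i) k.
Proof. by elim/big_rec2: _ => [|i y x _ <-]; rewrite ?Cc_mul0l ?Cc_mulDl. Qed.

Lemma Cc_mul_sumr (I : Type) (r : seq I) (P : pred I) (F : I -> Cc) k :
  Cc_mul k (\sum_(i <- r | P i) F i) = \sum_(i <- r | P i) Cc_mul k (F i).
Proof. by elim/big_rec2: _ => [|i y x _ <-]; rewrite ?Cc_mul0r ?Cc_mulDr. Qed.

Lemma Cc_star_sum (I : Type) (r : seq I) (F : I -> Cc) :
  Cc_star (\sum_(i <- r) F i) = \sum_(i <- r) Cc_star (F i).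
Proof.
elim: r => [|i r IH]; first by rewrite !big_nil Cc_star0.
by rewrite !big_cons Cc_starD IH.
Qed.

Lemma Cc_expand f : f = \sum_(x <- fset_set [set x | Cc_val f x != 0])
  Cc_delta (Tagged fib (Cc_val f x)).
Proof.
apply: Cc_sum_delta; first exact: Cc_finite.
by move=> x /= /negP; rewrite negbK => /eqP.
Qed.

Lemma Cc_mul_delta0 w f : (forall y, Cc_val f y != 0 -> rng y <> src (tag w)) ->
  Cc_mul (Cc_delta w) f = 0.
Proof.
move=> H; rewrite [f]Cc_expand Cc_mul_sumr big_seq big1 // => y.
rewrite in_fset_set; last exact: Cc_finite.
move=> /set_mem /= /H ne; rewrite Cc_mul_delta /=.
by case: eqP => // e; case: ne.
Qed.

Definition delta_at s x : Cc := Cc_delta (Tagged fib (s x)).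

Lemma delta_at0 s x : s x = 0 -> delta_at s x = 0.
Proof. by move=> e; rewrite /delta_at e Cc_delta0. Qed.

Definition locally_finite s := forall u,
  finite_set [set x | s x != 0 /\ (src x = u \/ rng x = u)].

(** Convolution by a section that need not be finitely supported. *)
Definition sec_op s f : Cc := \sum_(x \in [set: X]) Cc_mul (delta_at s x) f.

Definition sec_supp s f : set X :=
  [set x | s x != 0 /\ exists2 y, Cc_val f y != 0 & rng y = src x].

Lemma sec_supp_finite s f : locally_finite s -> finite_set (sec_supp s f).
Proof.
move=> ls; apply: (@sub_finite_set _ _ (\bigcup_(y in [set y | Cc_val f y != 0])
  [set x | s x != 0 /\ (src x = rng y \/ rng x = rng y)])).
  by move=> x [nx [y ny e]]; exists y => //; split=> //; left.
by apply: bigcup_finite => [|y _]; [exact: Cc_finite|exact: ls].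
Qed.

Lemma sec_supp0 s f x : ~ sec_supp s f x -> Cc_mul (delta_at s x) f = 0.
Proof.
move=> nx; have [e|ne] := eqVneq (s x) 0; first by rewrite delta_at0 // Cc_mul0l.
by apply: Cc_mul_delta0 => y ny e; apply: nx; split=> //; exists y.
Qed.

Lemma sec_opE s f (S : set X) : finite_set S -> sec_supp s f `<=` S ->
  sec_op s f = \sum_(x <- fset_set S) Cc_mul (delta_at s x) f.
Proof.
move=> fS sub; apply: fsumTE => // x nx; apply: sec_supp0 => /sub; exact: nx.
Qed.

Lemma sec_supp_lin s (c : C) f k : sec_supp s (c *: f + k) `<=`
  sec_supp s f `|` sec_supp s k.
Proof.
move=> x [nx [y ny e]]; have [f0|nf] := eqVneq (Cc_val f y) 0.
  right; split=> //; exists y => //; apply: contra_neq ny => k0.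
  by rewrite Cc_linE f0 k0 scaler0 addr0.
by left; split=> //; exists y.
Qed.

Lemma sec_op_linear s : locally_finite s -> linear (sec_op s).
Proof.
move=> ls c f k; set S := sec_supp s f `|` sec_supp s k.
have fS : finite_set S by rewrite finite_setU; split; exact: sec_supp_finite.
rewrite (sec_opE fS (@sec_supp_lin _ _ _ _)).
rewrite (sec_opE fS (@subsetUl _ _ _)) (sec_opE fS (@subsetUr _ _ _)).
rewrite scaler_sumr -big_split; apply: eq_bigr => x _; exact: Cc_mul_linr.
Qed.

Lemma delta_at_lin (c : C) s1 s2 x :
  delta_at (c *: s1 + s2) x = c *: delta_at s1 x + delta_at s2 x.
Proof. exact: Cc_delta_lin. Qed.

Lemma sec_op_lin (c : C) s1 s2 : locally_finite s1 -> locally_finite s2 ->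
  sec_op (c *: s1 + s2) = c *: sec_op s1 + sec_op s2.
Proof.
move=> l1 l2; apply/funext => f; set S := sec_supp s1 f `|` sec_supp s2 f.
have fS : finite_set S by rewrite finite_setU; split; exact: sec_supp_finite.
rewrite -[RHS]/(c *: sec_op s1 f + sec_op s2 f).
rewrite (sec_opE fS (@subsetUl _ _ _)) (sec_opE fS (@subsetUr _ _ _)).
rewrite (sec_opE fS); last first.
  move=> x [nx [y ny e]]; have [e1|n1] := eqVneq (s1 x) 0.
    right; split; last by exists y.
    apply: contra_neq nx => e2.
    by rewrite -[LHS]/(c *: s1 x + s2 x) e1 e2 scaler0 addr0.
  by left; split=> //; exists y.
rewrite scaler_sumr -big_split; apply: eq_bigr => x _.
by rewrite delta_at_lin Cc_mul_linl.
Qed.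

(** A section is recovered from its values at the adjoints of its elements, by the
    C*-identity. *)
Lemma sec_op_inj s1 s2 : locally_finite s1 -> locally_finite s2 ->
  sec_op s1 = sec_op s2 -> s1 = s2.
Proof.
move=> l1 l2 e; apply: functional_extensionality_dep => x; apply/eqP.
rewrite -subr_eq0; apply/eqP.
pose d : sections A := -1 *: s2 + s1.
have -> : s1 x - s2 x = d x.
  by rewrite -[RHS]/(-1 *: s2 x + s1 x) scaleN1r addrC.
have D0 : sec_op d = 0.
  by rewrite sec_op_lin // e scaleN1r addNr.
have ld : locally_finite d.
  move=> u; have := conj (l1 u) (l2 u); rewrite -finite_setU.
  apply: sub_finite_set => y [ny hy]; have [e1|n1] := eqVneq (s1 y) 0.
    right; split=> //; apply: contra_neq ny => e2.
    by rewrite -[LHS]/(-1 *: s2 y + s1 y) e1 e2 scaler0 addr0.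
  by left.
move: ld D0; clearbody d => ld D0 {e}; apply: contrapT => /eqP dx.
set w : total_space A := Tagged fib (d x).
have := congr1 (fun T : Cc -> Cc => T (Cc_delta (tstar w))) D0.
rewrite -[(0 : Cc -> Cc) _]/(0 : Cc) /=.
have fS := sec_supp_finite (Cc_delta (tstar w)) ld.
have fS' : finite_set (sec_supp d (Cc_delta (tstar w)) `|` [set x]).
  by rewrite finite_setU; split=> //; exact: finite_set1.
rewrite (sec_opE fS' (@subsetUl _ _ _)).
have off y : y != x -> Cc_val (Cc_mul (delta_at d y) (Cc_delta (tstar w))) (rng x) = 0.
  move=> yx; rewrite /delta_at Cc_mul_delta; case: ifP => // /eqP /=.
  rewrite rng_inv => sy; rewrite /delta_sec in_fib_ne //=; apply: contra_neq yx => e.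
  rewrite -(gpd_mul_src y) sy -(gpd_mulVx x) -gpd_mulA ?rng_inv ?src_inv //.
  by rewrite e gpd_mul_rng.
have xS : x \in fset_set (sec_supp d (Cc_delta (tstar w)) `|` [set x]).
  by rewrite in_fset_set //; apply: mem_set; right.
move=> /(congr1 (fun f : Cc => Cc_val f (rng x))); rewrite Cc_sumE.
rewrite (bigD1_seq x xS (fset_uniq _)) (big1 _ _ _ off).
rewrite [LHS](addr0 (Cc_val (Cc_mul (delta_at d x) (Cc_delta (tstar w))) (rng x))).
rewrite /delta_at Cc_mul_delta.
rewrite rng_inv eqxx Cc_deltaE => h.
have := fcstar (fstar (d x)).
have t : Tagged fib (fmul (fstar (fstar (d x))) (fstar (d x))) =
    Tagged fib (fmul (d x) (fstar (d x))).
  rewrite -[LHS]/(tmul (Tagged fib (fstar (fstar (d x)))) (Tagged fib (fstar (d x)))).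
  by rewrite fstarK.
have z : fmul (d x) (fstar (d x)) = 0.
  exact: (@in_fib_eq0 (rng x) (tmul w (tstar w)) (gpd_mulV x) h).
have {t} t : fmul (fstar (fstar (d x))) (fstar (d x)) = 0.
  have := congr1 (in_fib (gpd_mul (gpd_inv (gpd_inv x)) (gpd_inv x))) t.
  by rewrite in_fibE z in_fib0.
rewrite t normr0 => /esym/eqP; rewrite expf_eq0 /= normr_eq0 => /eqP d0.
have : Tagged fib (fstar (fstar (d x))) = w by exact: fstarK.
rewrite d0 fstar0 => e; move/negP: dx; apply; apply/eqP.
have := congr1 (in_fib x) e; rewrite in_fibE => <-.
by rewrite in_fib0.
Qed.

Lemma delta_at_star s x : delta_at (star_sec s) (gpd_inv x) = Cc_star (delta_at s x).
Proof.
rewrite /delta_at /star_sec Cc_delta_in_fib /=; last by rewrite gpd_invK.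
rewrite Cc_star_delta; congr Cc_delta.
rewrite -[LHS]/(tstar (Tagged fib (s (gpd_inv (gpd_inv x))))).
by rewrite gpd_invK.
Qed.

Lemma star_sec_eq0 s y : s (gpd_inv y) = 0 -> star_sec s y = 0.
Proof. by move=> e; rewrite /star_sec e fstar0 in_fib0. Qed.

Lemma star_sec_locally_finite s : locally_finite s -> locally_finite (star_sec s).
Proof.
move=> ls u; apply: (@sub_finite_set _ _ (@gpd_inv X @`
  [set x | s x != 0 /\ (src x = u \/ rng x = u)])); last exact: finite_image (ls u).
move=> x [nx hx]; exists (gpd_inv x); last exact: gpd_invK.
split; last by rewrite src_inv rng_inv; case: hx; [right|left].
by apply: contra_neq nx; exact: star_sec_eq0.
Qed.

Lemma gpd_inv_bij : bijective (@gpd_inv X).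
Proof. by exists (@gpd_inv X) => x; exact: gpd_invK. Qed.

Lemma sec_op_adjoint s : locally_finite s -> mult_adjoint (sec_op s) (sec_op (star_sec s)).
Proof.
move=> ls f1 f2; pose F x := Cc_mul (Cc_star f1) (Cc_mul (Cc_star (delta_at s x)) f2).
have fS := sec_supp_finite f1 ls.
have ls' := star_sec_locally_finite ls; have fS' := sec_supp_finite f2 ls'.
transitivity (\sum_(x \in [set: X]) F x).
  rewrite (sec_opE fS) // Cc_star_sum Cc_mul_suml (fsumTE fS) => [|x /sec_supp0 e].
    by apply: eq_bigr => x _; rewrite Cc_star_mul -Cc_mulA.
  by rewrite /F Cc_mulA -Cc_star_mul e Cc_star0 Cc_mul0l.
rewrite [LHS](reindex_fsbigT (@gpd_inv X) _ gpd_inv_bij) (sec_opE fS') // Cc_mul_sumr.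
rewrite (fsumTE fS') => [|x /sec_supp0 e]; rewrite /F.
  apply: eq_bigr => x _; by rewrite -delta_at_star gpd_invK.
by rewrite -delta_at_star gpd_invK e Cc_mul0r.
Qed.

Lemma sec_op_multiplier s : locally_finite s -> multipliers (sec_op s).
Proof.
move=> ls; split; first exact: sec_op_linear.
exists (sec_op (star_sec s)); split; last exact: sec_op_adjoint.
exact/sec_op_linear/star_sec_locally_finite.
Qed.

Lemma mult_star_sec s : locally_finite s -> mult_star (sec_op s) = sec_op (star_sec s).
Proof.
move=> ls; apply: mult_star_eq; last exact: sec_op_adjoint.
exact/sec_op_linear/star_sec_locally_finite.
Qed.

Lemma mul_sec_supp s1 s2 z : mul_sec s1 s2 z != 0 -> exists x y,
  [/\ s1 x != 0, s2 y != 0, src x = rng y & gpd_mul x y = z].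
Proof.
move=> nz; apply: contrapT => nex; move/eqP: nz; apply.
apply: fsbig1 => -[x y] [/= xy xyz]; apply/eqP/negPn/negP => /in_fib_neq0[_ /=].
move=> m0; apply: nex; exists x, y; split => //.
  by apply: contra_neq m0 => ->; exact: fmul0r.
by apply: contra_neq m0 => ->; exact: fmulr0.
Qed.

Lemma delta_at_mul s1 s2 z (P : set (X * X)) : finite_set P ->
  (forall x y, s1 x != 0 -> s2 y != 0 -> src x = rng y -> gpd_mul x y = z -> P (x, y)) ->
  delta_at (mul_sec s1 s2) z = \sum_(p <- fset_set P | gpd_mul p.1 p.2 == z)
    Cc_mul (delta_at s1 p.1) (delta_at s2 p.2).
Proof.
move=> fP H; pose t p := if (src p.1 == rng p.2) && (gpd_mul p.1 p.2 == z) then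
  in_fib z (tmul (Tagged fib (s1 p.1)) (Tagged fib (s2 p.2))) else 0.
have mE : mul_sec s1 s2 z = \sum_(p <- fset_set P) t p.
  rewrite -(fsumTE fP); last first.
    move=> [x y] /= np; rewrite /t /=; case: ifP => // /andP[/eqP xy /eqP xyz].
    apply/eqP/negPn/negP => /in_fib_neq0[_ /= m0]; apply: np; apply: H => //.
      by apply: contra_neq m0 => ->; exact: fmul0r.
    by apply: contra_neq m0 => ->; exact: fmulr0.
  rewrite /mul_sec fsbig_mkcond; apply: eq_fsbigr => p _; rewrite /patch /t.
  case: ifPn => [|/negP np]; first by move=> /set_mem[-> ->]; rewrite !eqxx.
  by case: ifP => // /andP[/eqP h1 /eqP h2]; case: np; exact: mem_set.
rewrite {1}/delta_at mE; have -> : Cc_delta (Tagged fib (\sum_(p <- fset_set P) t p)) =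
    \sum_(p <- fset_set P) Cc_delta (Tagged fib (t p)).
  elim: (fset_set _ : seq _) => [|p r IH]; first by rewrite !big_nil Cc_delta0.
  by rewrite !big_cons -IH -[t p]scale1r Cc_delta_lin !scale1r.
rewrite [RHS]big_mkcond; apply: eq_bigr => p _; rewrite Cc_mul_delta /t /=.
case: ifP => [/andP[-> e]|].
  by rewrite e Cc_delta_in_fib //=; exact/eqP.
by rewrite Cc_delta0; case: (_ == rng _) => /= [->|] //; case: ifP.
Qed.

Lemma sec_op_mul s1 s2 : locally_finite s1 -> locally_finite s2 ->
  sec_op s1 \o sec_op s2 = sec_op (mul_sec s1 s2).
Proof.
move=> l1 l2; apply/funext => f /=.
set S2 := sec_supp s2 f; have f2 : finite_set S2 by exact: sec_supp_finite.
pose S1 := \bigcup_(y in S2) [set x | s1 x != 0 /\ (src x = rng y \/ rng x = rng y)].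
have f1 : finite_set S1 by apply: bigcup_finite => // y _; exact: l1.
pose P : set (X * X) := [set p | (S1 `*` S2) p /\ src p.1 = rng p.2].
have f12 : finite_set (S1 `*` S2) by exact: finite_setX.
have fP : finite_set P by apply: sub_finite_set f12 => p [].
pose F (p : X * X) := Cc_mul (delta_at s1 p.1) (Cc_mul (delta_at s2 p.2) f).
have eF p : F p = Cc_mul (Cc_mul (delta_at s1 p.1) (delta_at s2 p.2)) f by exact: Cc_mulA.
have F0 p : ~ P p -> F p = 0.
  case: p => x y nP; have [y2|n2] := pselect (S2 y); last by rewrite /F /= (sec_supp0 n2) Cc_mul0r.
  rewrite eF /= Cc_mul_delta /=; have [xy|_] := eqVneq; last by rewrite Cc_mul0l.
  have [e|ne] := eqVneq (s1 x) 0; last first.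
    by case: nP; split=> //; split=> //; exists y => //; split=> //; left.
  by rewrite -[Cc_delta _]/(Cc_delta (tmul (Tagged fib (s1 x)) (Tagged fib (s2 y)))) e
    /tmul /= fmul0r // Cc_delta0 Cc_mul0l.
pose Z := [set gpd_mul p.1 p.2 | p in P]; have fZ : finite_set Z by exact: finite_image.
transitivity (\sum_(p <- fset_set P) F p).
  rewrite (@sec_opE s2 f _ f2) // (linear_sum_fun _ _ (@sec_op_linear _ l1)).
  transitivity (\sum_(y <- fset_set S2) \sum_(x <- fset_set S1) F (x, y)).
    rewrite big_seq [RHS]big_seq; apply: eq_bigr => y; rewrite in_fset_set // => /set_mem yS.
    by apply: fsumTE => // x nx; apply: (F0 (x, y)) => -[[]].
  rewrite exchange_big /= -!fsbig_finite //.
  under eq_fsbigr do rewrite -fsbig_finite //.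
  rewrite pair_fsbig // fsbig_finite //.
  have G0 p : ~ (S1 `*` S2) p -> F (p.1, p.2) = 0 by move=> np; apply: F0 => -[].
  by rewrite -(fsumTE f12 G0) [RHS]fsbig_finite // -(fsumTE fP F0); apply: eq_fsbigr => -[].
rewrite (sec_opE fZ); last first.
  move=> z [nz [y' ny' e']]; have [x [y [nx ny xy xyz]]] := mul_sec_supp nz.
  exists (x, y) => //; have yS : S2 y.
    by split=> //; exists y' => //; rewrite e' -xyz src_mul.
  by split=> //; split=> //; exists y => //; split=> //; left.
rewrite fset_set_image // (partition_big_imfset _ (fun p => gpd_mul p.1 p.2)) /=.
apply: eq_big_seq => z; rewrite -fset_set_image // in_fset_set //.
move=> /set_mem [[x0 y0] [[_ /= [_ [y' ny' e']]] xy0] /= e0].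
rewrite (delta_at_mul fP) ?Cc_mul_suml => [|x y nx ny xy xyz]; first exact: eq_bigr.
have S2y : S2 y by split=> //; exists y' => //; rewrite e' -(src_mul xy0) e0 -xyz src_mul.
by split=> //; split=> //; exists y => //; split=> //; left.
Qed.

(** ** Restriction to a set of ranges *)

Lemma range_restrict_subproof (U : set X) f :
  (fun z => if `[< U (rng z) >] then Cc_val f z else 0) \in @Defs.finsupp R X A.
Proof.
apply/Defs.finsuppP; apply: sub_finite_set (Cc_finite f) => x /=.
by case: asboolP => // _; rewrite eqxx.
Qed.

Definition range_restrict (U : set X) f : Cc := MkCc (range_restrict_subproof U f).

Lemma range_restrictE U f z :
  Cc_val (range_restrict U f) z = if `[< U (rng z) >] then Cc_val f z else 0.
Proof. by []. Qed.

Lemma range_restrict_linear U : linear (range_restrict U).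
Proof.
move=> c f k; apply: Cc_eqP => z; rewrite Cc_linE !range_restrictE.
by case: asboolP => _; rewrite ?scaler0 ?addr0.
Qed.

Lemma range_restrict_delta U w :
  range_restrict U (Cc_delta w) = if `[< U (rng (tag w)) >] then Cc_delta w else 0.
Proof.
apply: Cc_eqP => z; rewrite range_restrictE.
have [e|n] := eqVneq (tag w) z; last first.
  rewrite Cc_deltaE in_fib_ne // !if_same.
  by case: asboolP => _ //; rewrite Cc_deltaE in_fib_ne.
by rewrite e; case: asboolP.
Qed.

Lemma range_restrict_idem U f : range_restrict U (range_restrict U f) = range_restrict U f.
Proof. by apply: Cc_eqP => z; rewrite !range_restrictE; case: asboolP. Qed.

Lemma range_restrict_adjoint U : mult_adjoint (range_restrict U) (range_restrict U).
Proof.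
move=> f1 f2; have lQ := range_restrict_linear U.
rewrite (Cc_expand f1) (linear_sum_fun _ _ lQ) !Cc_star_sum !Cc_mul_suml.
apply: eq_bigr => x _; rewrite (Cc_expand f2) (linear_sum_fun _ _ lQ) !Cc_mul_sumr.
apply: eq_bigr => y _; rewrite !range_restrict_delta /=.
case: asboolP => Ux; rewrite ?Cc_star0 ?Cc_mul0l.
  case: asboolP => // nU; rewrite Cc_mul0r Cc_star_delta Cc_mul_delta /= src_inv.
  by case: eqP => // e; case: nU; rewrite -e.
case: asboolP => Uy; rewrite ?Cc_mul0r // Cc_star_delta Cc_mul_delta /= src_inv.
by case: eqP => // e; case: Ux; rewrite e.
Qed.

Lemma range_restrict_multiplier U : multipliers (range_restrict U).
Proof.
split; first exact: range_restrict_linear.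
by exists (range_restrict U); split; [exact: range_restrict_linear|exact: range_restrict_adjoint].
Qed.

Lemma mult_star_range_restrict U : mult_star (range_restrict U) = range_restrict U.
Proof. exact: mult_star_eq (@range_restrict_linear U) (@range_restrict_adjoint U). Qed.

Definition sec_restrict (U : set X) s : sections A :=
  fun z => if `[< U (rng z) >] then s z else 0.

Lemma sec_restrict_supp U s z : sec_restrict U s z != 0 -> s z != 0.
Proof. by rewrite /sec_restrict; case: asboolP => // _; rewrite eqxx. Qed.

Lemma range_restrict_mul U w f : range_restrict U (Cc_mul (Cc_delta w) f) =
  if `[< U (rng (tag w)) >] then Cc_mul (Cc_delta w) f else 0.
Proof.
have lQ := range_restrict_linear U.
elim/Cc_ind: f => [|f k IHf IHk|v].
- by rewrite Cc_mul0r (linear0_fun lQ) if_same.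
- by rewrite Cc_mulDr (linearD_fun _ _ lQ) IHf IHk; case: ifP; rewrite ?addr0.
rewrite Cc_mul_delta; case: eqP => [e|_]; last by rewrite (linear0_fun lQ) if_same.
by rewrite range_restrict_delta /= rng_mul.
Qed.

Lemma range_restrict_sec U s : locally_finite s ->
  range_restrict U \o sec_op s = sec_op (sec_restrict U s).
Proof.
move=> ls; apply/funext => f /=; have fS := sec_supp_finite f ls.
rewrite (sec_opE fS) // (linear_sum_fun _ _ (@range_restrict_linear U)).
rewrite (sec_opE fS) => [|x [nx h]]; last by split=> //; exact: sec_restrict_supp nx.
apply: eq_bigr => x _; rewrite range_restrict_mul /= /delta_at /sec_restrict.
by case: asboolP => // _; rewrite Cc_delta0 Cc_mul0l.
Qed.

End SectionOperators.

(** * Sections of orbit bundles as invariant sections *)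

Section Orbits.
Variables (R : realType) (G : groupType) (X : groupoid) (A : Fell_bundle R X).
Variable alpha : Fell_action G A.
Local Notation fib := (fib A).
Local Notation Cc := (Cc A).
Local Notation gact := (gact alpha).
Local Notation tact := (tact alpha).
Implicit Types (x y z : X) (g h : G) (w : total_space A) (s : sections A) (f : Cc).

Lemma gactK x g : gact (gact x g) g^-1%g = x.
Proof. by rewrite -gactM mulgV gact1. Qed.

Lemma gactVK x g : gact (gact x g^-1%g) g = x.
Proof. by rewrite -gactM mulVg gact1. Qed.

Lemma gact_inv x g : gact (gpd_inv x) g = gpd_inv (gact x g).
Proof.
set a := gact (gpd_inv x) g; set b := gact x g.
have ab : gpd_mul a b = src b by rewrite -gact_mul ?src_inv // gpd_mulVx gact_src.
have sa : src a = rng b by rewrite /a /b gact_src gact_rng src_inv.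
rewrite -(gpd_mul_src a) sa -(gpd_mulV b) -gpd_mulA ?rng_inv // ab.
by rewrite -(rng_inv b) gpd_mul_rng.
Qed.

Lemma tact_tag g w : tag (tact g w) = gact (tag w) g^-1%g.
Proof. by []. Qed.

Lemma tagged_tact0 g w : (tagged (tact g w) == 0) = (tagged w == 0).
Proof. by rewrite -normr_eq0 bact_norm normr_eq0. Qed.

Section Good.
Variable K : subgroup G.

Definition gorbit_of x : gorbits alpha K := (\pi_(gorbits alpha K) x)%qT.
Definition forbit_of w : forbits alpha K := (\pi_(forbits alpha K) w)%qT.
Local Notation gpi := gorbit_of.
Local Notation fpi := forbit_of.

Lemma gorbit_eqP x y : gpi x = gpi y <-> exists2 h, sg_set K h & y = gact x h.
Proof.
split=> [/eqP|H]; first by rewrite eqmodE => /asboolP.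
by apply/eqP; rewrite eqmodE; apply/asboolP.
Qed.

Lemma forbit_eqP w w' : fpi w = fpi w' <-> exists2 h, sg_set K h & w' = tact h w.
Proof.
split=> [/eqP|H]; first by rewrite eqmodE => /asboolP.
by apply/eqP; rewrite eqmodE; apply/asboolP.
Qed.

Lemma gorbit_repr (o : gorbits alpha K) : gpi (repr o) = o. Proof. exact: reprK. Qed.
Lemma forbit_repr (o : forbits alpha K) : fpi (repr o) = o. Proof. exact: reprK. Qed.

Lemma gpi_tact h w : sg_set K h -> gpi (tag (tact h w)) = gpi (tag w).
Proof. by move=> Kh; apply/esym/gorbit_eqP; exists h^-1%g => //; exact: sg_inv. Qed.

Lemma fpi_tact h w : sg_set K h -> fpi (tact h w) = fpi w.
Proof. by move=> Kh; apply/esym/forbit_eqP; exists h. Qed.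

Lemma gpi_fpi w w' : fpi w = fpi w' -> gpi (tag w) = gpi (tag w').
Proof. by move=> /forbit_eqP[h Kh ->]; rewrite gpi_tact. Qed.

Hypothesis good : good_action alpha K.

Lemma good_tact h w : sg_set K h -> tag (tact h w) = tag w -> tact h w = w.
Proof.
move=> Kh; rewrite tact_tag => e; case: w e => x a /= e.
have Kh' := sg_inv Kh.
have [_ /(_ a) ba] := good Kh' (etrans (esym (gact_src _ _ _)) (congr1 (@src X) e)).
have t : tact h^-1%g (Tagged fib a) = Tagged fib a by exact: ba.
by rewrite -[LHS]/(tact h (Tagged fib a)) -[in LHS]t -tactM mulgV tact1.
Qed.

Lemma fpi_inj w w' : fpi w = fpi w' -> tag w = tag w' -> w = w'.
Proof. by move=> /forbit_eqP[h Kh ->] e; rewrite good_tact. Qed.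

Lemma gpi_src_inj x y : gpi x = gpi y -> src x = src y -> x = y.
Proof.
by move=> /gorbit_eqP[h Kh ->]; rewrite gact_src => /esym /(good Kh)[->].
Qed.

Lemma gpi_rng_inj x y : gpi x = gpi y -> rng x = rng y -> x = y.
Proof.
move=> /gorbit_eqP[h Kh ->]; rewrite gact_rng -src_inv => /esym /(good Kh)[e _].
by rewrite -[LHS]gpd_invK -e gact_inv gpd_invK.
Qed.

Definition orbit_finite s := finite_set (gpi @` [set x | s x != 0]).

(** Goodness leaves at most one arrow of each orbit with a given source or range. *)
Lemma orbit_finite_locally s : orbit_finite s -> locally_finite s.
Proof.
move=> fo u; pose P (F : X -> X) := [set x | s x != 0 /\ F x = u].
have fin (F : X -> X) : (forall x y, gpi x = gpi y -> F x = F y -> x = y) -> finite_set (P F).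
  move=> inj; pose back o := xget (repr o) [set x | P F x /\ gpi x = o].
  apply: (@sub_finite_set _ _ (back @` (gpi @` [set x | s x != 0]))); last exact: finite_image.
  move=> x [nx ex]; exists (gpi x); first by exists x.
  rewrite /back; case: xgetP => [y _ [[_ ey] e]|/(_ x)]; last by case.
  by apply: inj => //; rewrite ex ey.
have : finite_set (P (@src X) `|` P (@rng X)).
  rewrite finite_setU; split; apply: fin.
    exact: gpi_src_inj.
  exact: gpi_rng_inj.
by apply: sub_finite_set => x [nx [e|e]]; [left|right].
Qed.

Definition sec_invariant s := forall h x, sg_set K h ->
  tact h (Tagged fib (s x)) = Tagged fib (s (gact x h^-1%g)).

(** s is the pullback of the section sg of the orbit bundle. *)
Definition lies_over s (sg : gorbits alpha K -> forbits alpha K) :=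
  forall x, fpi (Tagged fib (s x)) = sg (gpi x).

Lemma lies_over_eq s sg w : lies_over s sg -> fpi w = sg (gpi (tag w)) ->
  Tagged fib (s (tag w)) = w.
Proof. by move=> so e; apply: fpi_inj => //; rewrite so. Qed.

Lemma lies_over_invariant s sg : lies_over s sg -> sec_invariant s.
Proof.
move=> so h x Kh; apply/esym; set w := tact h _.
apply: (lies_over_eq (w := w) so); rewrite fpi_tact // gpi_tact //; exact: so.
Qed.

Lemma lies_over_exists sg : orbit_sections sg -> exists s, lies_over s sg.
Proof.
move=> [pr _].
have ex x : exists a : fib x, fpi (Tagged fib a) = sg (gpi x).
  have := pr (gpi x); rewrite /forbit_proj => /gorbit_eqP [h Kh e].
  set w := tact h^-1%g (repr (sg (gpi x))).
  have tw : tag w = x by rewrite tact_tag invgK.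
  have fw : fpi w = sg (gpi x) by rewrite fpi_tact ?forbit_repr //; exact: sg_inv.
  exists (in_fib x w); rewrite -fw; move: (w) tw => v <-.
  by rewrite in_fib_tag; case: v.
by exists (fun x => sval (cid (ex x))) => x; case: (cid (ex x)).
Qed.

Lemma lies_over_nonzero s sg x : lies_over s sg ->
  (tagged (repr (sg (gpi x))) == 0) = (s x == 0).
Proof.
move=> so; have /forbit_eqP[h Kh ->] : fpi (Tagged fib (s x)) = fpi (repr (sg (gpi x))).
  by rewrite so forbit_repr.
by rewrite tagged_tact0.
Qed.

Lemma lies_over_finite s sg : orbit_sections sg -> lies_over s sg -> orbit_finite s.
Proof.
move=> [_ fs] so; apply: sub_finite_set fs => _ [x nx <-] /=.
by rewrite (lies_over_nonzero _ so).
Qed.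

Lemma invariant_lies_over s : orbit_finite s -> sec_invariant s ->
  exists sg, orbit_sections sg /\ lies_over s sg.
Proof.
move=> fo si; pose sg (o : gorbits alpha K) : forbits alpha K := fpi (Tagged fib (s (repr o))).
have so : lies_over s sg.
  move=> x; rewrite /sg; have /gorbit_eqP[h Kh e] : gpi (repr (gpi x)) = gpi x.
    exact: gorbit_repr.
  have -> : x = gact (repr (gpi x)) h^-1^-1%g by rewrite invgK.
  by rewrite -si ?fpi_tact ?invgK -?e //; exact: sg_inv.
exists sg; split=> //; split=> [o|].
  rewrite /forbit_proj /sg -[RHS]gorbit_repr; apply: (gpi_fpi (w' := Tagged fib (s (repr o)))).
  exact: forbit_repr.
apply: sub_finite_set fo => o /= no; exists (repr o); last exact: gorbit_repr.
by rewrite /= -(lies_over_nonzero _ so) gorbit_repr.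
Qed.

Lemma orbit_mul_sum s sg o w (S : set X) : lies_over s sg -> orbit_sections sg ->
  finite_set S -> (forall x, s x != 0 -> src x = rng (tag w) -> S x) ->
  orbit_mul alpha K (repr (sg o)) w =
  \sum_(x <- fset_set S | gpi x == o) Cc_mul (delta_at s x) (Cc_delta w).
Proof.
move=> so [pr _] fS HS; set u := repr (sg o).
have gu : gpi (tag u) = o by exact: pr.
rewrite /orbit_mul; case: pselect => [e|ne]; last first.
  rewrite big1 // => x /eqP xo; rewrite Cc_mul_delta /=; case: eqP => // sx.
  case: ne; have /gorbit_eqP[h Kh xe] : gpi (tag u) = gpi x by rewrite gu xo.
  by exists h; split=> //; rewrite -gact_src -xe.
case: (cid e) => h /= [Kh he]; set v := tact h^-1%g u.
have Kh' := sg_inv Kh.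
have gv : gpi (tag v) = o by rewrite gpi_tact.
have sv : Tagged fib (s (tag v)) = v.
  by apply: (lies_over_eq (w := v) so); rewrite fpi_tact // gv /u forbit_repr.
have rv : src (tag v) = rng (tag w) by rewrite tact_tag gact_src invgK.
have only x : gpi x = o -> src x = rng (tag w) -> x = tag v.
  by move=> xo xw; apply: gpi_src_inj; rewrite ?xo ?gv ?xw ?rv.
have zero x : x != tag v -> gpi x == o -> Cc_mul (delta_at s x) (Cc_delta w) = 0.
  move=> nx /eqP xo; rewrite Cc_mul_delta /=; case: eqP => // sx.
  by case/eqP: nx; exact: only.
have val : Cc_mul (delta_at s (tag v)) (Cc_delta w) = Cc_delta (tmul v w).
  by rewrite /delta_at sv Cc_mul_delta rv eqxx.
have [vS|nvS] := boolP (tag v \in fset_set S).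
  rewrite big_mkcond (bigD1_seq (tag v) vS (fset_uniq _)) /= gv eqxx val big1 ?addr0 //.
  by move=> x xv; case: ifP => // xo; exact: zero.
rewrite big_seq_cond big1 => [|x /andP[xS xo]]; last first.
  by apply: zero => //; apply: contraNneq nvS => <-.
rewrite -val delta_at0 ?Cc_mul0l //; apply/eqP/negPn/negP => nv; case/negP: nvS.
by rewrite in_fset_set //; apply: mem_set; exact: HS.
Qed.

Lemma orbit_op_sec s sg : lies_over s sg -> orbit_sections sg ->
  orbit_op sg = sec_op s.
Proof.
move=> so os; have fo := lies_over_finite os so; have ls := orbit_finite_locally fo.
apply/funext => f; have fS := sec_supp_finite f ls; set S := sec_supp s f in fS.
have genE o : orbit_gen alpha K (repr (sg o)) f =
    \sum_(x <- fset_set S | gpi x == o) Cc_mul (delta_at s x) f.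
  rewrite /orbit_gen (fsumTE (Cc_finite f)) => [|y /= /negP]; last first.
    by rewrite negbK => /eqP ->; exact: orbit_mul0.
  rewrite [in RHS](Cc_expand f).
  under [RHS]eq_bigr do rewrite Cc_mul_sumr.
  rewrite [RHS]exchange_big /= big_seq [RHS]big_seq; apply: eq_bigr => y.
  rewrite in_fset_set; last exact: Cc_finite.
  move=> /set_mem /= ny; apply: (orbit_mul_sum o so os fS) => x nx sx.
  by split=> //; exists y.
rewrite /orbit_op (sec_opE fS) //.
have fO : finite_set (gpi @` S) by exact: finite_image.
rewrite (fsumTE fO) => [|o no]; last first.
  rewrite genE big_seq_cond big1 // => x /andP[]; rewrite in_fset_set // => /set_mem xS /eqP xo.
  by case: no; exists x.
rewrite fset_set_image // (partition_big_imfset _ (fun x => gpi x)) /=.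
by apply: eq_bigr => o _; exact: genE.
Qed.

(** Membership in the algebra of an orbit bundle becomes two conditions, finiteness
    of the support modulo the group and invariance, which can be compared for
    different groups and are stable under the operations. *)
Lemma Cc_orbitP T : Cc_orbit alpha K T <->
  exists s, [/\ orbit_finite s, sec_invariant s & T = sec_op s].
Proof.
split=> [[sg os <-]|[s [fo si ->]]].
  have [s so] := lies_over_exists os; exists s; split; last exact: orbit_op_sec.
    exact: lies_over_finite so.
  exact: lies_over_invariant so.
have [sg [os so]] := invariant_lies_over fo si.
by exists sg => //; exact: orbit_op_sec.
Qed.

End Good.
End Orbits.

(** * The crossed product as an algebra of equivariant functions *)

Section ActOnSections.
Variables (R : realType) (G : groupType) (X : groupoid) (A : Fell_bundle R X).
Variable alpha : Fell_action G A.
Local Notation fib := (fib A).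
Local Notation Cc := (Cc A).
Local Notation gact := (gact alpha).
Local Notation tact := (tact alpha).
Local Notation mact := (mult_act alpha).
Implicit Types (x y z : X) (g h : G) (w : total_space A) (s : sections A) (f : Cc).

Lemma act_sec_tagged g s x :
  Tagged fib (act_sec alpha g s x) = tact g (Tagged fib (s (gact x g))).
Proof.
have e : tag (tact g (Tagged fib (s (gact x g)))) = x by rewrite tact_tag gactK.
rewrite /act_sec -[Tagged fib (bact _ _ _)]/(tact g (Tagged fib (s (gact x g)))).
by move: (tact g _) e => v <-; rewrite in_fib_tag; case: v.
Qed.

Lemma act_sec_neq0 g s x : act_sec alpha g s x != 0 -> s (gact x g) != 0.
Proof.
apply: contra_neq => e; have := act_sec_tagged g s x.
by rewrite e /Defs.tact /= bact0 => h; rewrite /act_sec e bact0 in_fib0.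
Qed.

Lemma delta_at_act g s x :
  delta_at (act_sec alpha g s) x = Cc_act alpha g (delta_at s (gact x g)).
Proof. by rewrite /delta_at act_sec_tagged Cc_act_delta. Qed.

Lemma act_sec_locally_finite g s : locally_finite s -> locally_finite (act_sec alpha g s).
Proof.
move=> ls u; apply: (@sub_finite_set _ _ ((fun y => gact y g^-1%g) @`
  [set x | s x != 0 /\ (src x = gact u g \/ rng x = gact u g)])).
  move=> x [nx hx]; exists (gact x g); last exact: gactK.
  split; first exact: act_sec_neq0 nx.
  by rewrite gact_src gact_rng; case: hx => ->; [left|right].
exact: finite_image.
Qed.

Lemma mult_act_sec g s : locally_finite s ->
  mact g (sec_op s) = sec_op (act_sec alpha g s).
Proof.
move=> ls; apply/funext => f; rewrite /Defs.mult_act.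
set f' := Cc_act alpha g^-1%g f; have fS := sec_supp_finite f' ls.
rewrite (sec_opE fS) //; have -> (r : seq X) (F : X -> Cc) :
    Cc_act alpha g (\sum_(x <- r) F x) = \sum_(x <- r) Cc_act alpha g (F x).
  elim: r => [|x r IH]; first by rewrite !big_nil Cc_act0.
  by rewrite !big_cons Cc_actD IH.
rewrite -(fsumTE fS) => [|x /sec_supp0 ->]; last exact: Cc_act0.
have bj : bijective (gact ^~ g).
  by exists (gact ^~ g^-1%g) => x; [exact: gactK|exact: gactVK].
rewrite [LHS](reindex_fsbigT (gact ^~ g) _ bj); apply: eq_fsbigr => x _.
by rewrite Cc_act_mul -delta_at_act /f' Cc_actVK.
Qed.

Lemma sec_invariantP K s : locally_finite s ->
  sec_invariant alpha K s <-> forall k, sg_set K k -> mact k (sec_op s) = sec_op s.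
Proof.
move=> ls; split=> [si k Kk|mi k x Kk].
  rewrite mult_act_sec //; congr sec_op; apply: functional_extensionality_dep => x.
  have := act_sec_tagged k s x; rewrite si // gactK => /(congr1 (in_fib x)).
  by rewrite !in_fibE.
have := mi k Kk; rewrite mult_act_sec // => /sec_op_inj e.
rewrite -[in RHS]e //; last exact: act_sec_locally_finite.
by rewrite act_sec_tagged gactVK.
Qed.

(** The conjugate of k by g fixes a source only if k fixes its translate by g. *)
Lemma good_conj K (H : subgroup G) g : good_action alpha K ->
  (forall h, sg_set H h -> conj_set K g h) -> good_action alpha H.
Proof.
move=> gK HK x h /HK[k Kk <-] e.
have [e1 e2] : gact (gact x g) k = gact x g /\
    forall a : fib (gact x g), Tagged fib (bact alpha k a) = Tagged fib a.
  apply: gK => //; rewrite gact_src -gactM.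
  by rewrite -[in RHS]e -gactM mulgVK.
split; first by rewrite !gactM e1 gactK.
move=> a; rewrite -[LHS]/(tact (g * k * g^-1)%g (Tagged fib a)) !tactM.
have tt w : tag w = gact x g -> tact k w = w.
  move=> tw; have E : Tagged fib (in_fib (gact x g) w) = w by rewrite -tw in_fib_tag; case: w tw.
  by rewrite -E; exact: e2.
rewrite tt; first by rewrite -tactM mulgV tact1.
by rewrite tact_tag invgK.
Qed.

End ActOnSections.

Section CrossedProductAlgebra.
Variables (R : realType) (G : groupType) (X : groupoid) (A : Fell_bundle R X).
Variables (alpha : Fell_action G A) (Gam : subgroup G).
Hypothesis HP : Hecke_pair Gam.
Hypothesis good : good_action alpha Gam.
Local Notation C := R[i].
Local Notation Cc := (Cc A).
Local Notation cos := (lcoset_of Gam).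
Local Notation L := (lcosets Gam).
Local Notation gact := (gact alpha).
Local Notation mact := (mult_act alpha).
Local Notation gpi := (gorbit_of alpha Gam).
Local Notation "f1 ** f2" := (cp_mul alpha f1 f2) (at level 40, left associativity).
Local Notation stf := (cp_star alpha).
Local Notation incl := (cp_incl alpha (Gam := Gam)).
Local Notation H := (Hecke_algebra R Gam).
Local Notation emem := (emem alpha).
Implicit Types (f k : L -> Cc -> Cc) (S T : Cc -> Cc) (g h : G) (c d : L) (s : sections A).

Lemma orbit_locally_finite s : orbit_finite alpha Gam s -> locally_finite s.
Proof. exact: orbit_finite_locally. Qed.

Definition orbit_operator T := exists2 s, orbit_finite alpha Gam s & T = sec_op s.

Lemma orbit_operator_multiplier T : orbit_operator T -> multipliers T.
Proof. by move=> [s fo ->]; apply: sec_op_multiplier; exact: orbit_locally_finite fo. Qed.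

Lemma orbit_operator_lin (a : C) S T : orbit_operator S -> orbit_operator T ->
  orbit_operator (a *: S + T).
Proof.
move=> [s fs ->] [t ft ->]; exists (a *: s + t).
  have : finite_set (gpi @` [set x | s x != 0] `|` gpi @` [set x | t x != 0]).
    by rewrite finite_setU.
  apply: sub_finite_set => _ [x nx <-]; have [e|n] := eqVneq (s x) 0.
    right; exists x => //; apply: contra_neq nx => e'.
    by rewrite -[LHS]/(a *: s x + t x) e e' scaler0 addr0.
  by left; exists x.
by rewrite sec_op_lin //; exact: orbit_locally_finite.
Qed.

Lemma orbit_operator0 : orbit_operator 0.
Proof.
have f0 : orbit_finite alpha Gam (0 : sections A).
  rewrite /orbit_finite (_ : [set x | _] = set0) ?image_set0 //.
  by apply/seteqP; split=> // x /=; rewrite eqxx.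
exists 0 => //; apply/funext => f; rewrite /sec_op fsbig1 // => x _.
by rewrite delta_at0 // Cc_mul0l.
Qed.

Lemma orbit_operator_scale (a : C) T : orbit_operator T -> orbit_operator (a *: T).
Proof. by move=> oT; rewrite -[_ *: _]addr0; exact: orbit_operator_lin orbit_operator0. Qed.

Lemma orbit_operator_sum (I : eqType) (r : seq I) (F : I -> Cc -> Cc) :
  (forall i, i \in r -> orbit_operator (F i)) -> orbit_operator (\sum_(i <- r) F i).
Proof.
move=> HF; rewrite big_seq; elim/big_rec: _ => [|i T ir oT]; first exact: orbit_operator0.
by rewrite -[F i]scale1r; apply: orbit_operator_lin => //; exact: HF.
Qed.

Lemma orbit_operator_star T : orbit_operator T -> orbit_operator (mult_star T).
Proof.
move=> [s fs ->]; rewrite mult_star_sec; last exact: orbit_locally_finite fs.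
exists (star_sec s) => //.
apply: (@sub_finite_set _ _ ((fun o => gpi (gpd_inv (repr o))) @` (gpi @` [set x | s x != 0])));
  last exact: finite_image.
move=> _ [x nx <-]; exists (gpi (gpd_inv x)).
  by exists (gpd_inv x) => //=; apply: contra_neq nx; exact: star_sec_eq0.
have /gorbit_eqP[h Gh ->] := esym (gorbit_repr (gpi (gpd_inv x))).
rewrite -gact_inv gpd_invK; apply/esym/gorbit_eqP; by exists h.
Qed.

(** By goodness all products of composable pairs from two orbits lie in one orbit. *)
Lemma orbit_operator_comp S T : orbit_operator S -> orbit_operator T ->
  orbit_operator (S \o T).
Proof.
move=> [s fs ->] [t ft ->]; rewrite sec_op_mul; try exact: orbit_locally_finite.
exists (mul_sec s t) => //.
pose back (p : gorbits alpha Gam * gorbits alpha Gam) := xget p.1 [set o | exists x y,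
  [/\ src x = rng y, gpi x = p.1, gpi y = p.2 & o = gpi (gpd_mul x y)]].
apply: (@sub_finite_set _ _ (back @` ((gpi @` [set x | s x != 0]) `*` (gpi @` [set x | t x != 0])))).
  move=> _ [z nz <-]; have [x [y [nx ny xy xyz]]] := mul_sec_supp nz.
  exists (gpi x, gpi y); first by split; [exists x|exists y].
  rewrite /back; case: xgetP => [o _ /= [x' [y' [xy' ex ey ->]]]|/(_ (gpi z))]; last first.
    by case; exists x, y; rewrite xyz.
  have /gorbit_eqP[h Gh xh] := esym ex; have /gorbit_eqP[k Gk yk] := esym ey.
  rewrite -xyz; apply/gorbit_eqP; exists k^-1%g; first exact: sg_inv.
  rewrite gact_mul // xh yk gactK -gactM; congr gpd_mul.
  have Ghk : sg_set Gam (h * k^-1)%g by apply: sg_mul => //; exact: sg_inv.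
  have [//|-> _ //] := @good x _ Ghk.
  by rewrite gactM -gact_src -xh xy' yk gact_rng gactK.
by apply: finite_image; exact: finite_setX.
Qed.

(** Gam g^-1 is covered by finitely many left cosets, so that translation by g maps
    an orbit into finitely many ones. *)
Lemma orbit_operator_act g T : orbit_operator T -> orbit_operator (mact g T).
Proof.
move=> [s fs ->]; rewrite mult_act_sec; last exact: orbit_locally_finite fs.
exists (act_sec alpha g s) => //.
apply: (@sub_finite_set _ _ ((fun p : gorbits alpha Gam * L => gpi (gact (repr p.1) (repr p.2))) @`
  ((gpi @` [set x | s x != 0]) `*` (cos @` dcoset_set Gam g^-1%g)))); last first.
  by apply: finite_image; apply: finite_setX => //; have [] := HP g^-1%g.
move=> _ [x /act_sec_neq0 nx <-].
have /gorbit_eqP[h Gh e] := gorbit_repr (gpi (gact x g)).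
exists (gpi (gact x g), cos (h * g^-1)%g).
  split; first by exists (gact x g).
  exists (h * g^-1)%g => //; exists h, 1%g.
  by split=> //; [exact: sg_one|rewrite mulg1].
set k := ((h * g^-1)^-1 * repr (cos (h * g^-1)))%g.
have ek : repr (cos (h * g^-1)%g) = (h * g^-1 * k)%g by rewrite /k mulgA mulgV mul1g.
apply/esym/gorbit_eqP; exists k; first exact: repr_lcoset.
by rewrite /= ek !gactM -e gactK.
Qed.

Lemma good_sub (K : subgroup G) : (forall h, sg_set K h -> sg_set Gam h) ->
  good_action alpha K.
Proof. by move=> KG x h /KG; exact: good. Qed.

Lemma orbit_finite_sub (K : subgroup G) s : (forall h, sg_set K h -> sg_set Gam h) ->
  orbit_finite alpha K s -> orbit_finite alpha Gam s.
Proof.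
move=> KG fs; apply: (@sub_finite_set _ _ ((fun o => gpi (repr o)) @`
  (gorbit_of alpha K @` [set x | s x != 0]))); last exact: finite_image.
move=> _ [x nx <-]; exists (gorbit_of alpha K x); first by exists x.
have /gorbit_eqP[h Kh e] := gorbit_repr (gorbit_of alpha K x).
by apply/gorbit_eqP; exists h => //; exact: KG.
Qed.

(** An orbit of Gam splits into finitely many orbits of the intersection with a
    conjugate: that intersection is the stabilizer of a point of a finite Gam-set
    of left cosets. *)
Lemma orbit_finite_capconj g s : orbit_finite alpha Gam s ->
  orbit_finite alpha (capconj Gam g) s.
Proof.
move=> fs; pose rep c := xget 1%g [set h | sg_set Gam h /\ cos (h * g)%g = c].
apply: (@sub_finite_set _ _ ((fun p : gorbits alpha Gam * L =>
    gorbit_of alpha (capconj Gam g) (gact (repr p.1) (rep p.2))) @`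
  ((gpi @` [set x | s x != 0]) `*` (cos @` dcoset_set Gam g)))); last first.
  by apply: finite_image; apply: finite_setX => //; have [] := HP g.
move=> _ [x nx <-].
have /gorbit_eqP[h Gh e] := gorbit_repr (gpi x).
exists (gpi x, cos (h * g)%g).
  split; first by exists x.
  by exists (h * g)%g => //; exists h, 1%g; split=> //; [exact: sg_one|rewrite mulg1].
rewrite /= /rep; case: xgetP => [k _ [Gk ek]|/(_ h)]; last by case.
apply/esym/gorbit_eqP; exists (h^-1 * k)%g; last first.
  by rewrite [in RHS]e -gactM mulgA mulgV mul1g.
split; first by apply: sg_mul => //; exact: sg_inv.
have /lcoset_eqP m := esym ek; exists ((h * g)^-1 * (k * g))%g => //.
by rewrite invgM !mulgA mulgV mul1g mulgK.
Qed.

Lemma Cc_orbit_baseP T : Cc_orbit alpha Gam T <->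
  orbit_operator T /\ forall gam, sg_set Gam gam -> mact gam T = T.
Proof.
rewrite Cc_orbitP //; split=> [[s [fs si ->]]|[[s fs ->] iT]].
  by split; [exists s|apply/sec_invariantP => //; exact: orbit_locally_finite fs].
exists s; split=> //; apply/sec_invariantP => //; exact: orbit_locally_finite fs.
Qed.

Lemma capconj_sub g h : sg_set (capconj Gam g) h -> sg_set Gam h.
Proof. by case. Qed.

(** The group under which the value at g Gam has to be invariant fixes this coset, so
    that equivariance implies the invariance. *)
Lemma cp_memP f : cp_mem alpha f <-> emem f /\ forall c, orbit_operator (f c).
Proof.
split=> [[fin vf eq]|[[fin eq mf] vf]].
  have vf' c : orbit_operator (f c).
    rewrite -(lcoset_repr c).
    have /Cc_orbitP[|s [fs _ ->]] := vf (repr c); first exact: good_sub (@capconj_sub _).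
    by exists s => //; apply: orbit_finite_sub fs; exact: capconj_sub.
  by split=> //; split=> // c; exact: orbit_operator_multiplier.
split=> // g; have gg : good_action alpha (capconj Gam g) by exact: good_sub (@capconj_sub _).
apply/Cc_orbitP => //; have [s fs e] := vf (cos g); exists s; split=> //.
  exact: orbit_finite_capconj.
apply/sec_invariantP; first exact: orbit_locally_finite fs.
move=> k [Gk [l Gl kl]]; rewrite -e -eq //; congr f.
by rewrite -kl -!mulgA mulVg mulg1 lcosetMr.
Qed.

Lemma cp_emem f : cp_mem alpha f -> emem f. Proof. by case/cp_memP. Qed.
Lemma cp_value f c : cp_mem alpha f -> orbit_operator (f c). Proof. by case/cp_memP. Qed.

Lemma cp_mem_lin (a : C) f k : cp_mem alpha f -> cp_mem alpha k -> cp_mem alpha (a *: f + k).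
Proof.
move=> /cp_memP[ef vf] /cp_memP[ek vk]; apply/cp_memP; split; first exact: emem_lin.
by move=> c; exact: orbit_operator_lin.
Qed.

Lemma cp_mem_mul f k : cp_mem alpha f -> cp_mem alpha k -> cp_mem alpha (f ** k).
Proof.
move=> /cp_memP[ef vf] /cp_memP[ek vk]; apply/cp_memP; split; first exact: emem_mul.
move=> c; rewrite (cp_mul_sum _ _ _ (emem_fin ef)) => [|d /= /negP]; last first.
  by rewrite negbK => /eqP.
apply: orbit_operator_sum => d _; apply: orbit_operator_comp => //.
exact: orbit_operator_act.
Qed.

Lemma cp_mem_star f : cp_mem alpha f -> cp_mem alpha (stf f).
Proof.
move=> /cp_memP[ef vf]; apply/cp_memP; split; first exact: emem_star.
move=> c; apply: orbit_operator_scale; apply: orbit_operator_star.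
exact: orbit_operator_act.
Qed.

Lemma cp_mem_incl T : Cc_orbit alpha Gam T -> cp_mem alpha (incl T).
Proof.
move=> /Cc_orbit_baseP[oT iT]; apply/cp_memP; split.
  by apply: emem_incl => //; exact: orbit_operator_multiplier.
move=> c; have [->|ne] := pselect (c = cos 1%g); first by rewrite cp_incl1.
by rewrite cp_incl0 //; exact: orbit_operator0.
Qed.

Lemma orbit_base_multiplier T : Cc_orbit alpha Gam T -> multipliers T.
Proof. by move=> /Cc_orbit_baseP[oT _]; exact: orbit_operator_multiplier. Qed.

Lemma cp_base_value f : cp_mem alpha f -> Cc_orbit alpha Gam (f (cos 1%g)).
Proof.
move=> cf; apply/Cc_orbit_baseP; split; first exact: cp_value.
move=> gam Gg; have [_ eq _] := cp_emem cf; by rewrite -eq // mulg1 -[gam]mul1g lcosetMr.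
Qed.

Lemma cp_mem_Heckel w f : sa_mem (w : H) -> cp_mem alpha f ->
  cp_mem alpha (Hecke_emb w ** f).
Proof.
move=> mw /cp_memP[ef vf]; have ew := emem_Hecke alpha HP mw.
apply/cp_memP; split; first exact: emem_mul.
move=> c; rewrite (cp_mul_sum _ _ _ (emem_fin ew)) => [|d /= /negP]; last first.
  by rewrite negbK => /eqP.
apply: orbit_operator_sum => d _.
rewrite -[_ \o _]/(w _ *: (translate alpha (repr d) f c)).
by apply: orbit_operator_scale; exact: orbit_operator_act.
Qed.

Lemma mult_act_restrict (U : set X) g :
  mact g (range_restrict U) = @range_restrict R X A [set y | U (gact y g)].
Proof.
have lQ V := @range_restrict_linear R X A V; apply/funext => f.
elim/Cc_ind: f => [|f k IHf IHk|w].
- by rewrite !linear0_fun //; exact: mult_act_linear.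
- by rewrite !linearD_fun ?IHf ?IHk //; exact: mult_act_linear.
rewrite /Defs.mult_act Cc_act_delta !range_restrict_delta tact_tag invgK gact_rng /=.
case: ifP => _; last exact: Cc_act0.
by rewrite -Cc_act_delta Cc_actVK.
Qed.

Definition invariant_set (U : set X) := forall gam x, sg_set Gam gam -> U (gact x gam) <-> U x.

Lemma mult_act_invariant (U : set X) gam : invariant_set U -> sg_set Gam gam ->
  mact gam (range_restrict U) = @range_restrict R X A U.
Proof.
move=> HU Gg; rewrite mult_act_restrict; congr range_restrict.
by apply/seteqP; split=> y /= /(HU _ _ Gg).
Qed.

Lemma emem_restrict (U : set X) : invariant_set U -> emem (incl (range_restrict U)).
Proof.
move=> HU; apply: emem_incl; first exact: range_restrict_multiplier.
by move=> gam; exact: mult_act_invariant.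
Qed.

Lemma cp_star_restrict (U : set X) : invariant_set U ->
  stf (incl (range_restrict U)) = incl (@range_restrict R X A U).
Proof.
move=> HU; rewrite cp_star_incl ?mult_star_range_restrict //.
  exact: range_restrict_multiplier.
by move=> gam; exact: mult_act_invariant.
Qed.

Lemma cp_mem_restrict (U : set X) f : invariant_set U -> cp_mem alpha f ->
  cp_mem alpha (incl (range_restrict U) ** f).
Proof.
move=> HU /cp_memP[ef vf]; apply/cp_memP; split.
  by apply: emem_mul => //; exact: emem_restrict.
move=> c; rewrite cp_mul_incll; last exact: emem_eqv ef.
have [s fs ->] := vf c; rewrite range_restrict_sec; last exact: orbit_locally_finite fs.
exists (sec_restrict U s) => //; apply: sub_finite_set fs => _ [x nx <-].
by exists x => //; exact: sec_restrict_supp nx.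
Qed.

Lemma orbit_base_lin (a : C) S T : Cc_orbit alpha Gam S -> Cc_orbit alpha Gam T ->
  Cc_orbit alpha Gam (a *: S + T).
Proof.
move=> /Cc_orbit_baseP[oS iS] /Cc_orbit_baseP[oT iT]; apply/Cc_orbit_baseP; split.
  exact: orbit_operator_lin.
by move=> gam Gg; rewrite mult_act_lin iS // iT.
Qed.

Lemma orbit_base0 : Cc_orbit alpha Gam 0.
Proof.
by apply/Cc_orbit_baseP; split=> [|gam _]; [exact: orbit_operator0|exact: mult_act0].
Qed.

Lemma orbit_base_star T : Cc_orbit alpha Gam T -> Cc_orbit alpha Gam (mult_star T).
Proof.
move=> cT; have /Cc_orbit_baseP[oT iT] := cT; apply/Cc_orbit_baseP; split.
  exact: orbit_operator_star.
by move=> gam Gg; rewrite -mult_star_act ?iT //; exact: orbit_base_multiplier.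
Qed.

Lemma orbit_base_comp S T : Cc_orbit alpha Gam S -> Cc_orbit alpha Gam T ->
  Cc_orbit alpha Gam (S \o T).
Proof.
move=> /Cc_orbit_baseP[oS iS] /Cc_orbit_baseP[oT iT]; apply/Cc_orbit_baseP; split.
  exact: orbit_operator_comp.
by move=> gam Gg; rewrite mult_act_comp iS // iT.
Qed.

(** ** The algebra of all orbit bundles *)

Lemma conj_cap_good (K : subgroup G) : conj_cap Gam K -> good_action alpha K.
Proof.
move=> [g0 [gs Ke]]; apply: (@good_conj _ _ _ _ alpha Gam _ g0) => // h Kh.
have : (K : set G) h by [].
by rewrite Ke => /(_ g0); apply; rewrite /= mem_head.
Qed.

Lemma star_subalgebra_DA : star_subalgebra (DA_set alpha Gam).
Proof.
have gens : [set T | exists K : subgroup G, conj_cap Gam K /\ Cc_orbit alpha K T] `<=`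
    @multipliers R X A.
  move=> T [K [cK]]; have gK := conj_cap_good cK => /(Cc_orbitP gK)[s [fs _ ->]].
  by apply: sec_op_multiplier; exact: orbit_finite_locally fs.
split.
- by move=> T; apply; split; [exact: star_subalgebra_multipliers|].
- by move=> D [[_ D0 _ _ _] _].
- by move=> c S T DS DT D HD; have [[_ _ Dl _ _] _] := HD; apply: Dl; [exact: DS|exact: DT].
- by move=> S T DS DT D HD; have [[_ _ _ Dc _] _] := HD; apply: Dc; [exact: DS|exact: DT].
- by move=> T DT D HD; have [[_ _ _ _ Ds] _] := HD; apply: Ds; exact: DT.
Qed.

Lemma DA_orbit (K : subgroup G) T : conj_cap Gam K -> Cc_orbit alpha K T -> DA_set alpha Gam T.
Proof. by move=> cK oT D [_]; apply; exists K. Qed.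

Lemma conj_set_id (g : G) : conj_set Gam 1%g g <-> sg_set Gam g.
Proof.
split=> [[h Gh <-]|Gg]; first by rewrite mul1g invg1 mulg1.
by exists g => //; rewrite mul1g invg1 mulg1.
Qed.

Lemma DA_capconj g T : Cc_orbit alpha (capconj Gam g) T -> DA_set alpha Gam T.
Proof.
apply: DA_orbit; exists 1%g, [:: g]; apply/seteqP; split=> [h [Gh ch] k /=|h Hh].
  by rewrite !inE => /orP[/eqP->|/eqP->] //; exact/conj_set_id.
split; last by apply: Hh; rewrite /= !inE eqxx orbT.
by apply/conj_set_id; apply: Hh; rewrite /= !inE eqxx.
Qed.

Lemma DA_base T : Cc_orbit alpha Gam T -> DA_set alpha Gam T.
Proof.
apply: DA_orbit; exists 1%g, [::]; apply/seteqP; split=> [h Gh k /=|h Hh].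
  by rewrite !inE => /eqP->; exact/conj_set_id.
by apply/conj_set_id; apply: Hh; rewrite /= !inE eqxx.
Qed.

Definition conj_subgroup (g : G) : subgroup G :=
  Subgroup (conj_set1 Gam g) (@conj_setM _ Gam g) (@conj_setV _ Gam g).

Lemma DA_act_base g T : Cc_orbit alpha Gam T -> DA_set alpha Gam (mact g T).
Proof.
move=> /Cc_orbit_baseP[[s fs ->] iT].
have ck : conj_cap Gam (conj_subgroup g).
  exists g, [::]; apply/seteqP; split=> [h Gh k /=|h Hh]; first by rewrite !inE => /eqP->.
  by apply: (Hh g); rewrite /= !inE.
have ls := orbit_locally_finite fs.
have gk := conj_cap_good ck; apply: (DA_orbit ck); apply/Cc_orbitP => //.
rewrite mult_act_sec //; exists (act_sec alpha g s); split=> //; last first.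
  apply/sec_invariantP; first exact: act_sec_locally_finite.
  move=> _ [gam Gg <-]; rewrite -mult_act_sec //.
  by rewrite -mult_actM mulgVK mult_actM iT.
apply: (@sub_finite_set _ _ ((fun o => gorbit_of alpha (conj_subgroup g) (gact (repr o) g^-1%g)) @`
  (gpi @` [set x | s x != 0]))); last exact: finite_image.
move=> _ [x /act_sec_neq0 nx <-]; exists (gpi (gact x g)); first by exists (gact x g).
have /gorbit_eqP[h Gh e] := gorbit_repr (gpi (gact x g)).
apply/gorbit_eqP; exists (g * h * g^-1)%g; first by exists h.
by rewrite !gactM gactVK -e gactK.
Qed.

(** Up to a modular factor the adjoint is a value of the function [stf f]. *)
Lemma DA_translate f h : cp_mem alpha f -> DA_set alpha Gam (translate alpha h f (cos 1%g)).
Proof.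
move=> cf; have ef := cp_emem cf; have [_ vs _] := cp_mem_star cf.
have [_ _ Dl _ Ds] := star_subalgebra_DA.
have m : multipliers (translate alpha h f (cos 1%g)).
  by apply: translate_mult; case: ef.
rewrite -(mult_starK m); apply: Ds.
have := DA_capconj (vs h); rewrite cp_starE // => DT.
set S := mult_star _ in DT *.
have -> : S = (Hecke_Delta Gam C h^-1%g)^-1 *: (Hecke_Delta Gam C h^-1%g *: S) + 0.
  by rewrite addr0 scalerA mulVf ?scale1r // gt_eqF // Delta_gt0.
by apply: Dl => //; case: star_subalgebra_DA.
Qed.

End CrossedProductAlgebra.

(** * Positive functionals on the crossed product *)

Section PositiveFunctionals.
Variables (R : realType) (G : groupType) (X : groupoid) (A : Fell_bundle R X).
Variables (alpha : Fell_action G A) (Gam : subgroup G).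
Hypothesis HP : Hecke_pair Gam.
Hypothesis good : good_action alpha Gam.
Local Notation C := R[i].
Local Notation Cc := (Cc A).
Local Notation cos := (lcoset_of Gam).
Local Notation L := (lcosets Gam).
Local Notation "f1 ** f2" := (cp_mul alpha f1 f2) (at level 40, left associativity).
Local Notation stf := (cp_star alpha).
Local Notation incl := (cp_incl alpha (Gam := Gam)).
Local Notation H := (Hecke_algebra R Gam).
Local Notation emem := (emem alpha).
Local Notation D := (cp_mem alpha (Gam := Gam)).
Implicit Types (f k : L -> Cc -> Cc) (T : Cc -> Cc) (om : (L -> Cc -> Cc) -> C).

Definition cp_functional om := [/\
  forall (c : C) f k, D f -> D k -> om (c *: f + k) = c * om f + om k,
  forall f, D f -> 0 <= om (stf f ** f) &
  forall f, D f -> om (stf f) = Num.conj (om f)].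

Definition cp_form om f k : C := om (stf k ** f).

Let De f : D f -> emem f. Proof. exact: cp_emem. Qed.
Let Dm f k : D f -> D k -> D (f ** k). Proof. exact: cp_mem_mul. Qed.
Let Ds f : D f -> D (stf f). Proof. exact: cp_mem_star. Qed.

Lemma cp_mem0 : D 0.
Proof.
apply/cp_memP => //; split; last by move=> c; exact: orbit_operator0.
split=> [|gam g _|c]; last exact: mult_zero.
  rewrite (_ : [set c | _] = set0) //.
  by apply/seteqP; split=> // x /=; rewrite eqxx.
by rewrite mult_act0.
Qed.

Lemma cp_form_psd om : cp_functional om -> psd_form D (cp_form om).
Proof.
move=> [oL oP oH]; split.
- exact: cp_mem0.
- by move=> c f k Df Dk; exact: cp_mem_lin.
- move=> c f k z Df Dk Dz; rewrite /cp_form cp_mul_linr ?oL //; try exact: Dm (Ds _) _.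
  by apply: De; exact: Ds.
- move=> f k Df Dk; rewrite /cp_form -oH; last exact: Dm (Ds _) _.
  have [ef ek] := (De Df, De Dk).
  by rewrite cp_star_mul ?cp_starK //; exact: emem_star.
- by move=> f Df; exact: oP.
Qed.

Lemma cp_form_adjoint om e f k : emem e -> D f -> D k ->
  cp_form om (e ** f) k = cp_form om f (stf e ** k).
Proof.
move=> ee Df Dk; have [ef ek] := (De Df, De Dk); have es := emem_star HP ee.
by rewrite /cp_form cp_star_mul // cp_starK // cp_mulA //; exact: emem_star.
Qed.

(** The quantitative form of the BG property: otherwise the direct sum of a
    sequence of forms on which an element of the Hecke algebra has growing norms
    would carry an unbounded pre-representation. *)
Lemma Hecke_uniform_bound : BG_star_algebra H -> forall w, sa_mem (w : H) ->
  exists2 M : R, 0 <= M & forall om f, cp_functional om -> D f ->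
    seminorm (cp_form om) (Hecke_emb w ** f) <= M * seminorm (cp_form om) f.
Proof.
move=> BG w mw; apply: contrapT => nM.
have ch n : exists p : ((L -> Cc -> Cc) -> C) * (L -> Cc -> Cc),
    [/\ cp_functional p.1, D p.2 &
      n%:R * seminorm (cp_form p.1) p.2 < seminorm (cp_form p.1) (Hecke_emb w ** p.2)].
  apply: contrapT => ne; apply: nM; exists n%:R => // om f oF Df.
  by rewrite leNgt; apply/negP => lt; apply: ne; exists (om, f).
have [p Hp] := choice ch.
pose V := nat -> L -> Cc -> Cc; pose s n := cp_form (p n).1.
have ps n : psd_form D (s n) by apply: cp_form_psd; case: (Hp n).
pose D' : set V := [set F | (forall n, D (F n)) /\ exists N, forall n, (N <= n)%N -> F n = 0].
pose S (F K : V) : C := \sum_(n \in [set: nat]) s n (F n) (K n).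
have s0l n k : D k -> s n 0 k = 0 by move=> Dk; exact: form_0l (ps n) _ Dk.
have SE (F K : V) N : D' K -> (forall n, (N <= n)%N -> F n = 0) ->
    S F K = \sum_(n <- fset_set `I_N) s n (F n) (K n).
  move=> [DK _] FN; apply: fsumTE => // n /negP; rewrite -leqNgt => /FN ->; exact: s0l.
have pS : psd_form D' S.
  split.
  - by split=> [n|]; [exact: cp_mem0|exists 0%N].
  - move=> c F K [DF [N FN]] [DK [N' KN]]; split=> [n|].
      exact: (psd_Dlin (ps n)).
    exists (maxn N N') => n; rewrite geq_max => /andP[n1 n2].
    by rewrite -[LHS]/(c *: F n + K n) FN // KN // scaler0 addr0.
  - move=> c F K Z [DF [N FN]] [DK [N' KN]] DZ.
    have m1 n : (maxn N N' <= n)%N -> F n = 0 by rewrite geq_max => /andP[/FN].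
    have m2 n : (maxn N N' <= n)%N -> K n = 0 by rewrite geq_max => /andP[_ /KN].
    rewrite (SE F Z (maxn N N')) // (SE K Z (maxn N N')) // (SE _ Z (maxn N N')) //; last first.
      by move=> n nN; rewrite -[LHS]/(c *: F n + K n) m1 // m2 // scaler0 addr0.
    rewrite mulr_sumr -big_split; apply: eq_bigr => n _; have [DZn _] := DZ.
    exact: (psd_linl (ps n)).
  - move=> F K [DF [N FN]] [DK [N' KN]].
    have m1 n : (maxn N N' <= n)%N -> F n = 0 by rewrite geq_max => /andP[/FN].
    have m2 n : (maxn N N' <= n)%N -> K n = 0 by rewrite geq_max => /andP[_ /KN].
    rewrite (SE F K (maxn N N')) ?(SE K F (maxn N N')) //; try by split; [|eexists; eassumption].
    rewrite rmorph_sum; apply: eq_bigr => n _; exact: (psd_herm (ps n)).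
  - move=> F DF; have [DFn [N FN]] := DF; rewrite (SE F F N) //.
    by apply: sumr_ge0 => n _; exact: (psd_ge0 (ps n)).
pose act (b : H) (F : V) : V := fun n => Hecke_emb b ** F n.
have eb b : @sa_mem R H b -> emem (Hecke_emb b) by exact: emem_Hecke.
have act0 b F n : @sa_mem R H b -> F n = 0 -> act b F n = 0.
  move=> mb F0; rewrite /act F0; have := cp_mul_linr (-1) 0 0 (eb b mb).
  by rewrite scaler0 addr0 scaleN1r addNr.
have Dact b F : @sa_mem R H b -> D' F -> D' (act b F).
  move=> mb [DF [N FN]]; split=> [n|]; first exact: cp_mem_Heckel.
  by exists N => n nN; apply: act0 => //; exact: FN.
have [||||||||//|W [pi [j [rep jn pij _ _]]]] :=
    form_representation (full := false) (B := H) (act := act) pS.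
- by move=> c b1 b2; exact: Hecke_mem_lin.
- by move=> b1 b2; exact: Hecke_mem_mul.
- by move=> b; exact: Hecke_mem_star.
- exact: Dact.
- by move=> b c F K mb DF DK; apply/funext => n; exact: cp_mul_linr (eb b mb).
- move=> b F K mb DF DK; have [DFn [N FN]] := DF.
  rewrite (SE (act b F) K N) // => [|n nN]; last by apply: act0 => //; exact: FN.
  rewrite (SE F (act (sa_star b) K) N) //; last by apply: Dact => //; exact: Hecke_mem_star.
  apply: eq_bigr => n _; rewrite /s cp_form_adjoint //; [|exact: eb|by case: DK].
  by rewrite -Hecke_emb_star.
- move=> c b1 b2 F m1 m2 DF; apply/funext => n; rewrite /act Hecke_emb_lin.
  by rewrite cp_mul_linl //; exact: eb.
- move=> b1 b2 F m1 m2 [DF _]; apply/funext => n; rewrite /act (Hecke_emb_mul alpha) //.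
  by rewrite cp_mulA //; [exact: eb|exact: eb|exact: De].
have [M HM] := BG W pi rep w mw.
pose n := Num.bound `|M|; have [oF Df lt] := Hp n.
have Mn : M <= n%:R.
  by apply: le_trans (ler_norm _) (ltW _); exact: archi_boundP.
pose F0 : V := fun m => if m == n then (p n).2 else 0.
have DF0 : D' F0.
  split=> [m|]; first by rewrite /F0; case: eqP => // _; exact: cp_mem0.
  by exists n.+1 => m nm; rewrite /F0 gtn_eqF.
have off m : m != n -> F0 m = 0 by rewrite /F0 => /negbTE ->.
have at_n : F0 n = (p n).2 by rewrite /F0 eqxx.
have normS (F : V) : D' F -> (forall m, m != n -> F m = 0) ->
    seminorm S F = seminorm (s n) (F n).
  move=> [DF _] Fo; rewrite /seminorm /S (fsumT1 (i := n)) // => m mn.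
  by rewrite (Fo m mn) s0l //; exact: cp_mem0.
have Da := Dact w F0 mw DF0.
have na : forall m, m != n -> act w F0 m = 0 by move=> m mn; apply: act0 => //; exact: off.
have := HM (j F0); rewrite pij // !jn // !normS // at_n /act at_n => le.
have := lt_le_trans lt le; rewrite ltNge => /negP; apply.
by apply: ler_wpM2r Mn; exact: seminorm_ge0.
Qed.

(** For a self-adjoint idempotent this is the Cauchy-Schwarz inequality. *)
Lemma restrict_contraction om U f : cp_functional om -> D f -> invariant_set alpha Gam U ->
  seminorm (cp_form om) (incl (range_restrict U) ** f) <= seminorm (cp_form om) f.
Proof.
move=> oF Df HU; have ps := cp_form_psd oF; have eQ := emem_restrict (A := A) HU.
have [ef Dq] := (De Df, cp_mem_restrict HP good HU Df).
set q := incl _ ** f in Dq *.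
have qq : incl (range_restrict U) ** q = q.
  rewrite /q cp_mulA //; congr (_ ** f).
  rewrite cp_mul_incll; last exact: emem_eqv eQ.
  apply/funext => c; have [->|ne] := pselect (c = cos 1%g).
    by rewrite !cp_incl1; apply/funext => x; exact: range_restrict_idem.
  by rewrite !cp_incl0 // compf0 //; exact: range_restrict_linear.
have e : cp_form om q q = cp_form om f q.
  by rewrite {1}/q cp_form_adjoint // cp_star_restrict // qq.
have := form_CS ps Df Dq; rewrite -e (form_diag ps Dq) cnorm_real ?sqr_ge0 //.
have := seminorm_ge0 (cp_form om) q; have := seminorm_ge0 (cp_form om) f.
by move: (seminorm _ q) (seminorm _ f) => a b b0 a0; rewrite expr2; nra.
Qed.

End PositiveFunctionals.

(** * Elementary generators of the crossed product *)

Section Generators.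
Variables (R : realType) (G : groupType) (X : groupoid) (A : Fell_bundle R X).
Variables (alpha : Fell_action G A) (Gam : subgroup G).
Hypothesis HP : Hecke_pair Gam.
Hypothesis good : good_action alpha Gam.
Hypothesis inter : intersection_property alpha Gam.
Local Notation C := R[i].
Local Notation fib := (fib A).
Local Notation Cc := (Cc A).
Local Notation cos := (lcoset_of Gam).
Local Notation dc := (dcoset_of Gam).
Local Notation L := (lcosets Gam).
Local Notation gact := (gact alpha).
Local Notation tact := (tact alpha).
Local Notation "f1 ** f2" := (cp_mul alpha f1 f2) (at level 40, left associativity).
Local Notation incl := (cp_incl alpha (Gam := Gam)).
Local Notation H := (Hecke_algebra R Gam).
Local Notation emem := (emem alpha).
Local Notation D := (cp_mem alpha (Gam := Gam)).
Local Notation gpi := (gorbit_of alpha Gam).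
Implicit Types (f k : L -> Cc -> Cc) (T : Cc -> Cc) (om : (L -> Cc -> Cc) -> C).
Implicit Types (x y z : X) (g h : G) (s : sections A).

Let De f : D f -> emem f. Proof. exact: cp_emem. Qed.

Lemma restrict_src_mul (U : set X) w (f : Cc) :
  Cc_mul (Cc_delta w) (range_restrict U f) =
  if `[< U (src (tag w)) >] then Cc_mul (Cc_delta w) f else 0.
Proof.
have lQ := @range_restrict_linear R X A U.
elim/Cc_ind: f => [|f k IHf IHk|v].
- by rewrite (linear0_fun lQ) Cc_mul0r if_same.
- by rewrite (linearD_fun _ _ lQ) !Cc_mulDr IHf IHk; case: ifP; rewrite ?addr0.
rewrite range_restrict_delta (fun_if (Cc_mul (Cc_delta w))) Cc_mul0r Cc_mul_delta.
by case: eqP => [->|_]; rewrite ?if_same.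
Qed.

Definition src_restrict (U : set X) s : sections A :=
  fun z => if `[< U (src z) >] then s z else 0.

Lemma sec_restrict_src (U : set X) s : locally_finite s ->
  sec_op s \o range_restrict U = sec_op (src_restrict U s).
Proof.
move=> ls; apply/funext => f /=; rewrite /sec_op; apply: eq_fsbigr => x _.
rewrite /delta_at restrict_src_mul /src_restrict /=.
by case: asboolP => // _; rewrite Cc_delta0 Cc_mul0l.
Qed.

(** The pullback of the element [a] at the orbit of x. *)
Lemma one_orbit_section x (a : fib x) : exists2 s, Cc_orbit alpha Gam (sec_op s) &
  [/\ locally_finite s,
      forall h, sg_set Gam h ->
        Tagged fib (s (gact x h)) = tact h^-1%g (Tagged fib a) &
      forall z, s z != 0 -> gpi z = gpi x].
Proof.
pose fpi := forbit_of alpha Gam.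
pose sg (o : gorbits alpha Gam) : forbits alpha Gam :=
  if o == gpi x then fpi (Tagged fib a) else fpi (Tagged fib (0 : fib (repr o))).
have rep0 y : tagged (repr (fpi (Tagged fib (0 : fib y)))) == 0.
  have /forbit_eqP[h Gh ->] := esym (forbit_repr (fpi (Tagged fib (0 : fib y)))).
  by rewrite tagged_tact0.
have os : orbit_sections sg.
  split=> [o|].
    rewrite /forbit_proj /sg; case: eqP => [->|_].
      by apply: (gpi_fpi (w' := Tagged fib a)); exact: forbit_repr.
    rewrite -[RHS]gorbit_repr; apply: (gpi_fpi (w' := Tagged fib (0 : fib (repr o)))).
    exact: forbit_repr.
  apply: (@sub_finite_set _ _ [set gpi x]); last exact: finite_set1.
  move=> o /= no; apply: contrapT => /eqP/negbTE ne; move: no.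
  by rewrite /sg ne rep0.
have [s so] := lies_over_exists os.
have ls := orbit_finite_locally good (lies_over_finite os so).
exists s.
  by exists sg => //; exact: orbit_op_sec so os.
split=> // [h Gh|z].
  have tw : tag (tact h^-1%g (Tagged fib a)) = gact x h by rewrite tact_tag invgK.
  have := lies_over_eq good (w := tact h^-1%g (Tagged fib a)) so; rewrite tw; apply.
  rewrite fpi_tact; last exact: sg_inv.
  have -> : gpi (gact x h) = gpi x by apply/esym/gorbit_eqP; exists h.
  by rewrite /sg eqxx.
have [//|/eqP/negbTE ne] := pselect (gpi z = gpi x).
by rewrite -(lies_over_nonzero z so) /sg ne rep0.
Qed.

Definition dcoset_ind (d : dcosets Gam) : dcosets Gam -> C := fun e => (e == d)%:R.

Lemma dcoset_ind_mem d : sa_mem (dcoset_ind d : H).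
Proof.
apply: (@sub_finite_set _ _ [set d]); last exact: finite_set1.
by move=> e /=; rewrite /dcoset_ind; case: (e =P d) => // _ /eqP.
Qed.

Definition elementary T d (U : set X) : L -> Cc -> Cc :=
  incl T ** (Hecke_emb (dcoset_ind d) ** incl (range_restrict U)).

Lemma elementaryE T d U g : multipliers T -> invariant_set alpha Gam U ->
  elementary T d U (cos g) =
  (dc g == d)%:R *: (T \o range_restrict [set y | U (gact y g)]).
Proof.
move=> mT HU; have eH := emem_Hecke alpha HP (dcoset_ind_mem d).
have eQ := emem_restrict (A := A) HU.
rewrite /elementary cp_mul_incll; last exact: emem_eqv (emem_mul eH eQ).
rewrite cp_mul_inclr //; last exact: range_restrict_linear.
rewrite mult_act_restrict Hecke_embE /dcoset_ind.
have [k Gk ->] : exists2 k, sg_set Gam k & repr (cos g) = (g * k)%g.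
  by exists (g^-1 * repr (cos g))%g; [exact: repr_lcoset|rewrite mulgA mulgV mul1g].
have -> : [set y | U (gact y (g * k)%g)] = [set y | U (gact y g)].
  by apply/seteqP; split=> y /=; rewrite gactM => /(HU _ _ Gk).
apply/funext => f /=; rewrite -[(_ *: id) _]/(_ *: _) -[RHS]/(_ *: _).
by have lT := mult_linear mT; rewrite -[X in T X]addr0 lT (linear0_fun lT) addr0.
Qed.

Lemma elementary_emem T d U : Cc_orbit alpha Gam T -> invariant_set alpha Gam U ->
  emem (elementary T d U).
Proof.
move=> oT HU; apply: emem_mul => //; first exact/De/cp_mem_incl.
apply: emem_mul => //; first exact/emem_Hecke/dcoset_ind_mem.
exact: emem_restrict.
Qed.

Definition orbit_part g s (o : gorbits alpha (capconj Gam g)) : sections A :=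
  fun z => if gorbit_of alpha (capconj Gam g) z == o then s z else 0.

(** T lives on the orbit of x under Gam, and U cuts it down to the arrows whose source
    lies in the orbit of s(x) under g Gam g^-1. By the intersection property these are
    the arrows of the orbit of x under the smaller group. *)
Lemma elementary_orbit_part g s x : sec_invariant alpha (capconj Gam g) s ->
  exists T U, [/\ Cc_orbit alpha Gam T, invariant_set alpha Gam U &
    elementary T (dc g) U (cos g) =
    sec_op (orbit_part (g := g) s (gorbit_of alpha (capconj Gam g) x))].
Proof.
move=> si; set K := capconj Gam g in si *.
have [t ot [lt tx t0]] := one_orbit_section (s x).
pose U : set X := [set y | exists2 k, sg_set Gam k & y = gact (gact (src x) g) k].
have HU : invariant_set alpha Gam U.
  move=> k y Gk; split=> -[l Gl].
    move=> e; exists (l * k^-1)%g; first by apply: sg_mul => //; exact: sg_inv.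
    by rewrite gactM -e gactK.
  by move=> ->; exists (l * k)%g; [exact: sg_mul|rewrite gactM].
exists (sec_op t), U; split=> //.
rewrite elementaryE //; last exact: orbit_base_multiplier ot.
rewrite eqxx scale1r sec_restrict_src //; congr sec_op.
have U'E y : U (gact y g) <-> exists2 k, conj_set Gam g k & y = gact (src x) k.
  split=> [[k Gk e]|[_ [k Gk <-] ->]].
    exists (g * k * g^-1)%g; first by exists k.
    by rewrite !gactM -e gactK.
  by exists k => //; rewrite !gactM gactVK.
apply: functional_extensionality_dep => z; rewrite /src_restrict /orbit_part.
have [zo|zo] := eqVneq.
  have /gorbit_eqP[k Kk ->] := esym zo.
  have [Gk ck] := Kk; rewrite (asboolT (P := U _)); last first.
    by apply/U'E; exists k => //; rewrite gact_src.
  have := tx k Gk; rewrite si; last exact: sg_inv.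
  by rewrite invgK => /(congr1 (in_fib (gact x k))); rewrite !in_fibE.
case: asboolP => // /U'E [k ck sz]; apply/eqP/negPn/negP => /t0 /esym /gorbit_eqP[h Gh zh].
have [l Kl sl] : [set gact (src x) a | a in capconj Gam g] (src z).
  rewrite -inter; last exact: src_src.
  by split; [exists h => //; rewrite zh gact_src|exists k].
case/eqP: zo; apply/esym/gorbit_eqP; exists l => //.
apply: (gpi_src_inj good); last by rewrite gact_src.
have [Gl _] := Kl; rewrite zh.
have -> : gpi (gact x h) = gpi x by apply/esym/gorbit_eqP; exists h.
by apply/gorbit_eqP; exists l.
Qed.

Lemma orbit_part_sum g s : orbit_finite alpha (capconj Gam g) s -> locally_finite s ->
  sec_op s = \sum_(o <- fset_set (gorbit_of alpha (capconj Gam g) @` [set x | s x != 0]))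
    sec_op (orbit_part (g := g) s o).
Proof.
set O := _ @` _ => fO ls; apply/funext => f.
have fS := sec_supp_finite f ls; set S := sec_supp s f in fS.
have sumE (r : seq (gorbits alpha (capconj Gam g))) (F : _ -> Cc -> Cc) :
    (\sum_(o <- r) F o) f = \sum_(o <- r) F o f.
  by elim: r => [|o r IH]; rewrite ?big_nil // !big_cons -IH.
rewrite sumE (sec_opE fS) //.
under [RHS]eq_bigr => o _.
  rewrite (sec_opE fS) => [|x [nx h]]; last first.
    by split=> //; apply: contra_neq nx => e; rewrite /orbit_part e if_same.
  over.
rewrite exchange_big /= big_seq [RHS]big_seq; apply: eq_bigr => x.
rewrite in_fset_set // => /set_mem [nx _].
have xO : gorbit_of alpha (capconj Gam g) x \in fset_set O.
  by rewrite in_fset_set //; apply: mem_set; exists x.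
rewrite (bigD1_seq _ xO (fset_uniq _)) /= big1 ?addr0 => [|o no].
  by rewrite /delta_at /orbit_part eqxx.
by rewrite /delta_at /orbit_part eq_sym (negbTE no) Cc_delta0 Cc_mul0l.
Qed.

(** ** Uniform bounds *)

Hypothesis BG : BG_star_algebra H.
Variable N : (Cc -> Cc) -> R.
Hypothesis N_ge0 : forall T, Cc_orbit alpha Gam T -> 0 <= N T.

Definition dominated om := forall T f, Cc_orbit alpha Gam T -> D f ->
  seminorm (cp_form alpha om) (incl T ** f) <= N T * seminorm (cp_form alpha om) f.

(** The bound must not depend on the functional, as the supremum over all
    representations has to be finite. Stability of the crossed product is part of
    the definition since the summands into which an element is decomposed are taken
    in the larger algebra. *)
Definition uniformly_bounded F := [/\ emem F, forall f, D f -> D (F ** f) &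
  exists2 M : R, 0 <= M & forall om f, cp_functional alpha om -> dominated om -> D f ->
    seminorm (cp_form alpha om) (F ** f) <= M * seminorm (cp_form alpha om) f].

Lemma emem0 : emem (0 : L -> Cc -> Cc).
Proof. exact: De (cp_mem0 HP good). Qed.

Lemma uniformly_bounded0 : uniformly_bounded 0.
Proof.
have z f : (0 : L -> Cc -> Cc) ** f = 0.
  have := cp_mul_linl (-1) f emem0 emem0.
  by rewrite scaler0 addr0 scaleN1r addNr.
split; first exact: emem0.
  by move=> f _; rewrite z; exact: cp_mem0.
exists 0 => // om f oF _ Df; rewrite z mul0r.
by rewrite (seminorm0 (cp_form_psd HP good oF)).
Qed.

Lemma uniformly_boundedD F K : uniformly_bounded F -> uniformly_bounded K ->
  uniformly_bounded (F + K).
Proof.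
move=> [eF DF [M M0 HM]] [eK DK [M' M0' HM']].
have z f : (F + K) ** f = F ** f + K ** f.
  by have := cp_mul_linl 1 f eF eK; rewrite !scale1r.
split; first by rewrite -[F]scale1r; exact: emem_lin.
  move=> f Df; rewrite z -[F ** f]scale1r; apply: cp_mem_lin => //; [exact: DF|exact: DK].
exists (M + M'); first exact: addr_ge0.
move=> om f oF dF Df; rewrite z mulrDl.
have ps := cp_form_psd HP good oF.
apply: le_trans (seminormD ps (DF _ Df) (DK _ Df)) _; apply: lerD; [exact: HM|exact: HM'].
Qed.

Lemma uniformly_bounded_sum (I : eqType) (r : seq I) (F : I -> L -> Cc -> Cc) :
  (forall i, i \in r -> uniformly_bounded (F i)) -> uniformly_bounded (\sum_(i <- r) F i).
Proof.
move=> HF; rewrite big_seq; elim/big_rec: _ => [|i T ir bT]; first exact: uniformly_bounded0.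
by apply: uniformly_boundedD => //; exact: HF.
Qed.

Lemma elementary_bounded T d U : Cc_orbit alpha Gam T -> invariant_set alpha Gam U ->
  uniformly_bounded (elementary T d U).
Proof.
move=> oT HU; have mH := dcoset_ind_mem d; have eH := emem_Hecke alpha HP mH.
have eQ := emem_restrict (A := A) HU; have eT := De (cp_mem_incl HP good oT).
have E f : D f -> elementary T d U ** f =
    incl T ** (Hecke_emb (dcoset_ind d) ** (incl (range_restrict U) ** f)).
  move=> Df; have ef := De Df; rewrite /elementary -!cp_mulA //; exact: emem_mul.
have D1 f (Df : D f) := cp_mem_restrict HP good HU Df.
have D2 f (Df : D f) := cp_mem_Heckel HP good mH (D1 f Df).
have [M M0 HM] := Hecke_uniform_bound HP good BG mH.
split; first exact: elementary_emem.
  move=> f Df; rewrite E //; apply: cp_mem_mul => //; [exact: cp_mem_incl|exact: D2].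
exists (N T * M); first by rewrite mulr_ge0 // N_ge0.
move=> om f oF dF Df; rewrite E // -mulrA.
apply: le_trans (dF _ _ oT (D2 _ Df)) _; apply: ler_wpM2l; first exact: N_ge0.
apply: le_trans (HM _ _ oF (D1 _ Df)) _; apply: ler_wpM2l => //.
exact: restrict_contraction.
Qed.

Let sum_at (I : Type) (r : seq I) (F : I -> L -> Cc -> Cc) c :
  (\sum_(i <- r) F i) c = \sum_(i <- r) F i c.
Proof. by elim: r => [|i r IH]; rewrite ?big_nil // !big_cons -IH. Qed.

Lemma double_coset_part F d : D F -> exists2 K, uniformly_bounded K &
  forall c, K c = if dc (repr c) == d then F c else 0.
Proof.
move=> DF; set g := repr d; have [_ vF eF] := DF.
have gK : good_action alpha (capconj Gam g).
  by apply: (good_sub good) => h [].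
have /(Cc_orbitP gK)[s [fs si sE]] := vF g.
have ls := orbit_finite_locally gK fs.
pose P (o : gorbits alpha (capconj Gam g)) (p : (Cc -> Cc) * set X) :=
  [/\ Cc_orbit alpha Gam p.1, invariant_set alpha Gam p.2 &
    elementary p.1 (dc g) p.2 (cos g) = sec_op (orbit_part (g := g) s o)].
have ch o : exists p, P o p.
  have [T [U [h1 h2 h3]]] := elementary_orbit_part (repr o) si.
  by exists (T, U); rewrite -[o]gorbit_repr.
have [p Hp] := choice ch.
have dg : dc g = d by exact: dcoset_repr.
pose K := \sum_(o <- fset_set (gorbit_of alpha (capconj Gam g) @` [set x | s x != 0]))
  elementary (p o).1 d (p o).2.
have bK : uniformly_bounded K.
  by apply: uniformly_bounded_sum => o _; have [h1 h2 _] := Hp o; exact: elementary_bounded.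
exists K => // c; have [eK _ _] := bK; case: eqP => [e|ne].
  have Kg : K (cos g) = F (cos g).
    rewrite sE (orbit_part_sum fs ls) /K sum_at; apply: eq_bigr => o _.
    by have [_ _ <-] := Hp o; rewrite dg.
  have [a [b [Ga Gb cE]]] : dcoset_set Gam g (repr c) by apply/dcoset_eqP; rewrite dg.
  by rewrite -(lcoset_repr c) cE lcosetMr // eF // -Kg; case: eK => _ + _; apply.
rewrite /K sum_at big1 // => o _; have [h1 h2 _] := Hp o.
rewrite -(lcoset_repr c) elementaryE //; last exact: orbit_base_multiplier h1.
by case: eqP => [/ne//|_]; rewrite scale0r.
Qed.

Lemma cp_uniformly_bounded F : D F -> uniformly_bounded F.
Proof.
move=> DF; have ch d : exists K, uniformly_bounded K /\
    forall c, K c = if dc (repr c) == d then F c else 0.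
  by have [K h1 h2] := double_coset_part d DF; exists K.
have [K HK] := choice ch; set ds := (fun c => dc (repr c)) @` [set c | F c != 0].
have fd : finite_set ds by apply: finite_image; case: (De DF).
have -> : F = \sum_(d <- fset_set ds) K d; last first.
  by apply: uniformly_bounded_sum => d _; case: (HK d).
apply/funext => c; rewrite sum_at; have [F0|nF] := eqVneq (F c) 0.
  by rewrite big1 // => d _; have [_ ->] := HK d; rewrite F0 if_same.
have cd : dc (repr c) \in fset_set ds.
  by rewrite in_fset_set //; apply: mem_set; exists c.
rewrite (bigD1_seq _ cd (fset_uniq _)) /= big1 ?addr0 => [|d nd].
  by have [_ ->] := HK (dc (repr c)); rewrite eqxx.
by have [_ ->] := HK d; rewrite eq_sym (negbTE nd).
Qed.

End Generators.

(** * Representations of the crossed product are uniformly bounded *)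

Section RepresentationBound.
Variables (R : realType) (G : groupType) (X : groupoid) (A : Fell_bundle R X).
Variables (alpha : Fell_action G A) (Gam : subgroup G).
Hypothesis HP : Hecke_pair Gam.
Hypothesis good : good_action alpha Gam.
Variable tau : (Cc A -> Cc A) -> R.
Hypothesis Ctau : Cstar_norm (B := DA alpha Gam) tau.
Local Notation C := R[i].
Local Notation Cc := (Cc A).
Local Notation L := (lcosets Gam).
Local Notation mact := (mult_act alpha).
Local Notation "f1 ** f2" := (cp_mul alpha f1 f2) (at level 40, left associativity).
Local Notation stf := (cp_star alpha).
Local Notation incl := (cp_incl alpha (Gam := Gam)).
Local Notation emem := (emem alpha).
Local Notation D := (cp_mem alpha (Gam := Gam)).
Local Notation DAs := (DA_set alpha Gam).
Local Notation orb := (Cc_orbit alpha Gam).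
Implicit Types (f k : L -> Cc -> Cc) (S T : Cc -> Cc) (g h : G).

Lemma tau_ge0 T : DAs T -> 0 <= tau T.
Proof. by case: Ctau => + _ _ _ _ => h /h[]. Qed.
Lemma tau_eq0 T : DAs T -> tau T = 0 -> T = 0.
Proof. by case: Ctau => + _ _ _ _ => h /h[]. Qed.
Lemma tauZ (c : C) T : DAs T -> tau (c *: T) = cnorm c * tau T.
Proof. by case: Ctau => _ + _ _ _; apply. Qed.
Lemma tauD S T : DAs S -> DAs T -> tau (S + T) <= tau S + tau T.
Proof. by case: Ctau => _ _ + _ _; apply. Qed.
Lemma tauM S T : DAs S -> DAs T -> tau (S \o T) <= tau S * tau T.
Proof. by case: Ctau => _ _ _ + _; apply. Qed.
Lemma tauC T : DAs T -> tau (mult_star T \o T) = tau T ^+ 2.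
Proof. by case: Ctau => _ _ _ _; apply. Qed.

Lemma DA0 : DAs 0.
Proof. by case: (star_subalgebra_DA good). Qed.
Lemma DA_lin (c : C) S T : DAs S -> DAs T -> DAs (c *: S + T).
Proof. by case: (star_subalgebra_DA good) => _ _ + _ _; apply. Qed.
Lemma DA_comp S T : DAs S -> DAs T -> DAs (S \o T).
Proof. by case: (star_subalgebra_DA good) => _ _ _ + _; apply. Qed.
Lemma DA_star T : DAs T -> DAs (mult_star T).
Proof. by case: (star_subalgebra_DA good) => _ _ _ _; apply. Qed.
Lemma DA_mult T : DAs T -> multipliers T.
Proof. by case: (star_subalgebra_DA good) => + _ _ _ _; apply. Qed.
Lemma DA_scale (c : C) T : DAs T -> DAs (c *: T).
Proof. by move=> dT; rewrite -[_ *: _]addr0; apply: DA_lin => //; exact: DA0. Qed.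

Lemma tau0 : tau 0 = 0.
Proof. by rewrite -(scale0r (0 : Cc -> Cc)) tauZ ?cnorm0 ?mul0r //; exact: DA0. Qed.

Lemma tau_star T : DAs T -> tau (mult_star T) = tau T.
Proof.
suff H S : DAs S -> tau S <= tau (mult_star S).
  move=> dT; apply/le_anti; rewrite (H T) // andbT.
  by have := H _ (DA_star dT); rewrite mult_starK //; exact: DA_mult.
move=> dS; have := tauM (DA_star dS) dS; rewrite tauC //.
have := tau_ge0 dS; have := tau_ge0 (DA_star dS).
by move: (tau S) (tau _) => a b b0 a0; rewrite expr2; nra.
Qed.

Definition squaring n T := iter n (fun S => S \o S) T.

Lemma squaring_orbit n T : orb T -> orb (squaring n T).
Proof. by move=> oT; elim: n => //= n IH; exact: orbit_base_comp. Qed.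

Lemma squaring_self n T : multipliers T -> mult_star T = T ->
  multipliers (squaring n T) /\ mult_star (squaring n T) = squaring n T.
Proof.
move=> mT sT; elim: n => //= n [mS sS]; split; first exact: mult_comp.
by rewrite mult_star_comp // sS.
Qed.

Lemma tau_squaring n T : orb T -> mult_star T = T -> tau (squaring n T) = tau T ^+ (2 ^ n).
Proof.
move=> oT sT; have mT := orbit_base_multiplier good oT.
elim: n => [|n IH]; first by rewrite expn0 expr1.
have [mS sS] := squaring_self n mT sT; have dS := DA_base (squaring_orbit n oT).
by rewrite /= -{1}sS (tauC dS) IH -exprM expnS mulnC.
Qed.

Lemma orbit_square T : orb T -> orb (mult_star T \o T) /\
  mult_star (mult_star T \o T) = mult_star T \o T.
Proof.
move=> oT; have mT := orbit_base_multiplier good oT; split.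
  by apply: orbit_base_comp => //; exact: orbit_base_star.
by rewrite mult_star_comp ?mult_starK //; exact: mult_starM.
Qed.

Section OneRepresentation.
Variables (V : inner_product_space R) (Phi : crossed_product alpha Gam -> V -> V).
Hypothesis rep : star_rep Phi.
Hypothesis cont : tau_continuous tau Phi.

Lemma rep_linear f : D f -> linear (Phi f).
Proof. by move=> Df; case: rep => _ [+ _ _ _] _ => h; case: (h f Df). Qed.
Lemma rep_lin (c : C) f k v : D f -> D k -> Phi (c *: f + k) v = c *: Phi f v + Phi k v.
Proof. by move=> Df Dk; case: rep => _ [_ + _ _] _; apply. Qed.
Lemma rep_mul f k v : D f -> D k -> Phi (f ** k) v = Phi f (Phi k v).
Proof. by move=> Df Dk; case: rep => _ [_ _ + _] _ => h; exact: (h f k Df Dk). Qed.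
Lemma rep_adj f v w : D f -> ips_dot V (Phi f v) w = ips_dot V v (Phi (stf f) w).
Proof. by move=> Df; case: rep => _ [_ _ _ +] _ => h; exact: (h f Df). Qed.

Lemma rep0 v : Phi 0 v = 0.
Proof.
have D0 := cp_mem0 HP good; have := rep_lin (-1) v D0 D0.
by rewrite scaler0 addr0 scaleN1r addNr.
Qed.

Lemma incl_lin (c : C) S T : incl (c *: S + T) = c *: incl S + incl T.
Proof.
apply/funext => d; rewrite -[RHS]/(c *: incl S d + incl T d).
have [->|ne] := pselect (d = lcoset_of Gam 1%g); first by rewrite !cp_incl1.
by rewrite !cp_incl0 // scaler0 addr0.
Qed.

Lemma incl_zero : incl 0 = 0.
Proof.
apply/funext => d; have [->|ne] := pselect (d = lcoset_of Gam 1%g); first by rewrite cp_incl1.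
by rewrite cp_incl0.
Qed.

Lemma incl_comp S T : multipliers S -> multipliers T ->
  (forall gam, sg_set Gam gam -> mact gam T = T) ->
  incl (S \o T) = incl S ** incl T.
Proof.
move=> mS mT iT; rewrite cp_mul_incll; last exact: emem_eqv (emem_incl mT iT).
apply/funext => d; have [->|ne] := pselect (d = lcoset_of Gam 1%g); first by rewrite !cp_incl1.
by rewrite !cp_incl0 // compf0 //; exact: mult_linear.
Qed.

Lemma rep_base_bound : exists2 K : R, 0 <= K & forall T v, orb T ->
  hnorm (Phi (incl T) v) <= K * tau T * hnorm v.
Proof.
have o0 := orbit_base0 good; have [d d0 Hd] := cont o0 ltr01.
have small S v : orb S -> tau S < d -> hnorm v <= 1 -> hnorm (Phi (incl S) v) <= 1.
  move=> oS lt v1; have := Hd S oS; rewrite subr0 => /(_ lt) /ltW.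
  move=> le; rewrite -lee_fin; apply: le_trans le.
  apply: ereal_sup_ubound; exists v => //.
  by rewrite incl_zero rep0 subr0.
have DT T : orb T -> D (incl T) by exact: cp_mem_incl.
have small' S v : orb S -> tau S < d -> hnorm (Phi (incl S) v) <= hnorm v.
  move=> oS lt; have lS := rep_linear (DT S oS); have [v0|v0] := eqVneq (hnorm v) 0.
    (* a vector of norm zero may be scaled at will *)
    rewrite v0 leNgt; apply/negP => x0; set x := hnorm _ in x0.
    have := small S ((2 / x)%:C%C *: v) oS lt.
    have r0 : 0 <= 2 / x by rewrite divr_ge0 // ltW.
    rewrite hnormZ v0 mulr0 -[_ *: v]addr0 lS (linear0_fun lS) addr0 hnormZ.
    by rewrite cnorm_real // -/x mulfVK ?gt_eqF // => /(_ ler01); rewrite leNgt ltr1n.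
  have p : 0 < hnorm v by rewrite lt_neqAle eq_sym v0 hnorm_ge0.
  have := small S ((hnorm v)^-1%:C%C *: v) oS lt.
  have r0 : 0 <= (hnorm v)^-1 by rewrite invr_ge0 hnorm_ge0.
  rewrite hnormZ cnorm_real // mulVf // => /(_ (lexx _)).
  rewrite -[_ *: v]addr0 lS (linear0_fun lS) addr0 hnormZ cnorm_real //.
  by rewrite mulrC ler_pdivrMr // mul1r.
exists (2 / d); first by rewrite divr_ge0 // ltW.
move=> T v oT; have dT := DA_base oT; have [t0|t0] := eqVneq (tau T) 0.
  rewrite (tau_eq0 dT t0) incl_zero rep0 tau0 mulr0 mul0r.
  by rewrite -(scale0r (0 : V)) hnormZ cnorm0 mul0r.
have tp : 0 < tau T by rewrite lt_neqAle eq_sym t0 tau_ge0.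
pose c : C := (d / (2 * tau T))%:C%C.
have c0 : 0 < d / (2 * tau T) by rewrite divr_gt0 // mulr_gt0.
have := small' (c *: T + 0) v; rewrite addr0.
have ocT : orb (c *: T) by rewrite -[_ *: _]addr0; exact: orbit_base_lin.
rewrite tauZ // cnorm_real; last exact: ltW.
have e : d / (2 * tau T) * tau T = d / 2 by field.
rewrite e => /(_ ocT); have -> : d / 2 < d by rewrite ltr_pdivrMr // ltr_pMr // ltr1n.
move=> /(_ isT); rewrite -[c *: T]addr0 incl_lin rep_lin; [|exact: DT|exact: DT].
rewrite incl_zero rep0 addr0 hnormZ cnorm_real; last exact: ltW.
move=> le; have q0 : 0 <= 2 / d * tau T by rewrite mulr_ge0 ?divr_ge0 // ltW.
apply: le_trans (ler_wpM2l q0 le); rewrite mulrA.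
have -> : 2 / d * tau T * (d / (2 * tau T)) = 1.
  by field; rewrite t0 gt_eqF.
by rewrite mul1r.
Qed.

Lemma rep_square_norm f v : D f ->
  hnorm (Phi f v) ^+ 2 <= hnorm (Phi (stf f ** f) v) * hnorm v.
Proof.
move=> Df; have Ds := cp_mem_star HP good Df.
have := hnorm_CS (Phi (stf f ** f) v) v; rewrite rep_mul // (rep_adj _ _ Ds).
by rewrite cp_starK ?hnorm_dot ?cnorm_real ?sqr_ge0 //; exact: cp_emem Df.
Qed.

(** Continuity gives the bound K tau for some constant K. On the powers h^(2^n) of
    h = T^* T, whose norms are the powers of tau h, the constant is lost. *)
Lemma rep_base_contractive T v : orb T -> hnorm (Phi (incl T) v) <= tau T * hnorm v.
Proof.
move=> oT; have mT := orbit_base_multiplier good oT.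
have [K K0 HK] := rep_base_bound; have [oh sh] := orbit_square oT.
set h := mult_star T \o T in oh sh; have mh := orbit_base_multiplier good oh.
have inv S : orb S -> forall gam, sg_set Gam gam -> mact gam S = S.
  by move=> /(Cc_orbit_baseP good)[].
have DT S : orb S -> D (incl S) by exact: cp_mem_incl.
have stE S : orb S -> stf (incl S) = incl (mult_star S).
  move=> oS; have mS := orbit_base_multiplier good oS.
  apply: (cp_star_incl HP mS); exact: inv.
set b := hnorm v; have b0 : 0 <= b by exact: hnorm_ge0.
have [bz|bn] := eqVneq b 0.
  by have := HK T v oT; rewrite -/b bz !mulr0.
have bp : 0 < b by rewrite lt_neqAle eq_sym bn.
pose x n := hnorm (Phi (incl (squaring n h)) v).
have x0 n : 0 <= x n by exact: hnorm_ge0.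
have step n : x n ^+ 2 <= x n.+1 * b.
  have os := squaring_orbit n oh; have [ms ss] := squaring_self n mh sh.
  have := rep_square_norm v (DT _ os); rewrite stE // ss -incl_comp //.
  exact: inv.
have claim n : x 0%N ^+ (2 ^ n) * b <= x n * b ^+ (2 ^ n).
  elim: n => [|n IH]; first by rewrite expn0 !expr1.
  have := lerXn2r 2 _ _ IH.
  rewrite !nnegrE !mulr_ge0 ?exprn_ge0 // => /(_ isT isT).
  rewrite !exprMn -!exprM mulnC -expnS => le.
  have := step n; move: le.
  have B0 : 0 <= b ^+ (2 ^ n.+1) by exact: exprn_ge0.
  move: (x 0%N ^+ _) (b ^+ (2 ^ n.+1)) B0 (x n) (x n.+1) => y B B0 z w le1 le2.
  have le3 : z ^+ 2 * B <= w * b * B by exact: ler_wpM2r.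
  have le4 := le_trans le1 le3.
  rewrite -(ler_pM2r bp); have -> : y * b * b = y * b ^+ 2 by ring.
  by have -> : w * B * b = w * b * B by ring.
have hb : x 0%N <= tau h * b.
  apply: (@le_of_pow2_le _ _ _ K); first by rewrite mulr_ge0 // tau_ge0 //; exact: DA_base.
  move=> n; rewrite -(ler_pM2r bp); apply: le_trans (claim n) _.
  have := HK (squaring n h) v (squaring_orbit n oh); rewrite tau_squaring // -/(x n) -/b.
  move=> le; apply: le_trans (ler_wpM2r (exprn_ge0 _ b0) le) _.
  by rewrite exprMn; rewrite le_eqVlt; apply/orP; left; apply/eqP; ring.
have := rep_square_norm v (DT _ oT); rewrite stE // -incl_comp //; last 2 first.
- exact: mult_starM.
- exact: inv.
rewrite -/h -/b => le; have {}le := le_trans le (ler_wpM2r b0 hb).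
rewrite -(@ler_pXn2r _ 2) ?nnegrE ?hnorm_ge0 ?mulr_ge0 ?tau_ge0 //; last exact: DA_base.
apply: le_trans le _; rewrite exprMn -(tauC (DA_base oT)) -/h.
by rewrite le_eqVlt; apply/orP; left; apply/eqP; ring.
Qed.

Variable v : V.

Definition vector_functional f : C := ips_dot V (Phi f v) v.

Lemma vector_form f k : D f -> D k ->
  cp_form alpha vector_functional f k = ips_dot V (Phi f v) (Phi k v).
Proof.
move=> Df Dk; have Ds := cp_mem_star HP good Dk.
rewrite /cp_form /vector_functional rep_mul // rep_adj // cp_starK //; exact: cp_emem Dk.
Qed.

Lemma vector_seminorm f : D f ->
  seminorm (cp_form alpha vector_functional) f = hnorm (Phi f v).
Proof. by move=> Df; rewrite /seminorm vector_form. Qed.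

Lemma vector_cp_functional : cp_functional alpha vector_functional.
Proof.
have ps := ips_psd V; split.
- move=> c f k Df Dk; rewrite /vector_functional rep_lin //.
  by rewrite (psd_linl ps).
- move=> f Df; rewrite -[X in 0 <= X]/(cp_form alpha vector_functional f f).
  by rewrite vector_form ?(psd_ge0 ps).
- move=> f Df; have Ds := cp_mem_star HP good Df.
  rewrite /vector_functional rep_adj // cp_starK //; last exact: cp_emem Df.
  by apply: (psd_herm ps).
Qed.

Lemma vector_dominated : dominated alpha tau vector_functional.
Proof.
move=> T f oT Df; have DT : D (incl T) by exact: cp_mem_incl.
rewrite !vector_seminorm //; last exact: cp_mem_mul.
by rewrite rep_mul //; exact: rep_base_contractive.
Qed.

End OneRepresentation.

Hypothesis inter : intersection_property alpha Gam.
Hypothesis BG : BG_star_algebra (Hecke_algebra R Gam).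

(** The vector functionals of Phi are dominated, so left multiplication by F^* has a
    bound M that does not depend on Phi; and the square of |Phi F v| is the inner
    product of Phi F^* Phi F v and v, at most M |Phi F v| |v|. *)
Lemma rep_uniform_bound F : D F -> exists2 M : R, 0 <= M &
  forall (V : inner_product_space R) (Phi : crossed_product alpha Gam -> V -> V),
    star_rep Phi -> tau_continuous tau Phi -> forall v, hnorm (Phi F v) <= M * hnorm v.
Proof.
move=> DF; have DS := cp_mem_star HP good DF.
have N0 T : orb T -> 0 <= tau T by move=> oT; apply: tau_ge0; exact: DA_base.
have [_ _ [M M0 HM]] := cp_uniformly_bounded HP good inter BG N0 DS.
exists M => // V Phi rep cont v.
have := HM _ F (vector_cp_functional rep v) (@vector_dominated _ _ rep cont v) DF.
rewrite !vector_seminorm //; last exact: cp_mem_mul.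
move=> le; have le2 := rep_square_norm rep v DF.
have {le2} le : hnorm (Phi F v) ^+ 2 <= M * hnorm (Phi F v) * hnorm v.
  by apply: le_trans le2 _; apply: ler_wpM2r le; exact: hnorm_ge0.
have [x0|xn] := eqVneq (hnorm (Phi F v)) 0.
  by rewrite x0 mulr_ge0 // hnorm_ge0.
have xp : 0 < hnorm (Phi F v) by rewrite lt_neqAle eq_sym xn hnorm_ge0.
rewrite -(ler_pM2r xp) -expr2; apply: le_trans le _.
by rewrite le_eqVlt; apply/orP; left; apply/eqP; ring.
Qed.

End RepresentationBound.

(** * States on the algebra of all orbit bundles *)

Lemma linearZ_fun (R : realType) (V W : lmodType R[i]) (T : V -> W) (c : R[i]) v :
  linear T -> T (c *: v) = c *: T v.
Proof. by move=> lT; have := lT c v 0; rewrite !addr0 (linear0_fun lT) addr0. Qed.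

Section States.
Variables (R : realType) (G : groupType) (X : groupoid) (A : Fell_bundle R X).
Variables (alpha : Fell_action G A) (Gam : subgroup G).
Hypothesis good : good_action alpha Gam.
Variable tau : (Cc A -> Cc A) -> R.
Hypothesis Ctau : Cstar_norm (B := DA alpha Gam) tau.
Local Notation C := R[i].
Local Notation Cc := (Cc A).
Local Notation DAs := (DA_set alpha Gam).
Implicit Types (S T : Cc -> Cc).
Hypothesis nontrivial : exists2 S, DAs S & S <> 0.

(** The identity is adjoined inside the multipliers, where it may already belong to
    the algebra. *)
Definition unitized : {pred (Cc -> Cc : lmodType C)} :=
  fun T => `[< exists (c : C) S, DAs S /\ T = c *: id + S >].

Lemma unitizedP T : reflect (exists (c : C) S, DAs S /\ T = c *: id + S) (T \in unitized).
Proof. exact: asboolP. Qed.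

Lemma unitized_submod : submod_closed unitized.
Proof.
split=> [|a T1 T2 /unitizedP[c1 [S1 [d1 ->]]] /unitizedP[c2 [S2 [d2 ->]]]].
  by apply/unitizedP; exists 0, 0; split; [exact: DA0|rewrite scale0r addr0].
apply/unitizedP; exists (a * c1 + c2), (a *: S1 + S2); split; first exact: DA_lin.
by rewrite scalerDr scalerDl !scalerA addrACA.
Qed.
HB.instance Definition _ := GRing.isSubmodClosed.Build C (Cc -> Cc) unitized
  (GRing.submod_closed_semi unitized_submod).

Record unitization := Unitization { un_val :> Cc -> Cc; _ : un_val \in unitized }.
HB.instance Definition _ := [isSub for un_val].
HB.instance Definition _ := [Choice of unitization by <:].
HB.instance Definition _ := [SubChoice_isSubLmodule of unitization by <:].
Implicit Types x y z : unitization.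

Lemma unitized_mult T : T \in unitized -> multipliers T.
Proof.
by move=> /unitizedP[c [S [dS ->]]]; apply: mult_lin; [exact: mult_id|exact: DA_mult dS].
Qed.

Lemma unitized_DA_comp T S : T \in unitized -> DAs S -> DAs (T \o S).
Proof.
move=> /unitizedP[c [S' [dS' ->]]] dS.
rewrite -[_ \o S]/(c *: S + (S' \o S)); apply: DA_lin => //; exact: DA_comp.
Qed.

Lemma unitized_DA T : DAs T -> T \in unitized.
Proof. by move=> dT; apply/unitizedP; exists 0, T; rewrite scale0r add0r. Qed.

Lemma unitized_id : (id : Cc -> Cc) \in unitized.
Proof. by apply/unitizedP; exists 1, 0; rewrite scale1r addr0; split=> //; exact: DA0. Qed.

Lemma unitized_comp S T : S \in unitized -> T \in unitized -> S \o T \in unitized.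
Proof.
move=> uS uT; have /unitizedP[c [T' [dT eT]]] := uT.
have /unitizedP[c' [S' [dS' eS]]] := uS.
apply/unitizedP; exists (c * c'), (c *: S' + (S \o T')); split.
  by apply: DA_lin => //; exact: unitized_DA_comp.
have lS := mult_linear (unitized_mult uS); apply/funext => f.
rewrite eT /= -[(c *: id + T') f]/(c *: f + T' f) lS {1}eS.
rewrite -[(_ + _) f in RHS]/((c * c') *: f + (c *: S' f + S (T' f))).
by rewrite -[(_ + _) f]/(c' *: f + S' f) scalerDr scalerA addrA.
Qed.

Lemma unitized_star T : T \in unitized -> mult_star T \in unitized.
Proof.
move=> /unitizedP[c [S [dS ->]]]; rewrite mult_star_lin; last exact: DA_mult dS.
  by rewrite mult_star_id; apply/unitizedP; exists (Num.conj c), (mult_star S); split=> //; exact: DA_star.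
exact: mult_id.
Qed.

Lemma un_valP x : un_val x \in unitized. Proof. by case: x. Qed.
Hint Resolve un_valP : core.

Definition un_one : unitization := Unitization unitized_id.
Definition un_mul x y : unitization := Unitization (unitized_comp (un_valP x) (un_valP y)).
Definition un_star x : unitization := Unitization (unitized_star (un_valP x)).

Lemma un_linear x : linear (un_val x).
Proof. exact/mult_linear/unitized_mult. Qed.

Lemma un_mulA : associative un_mul. Proof. by move=> x y z; exact: val_inj. Qed.
Lemma un_mul1 : left_id un_one un_mul. Proof. by move=> x; exact: val_inj. Qed.
Lemma un_1mul : right_id un_one un_mul. Proof. by move=> x; exact: val_inj. Qed.
Lemma un_mulDl : left_distributive un_mul +%R. Proof. by move=> x y z; exact: val_inj. Qed.
Lemma un_mulDr : right_distributive un_mul +%R.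
Proof.
by move=> x y z; apply: val_inj; apply/funext => f; exact: linearD_fun (un_linear x).
Qed.
Lemma un_one_neq0 : un_one != 0.
Proof.
apply/eqP => /(congr1 val) /= e; have [S _] := nontrivial; apply.
have -> : S = id \o S by [].
by rewrite e.
Qed.
HB.instance Definition _ := GRing.Zmodule_isNzRing.Build unitization
  un_mulA un_mul1 un_1mul un_mulDl un_mulDr un_one_neq0.
Lemma un_scaleAl (c : C) x y : c *: (x * y) = c *: x * y.
Proof. exact: val_inj. Qed.
HB.instance Definition _ := GRing.Lmodule_isLalgebra.Build C unitization un_scaleAl.
Lemma un_scaleAr (c : C) x y : c *: (x * y) = x * (c *: y).
Proof.
apply: val_inj; apply/funext => f; exact/esym/linearZ_fun/un_linear.
Qed.
HB.instance Definition _ := GRing.Lalgebra_isAlgebra.Build C unitization un_scaleAr.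

(** The operator norm of left multiplication on D(A), which extends tau and inherits
    the C*-identity. *)
Definition un_norm x : R :=
  sup [set tau (un_val x \o S) | S in [set S | DAs S /\ tau S <= 1]].

Let comp_DA x S : DAs S -> DAs (un_val x \o S). Proof. exact: unitized_DA_comp. Qed.

Lemma un_norm_has_sup x :
  has_sup [set tau (un_val x \o S) | S in [set S | DAs S /\ tau S <= 1]].
Proof.
split; first by exists (tau (un_val x \o 0)), 0 => //; split; [exact: DA0|by rewrite (tau0 good Ctau)].
have /unitizedP[c [T [dT e]]] := un_valP x.
exists (cnorm c + tau T) => _ [S [dS S1] <-].
rewrite e -[_ \o S]/(c *: S + (T \o S)).
have dc := DA_scale good c dS; have dc' := DA_comp good dT dS.
apply: (le_trans (tauD Ctau dc dc')); rewrite (tauZ Ctau) //; apply: lerD.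
  by rewrite ler_piMr // cnorm_ge0.
apply: (le_trans (tauM Ctau dT dS)); rewrite ler_piMr //; exact: (tau_ge0 Ctau).
Qed.

Lemma un_norm_ub x S : DAs S -> tau S <= 1 -> tau (un_val x \o S) <= un_norm x.
Proof.
by move=> dS S1; apply: ub_le_sup; [case: (un_norm_has_sup x)|exists S].
Qed.

Lemma un_norm_le x (B : R) : (forall S, DAs S -> tau S <= 1 -> tau (un_val x \o S) <= B) ->
  un_norm x <= B.
Proof.
move=> H; apply: ge_sup; first by case: (un_norm_has_sup x).
by move=> _ [S [dS S1] <-]; exact: H.
Qed.

Lemma un_norm_ge0 x : 0 <= un_norm x.
Proof.
have := un_norm_ub x (DA0 good); rewrite (tau0 good Ctau) => /(_ ler01).
apply: le_trans; apply: (tau_ge0 Ctau); apply: comp_DA; exact: DA0.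
Qed.

Lemma un_norm_bound x S : DAs S -> tau (un_val x \o S) <= un_norm x * tau S.
Proof.
move=> dS; have t0 := tau_ge0 Ctau dS; have [e|n] := eqVneq (tau S) 0.
  rewrite (tau_eq0 Ctau dS e) (compf0 (un_linear x)) (tau0 good Ctau) mulr0.
  by [].
have tp : 0 < tau S by rewrite lt_neqAle eq_sym n.
pose c : C := (tau S)^-1%:C%C; have i0 : 0 <= (tau S)^-1 by rewrite invr_ge0.
have := un_norm_ub x (DA_scale good c dS).
rewrite (tauZ Ctau) // cnorm_real // mulVf // => /(_ (lexx _)).
have -> : un_val x \o (c *: S) = c *: (un_val x \o S).
  by apply/funext => f; exact/linearZ_fun/un_linear.
rewrite (tauZ Ctau); last exact: comp_DA.
by rewrite cnorm_real // mulrC ler_pdivrMr.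
Qed.

Lemma un_normD x y : un_norm (x + y) <= un_norm x + un_norm y.
Proof.
apply: un_norm_le => S dS S1.
rewrite -[un_val (x + y) \o S]/((un_val x \o S) + (un_val y \o S)).
apply: (le_trans (tauD Ctau (comp_DA x dS) (comp_DA y dS))).
by apply: lerD; exact: un_norm_ub.
Qed.

Lemma un_normM x y : un_norm (x * y) <= un_norm x * un_norm y.
Proof.
apply: un_norm_le => S dS S1; rewrite -[un_val (x * y) \o S]/(un_val x \o (un_val y \o S)).
apply: (le_trans (un_norm_bound x (comp_DA y dS))); apply: ler_wpM2l; first exact: un_norm_ge0.
exact: un_norm_ub.
Qed.

Lemma un_normZ (c : C) x : un_norm (c *: x) = complex.Re `|c| * un_norm x.
Proof.
rewrite -/(cnorm c).
have le (a : C) z : un_norm (a *: z) <= cnorm a * un_norm z.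
  apply: un_norm_le => S dS S1.
  rewrite -[un_val (a *: z) \o S]/(a *: (un_val z \o S)) (tauZ Ctau); last exact: comp_DA.
  by apply: ler_wpM2l; [exact: cnorm_ge0|exact: un_norm_ub].
apply/le_anti; rewrite le /=; have [->|c0] := eqVneq c 0.
  by rewrite cnorm0 mul0r un_norm_ge0.
have := le c^-1 (c *: x); rewrite scalerA mulVf // scale1r => h.
have cp : 0 < cnorm c.
  by rewrite lt_neqAle cnorm_ge0 andbT eq_sym; apply: contra_neq c0; exact: cnorm_eq0.
rewrite mulrC -ler_pdivlMr //; apply: le_trans h _; rewrite mulrC ler_wpM2l ?un_norm_ge0 //.
have : cnorm c^-1 * cnorm c = 1 by rewrite -cnormM mulVf // /cnorm normr1.
by move=> e; rewrite -[leLHS]mulr1 -[X in _ * X](divff (lt0r_neq0 cp)) mulrA e mul1r.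
Qed.

Lemma un_normC x : un_norm (un_star x * x) = un_norm x ^+ 2.
Proof.
have half z : un_norm z ^+ 2 <= un_norm (un_star z * z).
  have b0 := un_norm_ge0 (un_star z * z).
  rewrite -(sqr_sqrtr b0) ler_pXn2r ?nnegrE ?sqrtr_ge0 ?un_norm_ge0 //.
  apply: un_norm_le => S dS S1; have dzS := comp_DA z dS.
  rewrite -(@ler_pXn2r _ 2) ?nnegrE ?sqrtr_ge0 ?(tau_ge0 Ctau) // sqr_sqrtr //.
  rewrite -(tauC Ctau dzS) mult_star_comp; last exact: DA_mult dS.
    rewrite -[_ \o _]/(mult_star S \o (un_val (un_star z * z) \o S)).
    have dsS := DA_star good dS.
    apply: (le_trans (tauM Ctau dsS (comp_DA _ dS))).
    have h := un_norm_ub (un_star z * z) dS S1.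
    rewrite (tau_star good Ctau dS); apply: le_trans h.
    by rewrite ler_piMl // (tau_ge0 Ctau) //; exact: comp_DA.
  exact: unitized_mult.
have starK z : un_star (un_star z) = z.
  by apply: val_inj; rewrite /= mult_starK //; exact: unitized_mult.
have le1 z : un_norm z <= un_norm (un_star z).
  have := le_trans (half z) (un_normM _ _); have := un_norm_ge0 z.
  have := un_norm_ge0 (un_star z).
  by move: (un_norm z) (un_norm _) => a b b0 a0; rewrite expr2; nra.
have e : un_norm (un_star x) = un_norm x.
  by apply/le_anti; rewrite le1 andbT; have := le1 (un_star x); rewrite starK.
apply/le_anti; rewrite half andbT.
by apply: le_trans (un_normM _ _) _; rewrite e expr2.
Qed.

Lemma un_norm1 : un_norm 1 = 1.
Proof.
have [S dS S0] := nontrivial; have e := un_normC 1.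
have s1 : un_star 1 = 1 by apply: val_inj; exact: mult_star_id.
have [n0|n0] := eqVneq (un_norm 1) 0.
  have := un_norm_bound 1 dS; rewrite n0 mul0r.
  have -> : un_val 1 \o S = S by [].
  by move=> le; case: S0; apply: (tau_eq0 Ctau dS); apply/le_anti; rewrite le (tau_ge0 Ctau).
by move: e; rewrite s1 mulr1 expr2 -[LHS]mulr1 => /(mulfI n0).
Qed.

Lemma un_norm_DA T (dT : DAs T) : un_norm (Unitization (unitized_DA dT)) = tau T.
Proof.
apply/le_anti/andP; split.
  apply: un_norm_le => S dS S1; apply: (le_trans (tauM Ctau dT dS)).
  by rewrite ler_piMr // (tau_ge0 Ctau).
have dS := DA_star good dT.
have := un_norm_bound (Unitization (unitized_DA dT)) dS => /=.
have := tauC Ctau dS; rewrite mult_starK ?(tau_star good Ctau dT); last exact: DA_mult dT.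
move=> ->; have := tau_ge0 Ctau dT; set y := un_norm _.
have := un_norm_ge0 (Unitization (unitized_DA dT)); rewrite -/y.
by move: (tau T) => t y0 t0; rewrite expr2; nra.
Qed.

Lemma DA_state T : DAs T -> T <> 0 -> exists phi : (Cc -> Cc) -> C,
  [/\ forall (c : C) S S', DAs S -> DAs S' -> phi (c *: S + S') = c * phi S + phi S',
      forall S, DAs S -> 0 <= phi (mult_star S \o S),
      forall S, DAs S -> phi (mult_star S) = Num.conj (phi S),
      forall S S', DAs S -> DAs S' ->
        phi (mult_star S \o (mult_star S' \o S') \o S) <=
        ((tau S') ^+ 2)%:C%C * phi (mult_star S \o S)
    & phi (mult_star T \o T) != 0].
Proof.
move=> dT T0.
pose u S (dS : DAs S) : unitization := Unitization (unitized_DA dS).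
have nT : un_norm (u T dT) != 0.
  by rewrite un_norm_DA; apply/eqP => /(tau_eq0 Ctau dT).
have stD x y : un_star (x + y) = un_star x + un_star y.
  by apply: val_inj; rewrite /= mult_starD //; exact: unitized_mult.
have stM x y : un_star (x * y) = un_star y * un_star x.
  by apply: val_inj; rewrite /= mult_star_comp //; exact: unitized_mult.
have stK z : un_star (un_star z) = z.
  by apply: val_inj; rewrite /= mult_starK //; exact: unitized_mult.
have stZ (c : C) x : un_star (c *: x) = Num.conj c *: un_star x.
  by apply: val_inj; rewrite /= mult_starZ //; exact: unitized_mult.
have [F [F1 F2 F3 F4 F5]] := state_exists stD stM stK stZ un_normD un_normM un_normZ
  un_normC un_norm1 nT.
exists (fun S => F (insubd 0 S)).
have ins S (dS : DAs S) : insubd (0 : unitization) S = u S dS.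
  by apply: val_inj; rewrite insubdK //; exact: unitized_DA.
split.
- move=> c S S' dS dS'; rewrite (ins _ (DA_lin good c dS dS')) (ins _ dS) (ins _ dS') -F1.
  by congr F; exact: val_inj.
- move=> S dS; rewrite (ins _ (DA_comp good (DA_star good dS) dS)).
  by rewrite (_ : u _ _ = un_star (u S dS) * u S dS) //; exact: val_inj.
- move=> S dS; rewrite (ins _ (DA_star good dS)) (ins _ dS) -F3.
  by congr F; exact: val_inj.
- move=> S S' dS dS'; have d1 := DA_comp good (DA_star good dS) dS.
  have d2 := DA_comp good (DA_comp good (DA_star good dS) (DA_comp good (DA_star good dS') dS')) dS.
  rewrite (ins _ d1) (ins _ d2) -(un_norm_DA dS').
  have := F4 (u S dS) (u S' dS').
  rewrite (_ : u _ d1 = un_star (u S dS) * u S dS); last exact: val_inj.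
  by rewrite (_ : u _ d2 = un_star (u S dS) * (un_star (u S' dS') * u S' dS') * u S dS) //;
    exact: val_inj.
- rewrite (ins _ (DA_comp good (DA_star good dT) dT)).
  by rewrite (_ : u _ _ = un_star (u T dT) * u T dT) //; exact: val_inj.
Qed.

End States.

(** * Representations from positive functionals *)

Section FunctionalRepresentation.
Variables (R : realType) (G : groupType) (X : groupoid) (A : Fell_bundle R X).
Variables (alpha : Fell_action G A) (Gam : subgroup G).
Hypothesis HP : Hecke_pair Gam.
Hypothesis good : good_action alpha Gam.
Hypothesis inter : intersection_property alpha Gam.
Hypothesis BG : BG_star_algebra (Hecke_algebra R Gam).
Variable tau : (Cc A -> Cc A) -> R.
Hypothesis Ctau : Cstar_norm (B := DA alpha Gam) tau.
Local Notation C := R[i].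
Local Notation Cc := (Cc A).
Local Notation cos := (lcoset_of Gam).
Local Notation L := (lcosets Gam).
Local Notation mact := (mult_act alpha).
Local Notation delta := (Hecke_Delta Gam C).
Local Notation "f1 ** f2" := (cp_mul alpha f1 f2) (at level 40, left associativity).
Local Notation stf := (cp_star alpha).
Local Notation incl := (cp_incl alpha (Gam := Gam)).
Local Notation D := (cp_mem alpha (Gam := Gam)).
Local Notation DAs := (DA_set alpha Gam).
Local Notation orb := (Cc_orbit alpha Gam).
Implicit Types (f k : L -> Cc -> Cc) (S T : Cc -> Cc) (g h : G).

Let De f : D f -> emem alpha f. Proof. exact: cp_emem. Qed.
Let Dm f k : D f -> D k -> D (f ** k). Proof. exact: cp_mem_mul. Qed.
Let Ds f : D f -> D (stf f). Proof. exact: cp_mem_star. Qed.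

(** By the uniform bounds left multiplication extends to the completion. *)
Lemma functional_representation om : cp_functional alpha om -> dominated alpha tau om ->
  exists (V : inner_product_space R) (Phi : crossed_product alpha Gam -> V -> V)
    (j : (L -> Cc -> Cc) -> V),
    [/\ star_rep Phi, tau_continuous tau Phi &
      forall F f, D F -> D f -> hnorm (Phi F (j f)) = seminorm (cp_form alpha om) (F ** f)].
Proof.
move=> oF dF; have ps := cp_form_psd HP good oF.
have N0 T : orb T -> 0 <= tau T by move=> oT; apply: (tau_ge0 Ctau); exact: DA_base.
have bd F : D F -> exists2 M : R, 0 <= M & forall f, D f ->
    seminorm (cp_form alpha om) (F ** f) <= M * seminorm (cp_form alpha om) f.
  move=> DF; have [_ _ [M M0 HM]] := cp_uniformly_bounded HP good inter BG N0 DF.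
  by exists M => // f Df; exact: HM.
have [|||||||||W [pi [j [rep jn pij cW bW]]]] :=
    @form_representation R _ D (cp_form alpha om) true (crossed_product alpha Gam)
      (fun F f => F ** f) ps.
- by move=> c b1 b2; exact: cp_mem_lin.
- by move=> b1 b2; exact: cp_mem_mul.
- by move=> b; exact: cp_mem_star.
- by move=> b x; exact: cp_mem_mul.
- by move=> b c x y Db Dx Dy; apply: cp_mul_linr; exact: De.
- by move=> b x y Db Dx Dy; apply: cp_form_adjoint => //; exact: De.
- by move=> c b1 b2 x D1 D2 Dx; apply: cp_mul_linl; exact: De.
- by move=> b1 b2 x D1 D2 Dx; rewrite -cp_mulA //; exact: De.
- by move=> _ b Db; exact: bd.
exists W, pi, j.
have srep : star_rep pi.
  split=> //; first exact: cW.
  by move=> b Db; have [M M0 HM] := bd b Db; exists M; exact: bW.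
split=> // [T oT e e0|F f DF Df]; last by rewrite pij // jn //; exact: Dm.
exists e => // S oS lt; have DT : D (incl T) by exact: cp_mem_incl.
have DS : D (incl S) by exact: cp_mem_incl.
have oST : orb (S - T) by rewrite addrC -scaleN1r; exact: orbit_base_lin.
have DST : D (incl (S - T)) by exact: cp_mem_incl.
rewrite /opnorm; apply: le_lt_trans (_ : ((tau (S - T))%:E < e%:E)%E); last by rewrite lte_fin.
apply: ge_ereal_sup => _ [v /= v1 <-]; rewrite lee_fin.
have -> : pi (incl S) v - pi (incl T) v = pi (incl (S - T)) v.
  rewrite addrC -scaleN1r -[in LHS](rep_lin srep) //.
  by rewrite -incl_lin scaleN1r addrC.
apply: (le_trans (bW _ (tau (S - T)) DST (N0 _ oST) _ v)).
  by move=> x Dx; exact: dF.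
by rewrite ler_piMr // N0.
Qed.

Hypothesis act_cont : forall g T, DAs T -> forall e : R, 0 < e -> exists2 d : R, 0 < d &
    forall S, DAs S -> tau (S - T) < d -> tau (mact g S - mact g T) < e.

Lemma tau_squaring_DA n T : DAs T -> mult_star T = T ->
  DAs (squaring n T) /\ tau (squaring n T) = tau T ^+ (2 ^ n).
Proof.
move=> dT sT; have mT := DA_mult good dT.
elim: n => [|n [dS IH]]; first by rewrite expn0 expr1.
have [mS sS] := squaring_self n mT sT; split; first exact: DA_comp.
by rewrite /= -{1}sS (tauC Ctau dS) IH -exprM expnS mulnC.
Qed.

Lemma mult_act_squaring g n T : mact g (squaring n T) = squaring n (mact g T).
Proof. by elim: n => //= n <-; rewrite mult_act_comp. Qed.

(** As for representations, repeated squaring removes the constant given by continuity. *)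
Lemma tau_act_le g T : orb T -> tau (mact g T) <= tau T.
Proof.
move=> oT; have [d d0 Hd] := act_cont g (DA0 good) ltr01.
have dA S : orb S -> DAs S by exact: DA_base.
have dG S : orb S -> DAs (mact g S) by exact: DA_act_base.
pose K := 2 / d; have K0 : 0 <= K by rewrite divr_ge0 // ltW.
have HK S : orb S -> tau (mact g S) <= K * tau S.
  move=> oS; have [t0|t0] := eqVneq (tau S) 0.
    by rewrite (tau_eq0 Ctau (dA S oS) t0) mult_act0 (tau0 good Ctau) mulr0.
  have tp : 0 < tau S by rewrite lt_neqAle eq_sym t0 (tau_ge0 Ctau) //; exact: dA.
  pose c : C := (d / (2 * tau S))%:C%C.
  have c0 : 0 < d / (2 * tau S) by rewrite divr_gt0 // mulr_gt0.
  have := Hd (c *: S); rewrite subr0 mult_act0 subr0 mult_actZ.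
  have cn : cnorm c = d / (2 * tau S) by rewrite cnorm_real // ltW.
  rewrite (tauZ Ctau _ (dA S oS)) (tauZ Ctau _ (dG S oS)) cn.
  have e : d / (2 * tau S) * tau S = d / 2 by field.
  rewrite e => /(_ (DA_scale good _ (dA S oS))).
  have -> : d / 2 < d by rewrite ltr_pdivrMr // ltr_pMr // ltr1n.
  move=> /(_ isT) /ltW le; have q0 : 0 <= K * tau S by rewrite mulr_ge0 // ltW.
  have := ler_wpM2l q0 le; rewrite mulr1; apply: le_trans; rewrite mulrA.
  have -> : K * tau S * (d / (2 * tau S)) = 1 by rewrite /K; field; rewrite t0 gt_eqF.
  by rewrite mul1r.
have [oh sh] := orbit_square good oT; set h := mult_star T \o T in oh sh.
have mh := orbit_base_multiplier good oh; have mT := orbit_base_multiplier good oT.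
have sgh : mult_star (mact g h) = mact g h by rewrite mult_star_act // sh.
have le n : tau (mact g h) ^+ (2 ^ n) <= K * tau h ^+ (2 ^ n).
  have [_ <-] := tau_squaring_DA n (dG _ oh) sgh.
  have [_ <-] := tau_squaring_DA n (dA _ oh) sh.
  by rewrite -mult_act_squaring; apply: HK; exact: squaring_orbit.
have := le_of_pow2_le (tau_ge0 Ctau (dA _ oh)) le.
rewrite /h mult_act_comp -mult_star_act // !(tauC Ctau) //; try exact: dA; try exact: dG.
by rewrite ler_pXn2r ?nnegrE ?(tau_ge0 Ctau) //; [exact: dG|exact: dA].
Qed.

Section Gns.
Variable phi : (Cc -> Cc) -> C.
Hypotheses (phi_lin : forall (c : C) S S', DAs S -> DAs S' ->
    phi (c *: S + S') = c * phi S + phi S')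
  (phi_ge0 : forall S, DAs S -> 0 <= phi (mult_star S \o S))
  (phi_star : forall S, DAs S -> phi (mult_star S) = Num.conj (phi S))
  (phi_bound : forall S S', DAs S -> DAs S' ->
     phi (mult_star S \o (mult_star S' \o S') \o S) <=
     ((tau S') ^+ 2)%:C%C * phi (mult_star S \o S)).

Definition base_functional f : C := phi (f (cos 1%g)).
Let y f (d : L) : Cc -> Cc := translate alpha (repr d) f (cos 1%g).

Let yD f d : D f -> DAs (y f d). Proof. exact: DA_translate. Qed.

(** The value at the base coset is a sum of products of elements of D(A), weighted by
    Delta; so positivity on D(A) passes to the crossed product. *)
Lemma base_product f k (S : set L) : D f -> D k -> finite_set S ->
  (forall d, ~ S d -> y k d = 0) ->
  (stf k ** f) (cos 1%g) =
  \sum_(d <- fset_set S) delta (repr d)^-1%g *: (mult_star (y k d) \o y f d).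
Proof.
move=> Df Dk fS HS.
have e d : stf k d = delta (repr d)^-1%g *: mult_star (y k d).
  by rewrite -{1}(lcoset_repr d) cp_starE //; exact: De.
rewrite (cp_mul_sum alpha f (cos 1%g) fS) => [|d /HS y0]; last first.
  by rewrite e y0 mult_star0 scaler0.
by apply: eq_bigr => d _; rewrite e.
Qed.

Lemma y_finite f : D f -> finite_set [set d | y f d != 0].
Proof.
move=> Df; have [fin _ _] := De (Ds Df); apply: sub_finite_set fin => d /=.
apply: contra_neq; rewrite -{1}(lcoset_repr d) (cp_starE HP _ (De Df)).
move=> /(congr1 (fun T => (delta (repr d)^-1%g)^-1 *: T)).
rewrite scaler0 scalerA mulVf ?scale1r ?deltaV // => /(congr1 (@mult_star R X A)).
by rewrite mult_star0 mult_starK //; exact: DA_mult (yD d Df).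
Qed.

Lemma phi0 : phi 0 = 0.
Proof.
by have := phi_lin (-1) (DA0 good) (DA0 good); rewrite scaler0 addr0 mulN1r addNr.
Qed.

Lemma phi_sum (I : eqType) (r : seq I) (c : I -> C) (F : I -> Cc -> Cc) :
  (forall i, DAs (F i)) ->
  phi (\sum_(i <- r) c i *: F i) = \sum_(i <- r) c i * phi (F i).
Proof.
move=> HF; suff [] : DAs (\sum_(i <- r) c i *: F i) /\
  phi (\sum_(i <- r) c i *: F i) = \sum_(i <- r) c i * phi (F i) by [].
elim: r => [|i r [dr IH]]; first by rewrite !big_nil; split; [exact: DA0|exact: phi0].
by rewrite !big_cons; split; [exact: DA_lin|rewrite phi_lin // IH].
Qed.

Lemma base_form f (S : set L) : D f -> finite_set S -> (forall d, ~ S d -> y f d = 0) ->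
  base_functional (stf f ** f) =
  \sum_(d <- fset_set S) delta (repr d)^-1%g * phi (mult_star (y f d) \o y f d).
Proof.
move=> Df fS HS; rewrite /base_functional (base_product Df Df fS HS) phi_sum // => d.
by apply: DA_comp => //; [exact: DA_star (yD d Df)|exact: yD].
Qed.

Lemma base_cp_functional : cp_functional alpha base_functional.
Proof.
have bD f : D f -> DAs (f (cos 1%g)) by move=> Df; exact: DA_base (cp_base_value HP good Df).
split.
- by move=> c f k Df Dk; rewrite -phi_lin; [|exact: bD|exact: bD].
- move=> f Df; rewrite (base_form Df (y_finite Df)); last first.
    by move=> d /= /negP; rewrite negbK => /eqP.
  apply: sumr_ge0 => d _; apply: mulr_ge0; first exact/ltW/Delta_gt0.
  by apply: phi_ge0; exact: yD.
- move=> f Df; rewrite /base_functional (cp_starE HP _ (De Df)).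
  by rewrite translate1 invg1 (Delta1 HP) scale1r phi_star //; exact: bD.
Qed.

Lemma base_dominated : dominated alpha tau base_functional.
Proof.
move=> T f oT Df; have DT := cp_mem_incl HP good oT; have DTf := Dm DT Df.
have ps := cp_form_psd HP good base_cp_functional.
have t0 := tau_ge0 Ctau (DA_base oT).
rewrite -(@ler_pXn2r _ 2) ?nnegrE ?mulr_ge0 ?seminorm_ge0 //.
rewrite exprMn -lecR -(form_diag ps DTf) [X in _ <= X]rmorphM.
rewrite -[X in _ <= _ * X](form_diag ps Df) /cp_form.
have fS := y_finite Df; set S := [set d | _] in fS.
have nS d : ~ S d -> y f d = 0 by move=> /negP; rewrite negbK => /eqP.
have yE d : y (incl T ** f) d = mact (repr d) T \o y f d.
  rewrite /y /translate cp_mul_incll; last exact: emem_eqv (De Df).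
  by rewrite mult_act_comp.
rewrite (base_form Df fS nS) (base_form DTf fS); last first.
  move=> d /nS y0; rewrite yE y0 compf0 //.
  by apply/mult_linear/mult_actP; exact: orbit_base_multiplier oT.
rewrite mulr_sumr; apply: ler_sum => d _; rewrite mulrCA.
apply: ler_wpM2l; first exact/ltW/Delta_gt0.
have dy := yD d Df; have dT := DA_act_base good (repr d) oT.
rewrite yE mult_star_comp; [|exact: DA_mult dT|exact: DA_mult dy].
apply: le_trans (phi_bound dy dT) _.
apply: ler_wpM2r; first exact: phi_ge0.
by rewrite lecR; apply: lerXn2r; rewrite ?nnegrE ?(tau_ge0 Ctau dT) //; exact: tau_act_le.
Qed.

End Gns.

Lemma cp_star_zero : stf (0 : L -> Cc -> Cc) = 0.
Proof.
apply/funext => d; rewrite /cp_star /=.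
by rewrite -[(0 : L -> Cc -> Cc) _]/(0 : Cc -> Cc) mult_act0 mult_star0 scaler0.
Qed.

(** Let k be the product of f and f^*. The value of k^* k at the base coset is a sum of
    squares, which a state of D(A) separates from zero unless k = 0. In the
    representation of that state Phi f does not kill the class of f^*. The same
    argument for f^* in place of k shows that k is not zero. *)
Lemma exists_faithful_vector f : D f -> f <> 0 ->
  exists (V : inner_product_space R) (Phi : crossed_product alpha Gam -> V -> V) (v : V),
    [/\ star_rep Phi, tau_continuous tau Phi & hnorm (Phi f v) != 0].
Proof.
have sep k : D k -> k <> 0 -> exists phi : (Cc -> Cc) -> C,
    [/\ cp_functional alpha (base_functional phi), dominated alpha tau (base_functional phi) &
      base_functional phi (stf k ** k) != 0].
  move=> Dk k0; have [d yd] : exists d : L, translate alpha (repr d) k (cos 1%g) <> 0.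
    apply: contrapT => ne; apply: k0; rewrite -(cp_starK HP (De Dk)).
    have -> : stf k = 0; last exact: cp_star_zero.
    apply/funext => d; rewrite -(lcoset_repr d) cp_starE //; last exact: De.
    have -> : translate alpha (repr d) k (cos 1%g) = 0.
      by apply: contrapT => h; apply: ne; exists d.
    by rewrite mult_star0 scaler0.
  have dy := DA_translate HP good (repr d) Dk.
  have [|phi [h1 h2 h3 h4 h5]] := @DA_state _ _ _ _ _ _ good _ Ctau _ _ dy yd.
    by exists (translate alpha (repr d) k (cos 1%g)).
  exists phi; split; [exact: base_cp_functional|exact: base_dominated|].
  have fS := y_finite Dk.
  rewrite (base_form h1 Dk fS); last by move=> e /= /negP; rewrite negbK => /eqP.
  rewrite psumr_neq0; last first.
    move=> e _; apply: mulr_ge0; first exact/ltW/Delta_gt0.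
    by apply: h2; exact: DA_translate.
  apply/hasP; exists d => /=.
    by rewrite in_fset_set //; apply: mem_set; apply/eqP.
  rewrite lt_def mulf_neq0 // ?deltaV //= mulr_ge0 //; first exact/ltW/Delta_gt0.
  by apply: h2.
move=> Df f0; have Dsf := Ds Df.
have om0 (om : (L -> Cc -> Cc) -> C) : cp_functional alpha om -> om 0 = 0.
  move=> [oL _ _]; have D0 := cp_mem0 HP good.
  by have := oL (-1) 0 0 D0 D0; rewrite scaler0 addr0 mulN1r addNr.
have sf0 : stf f <> 0.
  by move=> e; apply: f0; rewrite -(cp_starK HP (De Df)) e cp_star_zero.
have ff0 : f ** stf f <> 0.
  move=> e; have [phi [h1 _]] := sep _ Dsf sf0.
  by rewrite (cp_starK HP (De Df)) e om0 ?eqxx.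
have Dff := Dm Df Dsf; have [phi [h1 h2 h3]] := sep _ Dff ff0.
have [V [Phi [j [h4 h5 h6]]]] := functional_representation h1 h2.
exists V, Phi, (j (stf f)); split=> //; rewrite h6 //.
apply: contra_neq h3 => s0; have := form_diag (cp_form_psd HP good h1) Dff.
by rewrite s0 expr0n.
Qed.

End FunctionalRepresentation.

(** * The norm of the full crossed product *)

Section UniversalNorm.
Variables (R : realType) (G : groupType) (X : groupoid) (A : Fell_bundle R X).
Variables (alpha : Fell_action G A) (Gam : subgroup G).
Hypothesis HP : Hecke_pair Gam.
Hypothesis good : good_action alpha Gam.
Hypothesis inter : intersection_property alpha Gam.
Hypothesis BG : BG_star_algebra (Hecke_algebra R Gam).
Variable tau : (Cc A -> Cc A) -> R.
Hypothesis perm : permissible_Cstar_norm alpha Gam tau.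
Local Notation C := R[i].
Local Notation Cc := (Cc A).
Local Notation L := (lcosets Gam).
Local Notation "f1 ** f2" := (cp_mul alpha f1 f2) (at level 40, left associativity).
Local Notation stf := (cp_star alpha).
Local Notation CP := (crossed_product alpha Gam).
Local Notation D := (cp_mem alpha (Gam := Gam)).
Implicit Types (f k : CP).

Let Ctau : Cstar_norm (B := DA alpha Gam) tau. Proof. by case: perm. Qed.

Definition admissible_rep (V : inner_product_space R) (Phi : CP -> V -> V) :=
  star_rep Phi /\ tau_continuous tau Phi.

Local Notation nu := (fun f => fine (norm_tau_u tau f)).

Lemma opnorm_le (V : inner_product_space R) (T : V -> V) (M : R) : 0 <= M ->
  (forall v, hnorm (T v) <= M * hnorm v) -> (opnorm T <= M%:E)%E.
Proof.
move=> M0 HM; apply: ge_ereal_sup => _ [v /= v1 <-]; rewrite lee_fin.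
by apply: le_trans (HM v) _; rewrite ler_piMr.
Qed.

Lemma opnorm_ge0 (V : inner_product_space R) (T : V -> V) : (0 <= opnorm T)%E.
Proof.
apply: (@le_trans _ _ (hnorm (T 0))%:E); first by rewrite lee_fin hnorm_ge0.
apply: ereal_sup_ubound; exists 0 => //=.
by rewrite -(scale0r (0 : V)) hnormZ cnorm0 mul0r.
Qed.

Lemma rep_norm_le f (M : R) : 0 <= M ->
  (forall (V : inner_product_space R) (Phi : CP -> V -> V), admissible_rep Phi ->
     forall v, hnorm (Phi f v) <= M * hnorm v) ->
  (norm_tau_u tau f <= M%:E)%E.
Proof.
move=> M0 HM; apply: ge_ereal_sup => _ [V [Phi [h1 h2 ->]]]; apply: opnorm_le => //.
by apply: HM.
Qed.

Lemma exists_admissible_rep : exists (V : inner_product_space R) (Phi : CP -> V -> V),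
  admissible_rep Phi.
Proof.
pose om (f : L -> Cc -> Cc) : C := 0.
have oF : cp_functional alpha om.
  by split=> [c f k _ _|f _|f _]; rewrite /om ?mulr0 ?addr0 ?conjC0.
have dF : dominated alpha tau om.
  by move=> T f _ _; rewrite /seminorm /cp_form /om /= sqrtr0 mulr0.
have [V [Phi [j [h1 h2 _]]]] := functional_representation HP good inter BG Ctau oF dF.
by exists V, Phi.
Qed.

Lemma norm_tau_u_fin f : D f -> norm_tau_u tau f \is a fin_num.
Proof.
move=> Df; have [M M0 HM] := rep_uniform_bound HP good Ctau inter BG Df.
have [V [Phi [h1 h2]]] := exists_admissible_rep.
rewrite ge0_fin_numE.
  apply: (@le_lt_trans _ _ M%:E); last exact: ltry.
  by apply: rep_norm_le => // W Psi [k1 k2]; exact: HM.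
apply: (le_trans (opnorm_ge0 (Phi f))).
by apply: ereal_sup_ubound; exists V, Phi.
Qed.

Lemma nu_le f (M : R) : D f -> 0 <= M ->
  (forall (V : inner_product_space R) (Phi : CP -> V -> V), admissible_rep Phi ->
     forall v, hnorm (Phi f v) <= M * hnorm v) -> nu f <= M.
Proof.
move=> Df M0 HM; rewrite -lee_fin fineK; last exact: norm_tau_u_fin.
exact: rep_norm_le.
Qed.

Lemma nu_ge0 f : D f -> 0 <= nu f.
Proof.
move=> Df; rewrite -lee_fin fineK; last exact: norm_tau_u_fin.
have [V [Phi [h1 h2]]] := exists_admissible_rep.
apply: (le_trans (opnorm_ge0 (Phi f))).
by apply: ereal_sup_ubound; exists V, Phi.
Qed.

Section OneRep.
Variables (V : inner_product_space R) (Phi : CP -> V -> V).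
Hypothesis adm : admissible_rep Phi.

Lemma nu_bound f v : D f -> hnorm (Phi f v) <= nu f * hnorm v.
Proof.
move=> Df; have [h1 h2] := adm.
have [M M0 HM] := rep_uniform_bound HP good Ctau inter BG Df.
have le w : hnorm w <= 1 -> hnorm (Phi f w) <= nu f.
  move=> w1; rewrite -lee_fin fineK; last exact: norm_tau_u_fin.
  apply: (@le_trans _ _ (opnorm (Phi f))); apply: ereal_sup_ubound.
    by exists w.
  by exists V, Phi.
have [v0|v0] := eqVneq (hnorm v) 0.
  by have := HM V Phi h1 h2 v; rewrite v0 !mulr0.
have p : 0 < hnorm v by rewrite lt_neqAle eq_sym v0 hnorm_ge0.
have r0 : 0 <= (hnorm v)^-1 by rewrite invr_ge0 hnorm_ge0.
have := le ((hnorm v)^-1%:C%C *: v); rewrite hnormZ cnorm_real // mulVf // => /(_ (lexx _)).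
rewrite (linearZ_fun _ _ (rep_linear h1 Df)) hnormZ cnorm_real //.
by rewrite mulrC ler_pdivrMr.
Qed.

End OneRep.

Let Dlin (c : C) f k : D f -> D k -> D (c *: f + k). Proof. exact: cp_mem_lin. Qed.
Let Dm f k : D f -> D k -> D (f ** k). Proof. exact: cp_mem_mul. Qed.
Let Ds f : D f -> D (stf f). Proof. exact: cp_mem_star. Qed.
Let DZ (c : C) f : D f -> D (c *: f).
Proof. by move=> Df; rewrite -[_ *: _]addr0; apply: Dlin => //; exact: cp_mem0. Qed.
Let DD f k : D f -> D k -> D (f + k).
Proof. by move=> Df Dk; rewrite -[f]scale1r; exact: Dlin. Qed.

Lemma nu_eq0 f : D f -> nu f = 0 -> f = 0.
Proof.
move=> Df n0; apply: contrapT => f0.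
have [_ act_cont] := perm.
have [V [Phi [v [h1 h2 h3]]]] := exists_faithful_vector HP good inter BG Ctau act_cont Df f0.
have := @nu_bound V Phi (conj h1 h2) f v Df; rewrite n0 mul0r => le.
by case/eqP: h3; apply/le_anti; rewrite le hnorm_ge0.
Qed.

Lemma nu_scale_le (c : C) f : D f -> nu (c *: f) <= cnorm c * nu f.
Proof.
move=> Df; apply: nu_le; [exact: DZ|by rewrite mulr_ge0 ?cnorm_ge0 ?nu_ge0|].
move=> V Phi adm v; have [h1 _] := adm.
have := rep_lin h1 c v Df (cp_mem0 HP good); rewrite addr0 (rep0 HP good h1) addr0 => ->.
by rewrite hnormZ -mulrA ler_wpM2l ?cnorm_ge0 //; exact: nu_bound.
Qed.

Lemma nuZ (c : C) f : D f -> nu (c *: f) = cnorm c * nu f.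
Proof.
move=> Df; apply/le_anti; rewrite nu_scale_le //=; have [->|c0] := eqVneq c 0.
  by rewrite cnorm0 mul0r nu_ge0 //; exact: DZ.
have := nu_scale_le c^-1 (DZ c Df); rewrite scalerA mulVf // scale1r => h.
have cp : 0 < cnorm c.
  by rewrite lt_neqAle cnorm_ge0 andbT eq_sym; apply: contra_neq c0; exact: cnorm_eq0.
have e : cnorm c * cnorm c^-1 = 1 by rewrite -cnormM divff // /cnorm normr1.
apply: le_trans (ler_wpM2l (ltW cp) h) _.
by rewrite mulrA e mul1r.
Qed.

Lemma nuD f k : D f -> D k -> nu (f + k) <= nu f + nu k.
Proof.
move=> Df Dk; apply: nu_le; [exact: DD|by rewrite addr_ge0 // nu_ge0|].
move=> V Phi adm v; have [h1 _] := adm.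
have := rep_lin h1 1 v Df Dk; rewrite !scale1r => ->.
rewrite mulrDl; apply: le_trans (hnormD _ _) _.
by apply: lerD; exact: nu_bound.
Qed.

Lemma nuM f k : D f -> D k -> nu (f ** k) <= nu f * nu k.
Proof.
move=> Df Dk; apply: nu_le; [exact: Dm|by rewrite mulr_ge0 // nu_ge0|].
move=> V Phi adm v; have [h1 _] := adm; rewrite (rep_mul h1) //.
apply: le_trans (nu_bound adm _ Df) _; rewrite -mulrA; apply: ler_wpM2l; first exact: nu_ge0.
exact: nu_bound.
Qed.

Lemma nuC f : D f -> nu (stf f ** f) = nu f ^+ 2.
Proof.
have half k : D k -> nu k ^+ 2 <= nu (stf k ** k).
  move=> Dk; have Dkk := Dm (Ds Dk) Dk; have b0 := nu_ge0 Dkk.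
  rewrite -(sqr_sqrtr b0) ler_pXn2r ?nnegrE ?sqrtr_ge0 ?nu_ge0 //.
  apply: nu_le; rewrite ?sqrtr_ge0 // => V Phi adm v; have [h1 _] := adm.
  have le : hnorm (Phi k v) ^+ 2 <= (Num.sqrt (nu (stf k ** k)) * hnorm v) ^+ 2.
    rewrite exprMn (sqr_sqrtr b0); apply: le_trans (rep_square_norm HP good h1 v Dk) _.
    rewrite expr2 mulrA; apply: ler_wpM2r; first exact: hnorm_ge0.
    exact: (nu_bound adm v Dkk).
  have q0 : 0 <= Num.sqrt (nu (stf k ** k)) * hnorm v.
    by rewrite mulr_ge0 ?sqrtr_ge0 ?hnorm_ge0.
  by move: le; rewrite ler_pXn2r ?nnegrE // hnorm_ge0.
have le1 k : D k -> nu k <= nu (stf k).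
  move=> Dk; have := le_trans (half k Dk) (nuM (Ds Dk) Dk); have := nu_ge0 Dk.
  have := nu_ge0 (Ds Dk).
  by move: (nu k) (nu _) => a b b0 a0; rewrite expr2; nra.
move=> Df; have e : nu (stf f) = nu f.
  apply/le_anti; rewrite le1 // andbT; have := le1 _ (Ds Df).
  by rewrite (cp_starK HP (cp_emem HP good Df)).
apply/le_anti; rewrite half // andbT.
by apply: le_trans (nuM (Ds Df) Df) _; rewrite e expr2.
Qed.

End UniversalNorm.

Theorem theorem4p4 (R : realType) (G : groupType) (Gam : subgroup G)
    (X : groupoid) (A : Fell_bundle R X) (alpha : Fell_action G A) :
  Hecke_pair Gam ->
  good_action alpha Gam ->
  intersection_property alpha Gam ->
  BG_star_algebra (Hecke_algebra R Gam) ->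
  forall tau : (Cc A -> Cc A) -> R,
    permissible_Cstar_norm alpha Gam tau ->
    full_crossed_product_exists alpha Gam tau.
Proof.
move=> HP good inter BG tau perm; split=> [f Df|]; first exact: norm_tau_u_fin.
split.
- by move=> f Df; split; [exact: nu_ge0|exact: nu_eq0].
- by move=> c f Df; exact: nuZ.
- by move=> f k Df Dk; exact: nuD.
- by move=> f k Df Dk; exact: nuM.
- by move=> f Df; exact: nuC.
Qed.
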